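(* Let $n\ge 2$ be an integer, let $q$ be a quadratic form on $\mathbb{Q}^{n+1}$, let $Z=Z(q_\mathbb{R})\subseteq\mathbb{P}^n(\mathbb{R})$ be the (non-empty) quadratic hypersurface it defines, and let $m$ be the Witt index of $q$. If $Z^{\mathrm{li}}$ is not empty, then \[ \hat{\lambda}(Z)=\begin{cases} 1/\rho_n & \text{if } m\le 1,\\ 1 & \text{otherwise,}\end{cases} \] where $\rho_n\in(1,2)$ is the unique positive root of $x^n-(x^{n-1}+\cdots+x+1)$. Moreover, the set $\{\xi\in Z^{\mathrm{li}}\,;\,\hat{\lambda}(\xi)=\hat{\lambda}(Z)\}$ is countably infinite if $m\le 1$ and uncountable otherwise.
   Context: A quadratic form on $\mathbb{Q}^{n+1}$ is a map $q:\mathbb{Q}^{n+1}\to\mathbb{Q}$ given by a non-zero homogeneous polynomial of degree $2$ in $\mathbb{Q}[t_0,\dots,t_n]$; $q_\mathbb{R}$ is the same polynomial on $\mathbb{R}^{n+1}$, and $Z(q_\mathbb{R})$ is its zero set in $\mathbb{P}^n(\mathbb{R})$. The associated bilinear form is $b(\mathbf{x},\mathbf{y})=q(\mathbf{x}+\mathbf{y})-q(\mathbf{x})-q(\mathbf{y})$. A hyperbolic plane is a $2$-dimensional subspace with a basis $\mathbf{x},\mathbf{y}$ such that $q(\mathbf{x})=q(\mathbf{y})=0$, $b(\mathbf{x},\mathbf{y})\ne0$. The Witt index of $q$ is the unique integer $m\ge 0$ with $\mathbb{Q}^{n+1}=\ker(q)\perp H_1\perp\cdots\perp H_m\perp W$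 (orthogonal direct sum w.r.t. $b$), where $\ker(q)=\{\mathbf{x}: b(\mathbf{x},\cdot)=0\}$, the $H_i$ are hyperbolic planes and $W$ contains no non-zero zero of $q$. $\mathbb{R}^{n+1}$ carries the standard Euclidean norm $\|\cdot\|$, and $\bigwedge^k\mathbb{R}^{n+1}$ the norm for which the $\mathbf{e}_{i_1}\wedge\cdots\wedge\mathbf{e}_{i_k}$ ($i_1<\dots<i_k$) are orthonormal. For $\xi=[\boldsymbol{\xi}]\in\mathbb{P}^n(\mathbb{R})$ and non-zero $\mathbf{x}\in\mathbb{Z}^{n+1}$, $D_\xi(\mathbf{x})=\|\mathbf{x}\wedge\boldsymbol{\xi}\|/\|\boldsymbol{\xi}\|$, and for $X\ge1$, $\mathcal{D}_\xi(X)=\min\{D_\xi(\mathbf{x}):\mathbf{x}\in\mathbb{Z}^{n+1}\setminus\{0\},\|\mathbf{x}\|\le X\}$. The exponent $\hat{\lambda}(\xi)$ is the supremum of all $\lambda\in\mathbb{R}$ such that $\mathcal{D}_\xi(X)\le X^{-\lambda}$ for all sufficiently large $X$. $Z^{\mathrm{li}}$ denotes the set of points of $Z$ whose representatives in $\mathbb{R}^{n+1}$ have coordinates linearly independent over $\mathbb{Q}$, and $\hat{\lambda}(Z)=\sup\{\hat{\lambda}(\xi):\xi\in Z^{\mathrm{li}}\}$. *)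

(* Defs.v *)
From HB Require Import structures.
From mathcomp Require Import all_boot all_order all_algebra.
From mathcomp Require Import all_classical all_reals all_analysis.
From mathcomp Require Import (canonicals, coercions) mpoly.

Set Implicit Arguments.
Unset Strict Implicit.
Unset Printing Implicit Defensive.

Import Order.TTheory GRing.Theory Num.Theory.
Import numFieldNormedType.Exports.

Local Open Scope classical_set_scope.
Local Open Scope ring_scope.

(* Only the canonical structures of [mpoly] are imported: its notations clash
   with those of MathComp-Analysis. *)
Definition quadratic_form (n : nat) (q : mpoly.mpoly n.+1 rat) : Prop :=
  q != 0 /\ q \is mpoly.ishomog1 2 mpoly.mdeg.

Definition qval (n : nat) (K : comNzRingType) (q : mpoly.mpoly n.+1 K)
    (x : 'rV[K]_n.+1) : K :=
  mpoly.meval (fun i => x 0 i) q.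

Definition qreal (R : realType) (n : nat) (q : mpoly.mpoly n.+1 rat) :
    mpoly.mpoly n.+1 R :=
  mpoly.map_mpoly ratr q.

Definition qbil (n : nat) (q : mpoly.mpoly n.+1 rat) (x y : 'rV[rat]_n.+1) : rat :=
  qval q (x + y) - qval q x - qval q y.

Definition hyperbolic_plane (n : nat) (q : mpoly.mpoly n.+1 rat)
    (H : {vspace 'rV[rat]_n.+1}) : Prop :=
  exists x y : 'rV[rat]_n.+1,
    [/\ basis_of H [:: x; y], qval q x = 0, qval q y = 0 & qbil q x y != 0].

Definition orthogonal_spaces (n : nat) (q : mpoly.mpoly n.+1 rat)
    (U V : {vspace 'rV[rat]_n.+1}) : Prop :=
  forall x y : 'rV[rat]_n.+1, x \in U -> y \in V -> qbil q x y = 0.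

Definition is_kernel (n : nat) (q : mpoly.mpoly n.+1 rat)
    (K : {vspace 'rV[rat]_n.+1}) : Prop :=
  forall x : 'rV[rat]_n.+1, x \in K <-> (forall y, qbil q x y = 0).

Definition anisotropic (n : nat) (q : mpoly.mpoly n.+1 rat)
    (W : {vspace 'rV[rat]_n.+1}) : Prop :=
  forall x : 'rV[rat]_n.+1, x \in W -> qval q x = 0 -> x = 0.

Definition is_witt_index (n : nat) (q : mpoly.mpoly n.+1 rat) (m : nat) : Prop :=
  exists (K : {vspace 'rV[rat]_n.+1}) (H : 'I_m -> {vspace 'rV[rat]_n.+1})
         (W : {vspace 'rV[rat]_n.+1}),
    [/\ is_kernel q K, forall i, hyperbolic_plane q (H i) & anisotropic q W] /\
    [/\ forall i, orthogonal_spaces q K (H i),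
        orthogonal_spaces q K W,
        forall i j, i != j -> orthogonal_spaces q (H i) (H j) &
        forall i, orthogonal_spaces q (H i) W] /\
    directv (K + (\sum_(i < m) H i) + W) /\
    (K + (\sum_(i < m) H i) + W)%VS = fullv.

(* Points of P^n(R) are the lines of R^(n+1). *)
Definition projective_space (R : realType) (n : nat) : Type :=
  {L : {vspace 'rV[R]_n.+1} | \dim L == 1%N}.

Definition line (R : realType) (n : nat) (xi : projective_space R n) :
    {vspace 'rV[R]_n.+1} := sval xi.

(* A non-zero vector on the line [xi]. *)
Definition rep (R : realType) (n : nat) (xi : projective_space R n) : 'rV[R]_n.+1 :=
  vpick (line xi).

Definition hypersurface (R : realType) (n : nat) (q : mpoly.mpoly n.+1 rat) :
    set (projective_space R n) :=
  [set xi | forall x, x \in line xi -> qval (qreal R q) x = 0].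

Arguments hypersurface R {n} q _.

Definition Q_independent (R : realType) (n : nat) (x : 'rV[R]_n.+1) : Prop :=
  forall c : 'I_n.+1 -> rat,
    \sum_(i < n.+1) ratr (c i) * x 0 i = 0 -> forall i, c i = 0.

Definition li_points (R : realType) (n : nat) (Z : set (projective_space R n)) :
    set (projective_space R n) :=
  [set xi | Z xi /\ forall x, x \in line xi -> x != 0 -> Q_independent x].

(* MathComp-Analysis's norm on ['rV[R]_n] is the max norm, hence [enorm]. *)
Definition enorm (R : realType) (n : nat) (x : 'rV[R]_n.+1) : R :=
  Num.sqrt (\sum_(i < n.+1) x 0 i ^+ 2).

(* For [i < j], the coordinate of [x /\ y] on [e_i /\ e_j]. *)
Definition wedge_coord (R : realType) (n : nat) (x y : 'rV[R]_n.+1)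
    (i j : 'I_n.+1) : R :=
  x 0 i * y 0 j - x 0 j * y 0 i.

Definition wedge_norm (R : realType) (n : nat) (x y : 'rV[R]_n.+1) : R :=
  Num.sqrt (\sum_(i < n.+1) \sum_(j < n.+1 | (i < j)%N) wedge_coord x y i j ^+ 2).

Definition Dvec (R : realType) (n : nat) (v : 'rV[R]_n.+1) (x : 'rV[int]_n.+1) : R :=
  wedge_norm (map_mx intr x) v / enorm v.

Definition Dpt (R : realType) (n : nat) (xi : projective_space R n)
    (x : 'rV[int]_n.+1) : R :=
  Dvec (rep xi) x.

(* For [1 <= X] the set is finite and non-empty, so that this [inf] is a
   minimum (lemma [Dmin_attained]). *)
Definition Dmin (R : realType) (n : nat) (xi : projective_space R n) (X : R) : R :=
  inf [set Dpt xi x | x in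
        [set x : 'rV[int]_n.+1 | x != 0 /\ enorm (map_mx intr x : 'rV[R]_n.+1) <= X]].

Definition lambda_hat (R : realType) (n : nat) (xi : projective_space R n) : \bar R :=
  ereal_sup [set l%:E | l in
              [set l : R | \forall X \near +oo, Dmin xi X <= X `^ (- l)]].

Definition lambda_hat_set (R : realType) (n : nat) (Z : set (projective_space R n)) :
    \bar R :=
  ereal_sup [set lambda_hat xi | xi in li_points Z].

Definition rho_poly (R : realType) (n : nat) : {poly R} :=
  'X^n - \sum_(i < n) 'X^i.

Lemma rep_neq0 (R : realType) (n : nat) (xi : projective_space R n) : rep xi != 0.
Proof.
rewrite /rep vpick0 -dimv_eq0; by rewrite (eqP (svalP xi)).
Qed.

Lemma mem_rep (R : realType) (n : nat) (xi : projective_space R n) :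
  rep xi \in line xi.
Proof. exact: memv_pick. Qed.

(* [Dpt] does not depend on the representative. *)
Lemma Dvec_scale (R : realType) (n : nat) (c : R) (v : 'rV[R]_n.+1)
  (x : 'rV[int]_n.+1) : c != 0 -> Dvec (c *: v) x = Dvec v x.
Proof.
move=> c0; rewrite /Dvec /wedge_norm /enorm.
have -> : \sum_(i < n.+1) (c *: v) 0 i ^+ 2 = c ^+ 2 * \sum_(i < n.+1) v 0 i ^+ 2.
  by rewrite mulr_sumr; apply: eq_bigr => i _; rewrite mxE exprMn.
have -> : \sum_(i < n.+1) \sum_(j < n.+1 | (i < j)%N)
    wedge_coord (map_mx intr x) (c *: v) i j ^+ 2 =
  c ^+ 2 * \sum_(i < n.+1) \sum_(j < n.+1 | (i < j)%N)
    wedge_coord (map_mx intr x) v i j ^+ 2.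
  rewrite mulr_sumr; apply: eq_bigr => i _; rewrite mulr_sumr.
  apply: eq_bigr => j _; rewrite -exprMn; congr (_ ^+ 2).
  by rewrite /wedge_coord [(c *: v) 0 j]mxE [(c *: v) 0 i]mxE mulrBr !(mulrCA _ c).
rewrite !(sqrtrM _ (sqr_ge0 c)) sqrtr_sqr -mulf_div divff ?mul1r//.
by rewrite normr_eq0.
Qed.

Lemma finite_int_le (k : nat) : finite_set [set z : int | `|z| <= k%:Z].
Proof.
apply: (@sub_finite_set _ _ (((fun i : nat => i%:Z) @` `I_k.+1) `|`
                             ((fun i : nat => - i%:Z) @` `I_k.+1))).
  move=> z /=; case: (intP z) => [|p|p] hp; [left|left|right].
  - by exists 0%N.
  - by exists p.+1.
  - by exists p.+1 => //=; move: hp; rewrite normrN.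
by rewrite finite_setU; split; apply: finite_image; exact: finite_II.
Qed.

Lemma finite_int_ball (R : realType) (n : nat) (X : R) :
  finite_set [set x : 'rV[int]_n.+1 | enorm (map_mx intr x : 'rV[R]_n.+1) <= X].
Proof.
pose k := Num.bound X.
have hfin : finite_set [set z : int | `|z| <= k%:Z] by exact: finite_int_le.
have [s hs] := (finite_seqP _).1 hfin.
pose S := seq_sub s.
pose F (f : {ffun 'I_n.+1 -> S}) : 'rV[int]_n.+1 := \row_i val (f i).
apply: (@sub_finite_set _ _ (F @` setT)); last first.
  by apply: finite_image; exact: finite_finset.
move=> x /= hx.
have hxs i : x 0 i \in s.
  suff : [set` s] (x 0 i) by [].
  rewrite -hs /=.
  have hi : `|(x 0 i)%:~R : R| <= X.
    apply: le_trans hx; rewrite /enorm -sqrtr_sqr ler_wsqrtr//.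
    rewrite (bigD1 i)//= mxE lerDl; apply: sumr_ge0 => j _; exact: sqr_ge0.
  have : `|(x 0 i)%:~R : R| < k%:R.
    exact: le_lt_trans hi (archi_boundP (le_trans (normr_ge0 _) hi)).
  by rewrite -intr_norm -[k%:R]/(k%:Z%:~R) ltr_int => /ltW.
exists [ffun i => SeqSub (hxs i)] => //.
by apply/rowP => i; rewrite mxE ffunE.
Qed.

Lemma Dmin_attained (R : realType) (n : nat) (xi : projective_space R n) (X : R) :
  1 <= X ->
  exists2 x : 'rV[int]_n.+1,
    x != 0 /\ enorm (map_mx intr x : 'rV[R]_n.+1) <= X & Dmin xi X = Dpt xi x.
Proof.
move=> X1.
pose A := [set x : 'rV[int]_n.+1 |
  x != 0 /\ enorm (map_mx intr x : 'rV[R]_n.+1) <= X].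
have Afin : finite_set A.
  by apply: sub_finite_set (finite_int_ball n X) => x [].
have [s hs] := (finite_seqP _).1 Afin.
have A0 : delta_mx 0 0 \in s.
  suff : [set` s] (delta_mx 0 0 : 'rV[int]_n.+1) by [].
  rewrite -hs /A /=; split.
    by apply/negP => /eqP/rowP/(_ 0); rewrite !mxE eqxx.
  rewrite /enorm (bigD1 0)//= !mxE eqxx /= expr1n big1 ?addr0 ?sqrtr1//.
  by move=> i /negPf i0; rewrite !mxE i0 expr0n.
pose f (i : seq_sub s) : R := Dpt xi (val i).
have [i _ hi] := @arg_minP _ _ _ (SeqSub A0) predT f isT.
have hAi : A (val i) by rewrite hs /=; exact: valP.
exists (val i) => //.
have hlb : lbound [set Dpt xi x | x in A] (Dpt xi (val i)).
  move=> _ [x Ax <-].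
  have xs : x \in s by move: Ax; rewrite hs.
  exact: (hi (SeqSub xs)).
apply/eqP; rewrite eq_le; apply/andP; split.
  by apply: ge_inf; [exists (Dpt xi (val i)) | exists (val i)].
by apply: lb_le_inf => //; exists (Dpt xi (val i)); exists (val i).
Qed.

(* Main.v *)
Require Import Defs.
From mathcomp Require Import all_boot all_order all_algebra.
From mathcomp Require Import all_classical all_reals all_analysis.
From mathcomp Require Import (canonicals, coercions) mpoly.
From mathcomp Require Import perm ring lra zify.

Set Implicit Arguments.
Unset Strict Implicit.
Unset Printing Implicit Defensive.

Import Order.TTheory GRing.Theory Num.Theory.
Import numFieldNormedType.Exports.

Local Open Scope classical_set_scope.
Local Open Scope ring_scope.

(** Write [q(x) = k * bf S x x] with [S] an integral symmetric matrix, and let [x_i] be the sequence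
    of minimal points of [xi], with norms [X_i] and distances [L_i] to the line of [xi].

    If [m <= 1] and the exponent exceeds [1/2], then [q(x_i) <> 0] for large [i]: otherwise the
    reflection of [x_(i+1)] in [x_i], which is integral and small, vanishes, so that almost all [x_i]
    are isotropic and pairwise orthogonal, which the Witt index excludes. Hence [X_i * L_i >> 1].
    Following the points at which the span of [x_i, x_(i+1), ...] grows, one gets a nonzero integral
    determinant of order [n+1]; in logarithms, a weighted combination of the resulting inequalities
    gives the bound [1/rho]. If it is attained, all inequalities are nearly equalities, so there are
    minimal points [y_j] with [ln |y_(j+1)| ~ rho * ln |y_j|] and distance [|y_j|^(-1+o(1))]. Then the
    order 3 minors of the reflection of [y_(j+n+1)] in [y_(j+n)] against the neighbours of [y_j] are
    integers less than [1], so this reflection is proportional to [y_j]: the point [xi] is determined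
    by [n+1] integral points, and there are countably many such points.

    Conversely, integral points [r_0, ..., r_n] with [q(r_i) = q(r_0)] and huge, rapidly increasing
    mutual products, obtained from solutions of Pell equations, are extended by the recurrence
    [r_(i+n+1) = (2 B(r_(i+n), r_i) / q(r_0)) r_(i+n) - r_i]. The lines of the [r_i] converge to a
    point of exponent [1/rho], and reflecting it in integral vectors gives infinitely many others.

    If [m >= 2], every isotropic integral [x] is orthogonal to many isotropic [y], and [N x + y] is
    again isotropic; with [N] huge at every step the lines converge to a point of exponent [1], and
    the choices of [y] and [N] allow the limit to avoid all rational hyperplanes and any given
    sequence of points. *)

(** * The quadratic form and uniform exponents *)

(** The threshold 1/2 is where the reflection becomes small: its norm is about [X_(i+1) * L_i ^ 2],
    and [L_i] is at most a constant times [X_(i+1)] to the power [-l]. The value 1/rho lies above it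
    because rho < 2. The delicate point of the equality case is precision: errors are relative to
    the largest of the [n] norms in a chain, conclusions must be relative to the smallest, so the
    growth inside a chain has to be bounded before anything is read off. In the construction, the
    quotients [2 B(r_(i+n), r_i) / q(r_0)] have to be integers. This is secured by keeping all
    points in the lattice of the [u *: e + a *: m] with [a = B e e] and [m] orthogonal to [e], where
    [a] divides every product. Pell's equation supplies points of norm [a] in it. The recurrence
    preserves this norm while the points grow, which forces the limit to be isotropic; and it can be
    run backwards, which carries the linear independence of the first [n.+1] points over to the
    coordinates of the limit. *)

Definition bf (K : comNzRingType) (m : nat) (S : 'M[K]_m) (x y : 'rV[K]_m) : K :=
  (x *m S *m y^T) 0 0.

Lemma bfDl (K : comNzRingType) (m : nat) (S : 'M[K]_m) (x y z : 'rV[K]_m) :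
  bf S (x + y) z = bf S x z + bf S y z.
Proof. by rewrite /bf !mulmxDl mxE. Qed.

Lemma bfZl (K : comNzRingType) (m : nat) (S : 'M[K]_m) c (x z : 'rV[K]_m) :
  bf S (c *: x) z = c * bf S x z.
Proof. by rewrite /bf -!scalemxAl mxE. Qed.

Lemma bfNl (K : comNzRingType) (m : nat) (S : 'M[K]_m) (x z : 'rV[K]_m) :
  bf S (- x) z = - bf S x z.
Proof. by rewrite -scaleN1r bfZl mulN1r. Qed.

Lemma bfDr (K : comNzRingType) (m : nat) (S : 'M[K]_m) (x y z : 'rV[K]_m) :
  bf S z (x + y) = bf S z x + bf S z y.
Proof. by rewrite /bf linearD /= mulmxDr mxE. Qed.

Lemma bfZr (K : comNzRingType) (m : nat) (S : 'M[K]_m) c (x z : 'rV[K]_m) :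
  bf S z (c *: x) = c * bf S z x.
Proof. by rewrite /bf linearZ /= -scalemxAr mxE. Qed.

Lemma bfNr (K : comNzRingType) (m : nat) (S : 'M[K]_m) (x z : 'rV[K]_m) :
  bf S z (- x) = - bf S z x.
Proof. by rewrite -scaleN1r bfZr mulN1r. Qed.

Definition bfE := (bfDl, bfDr, bfZl, bfZr, bfNl, bfNr).

Lemma bf0l (K : comNzRingType) (m : nat) (S : 'M[K]_m) (x : 'rV[K]_m) : bf S 0 x = 0.
Proof. by rewrite -(scale0r 0) bfZl mul0r. Qed.

Lemma bf0r (K : comNzRingType) (m : nat) (S : 'M[K]_m) (x : 'rV[K]_m) : bf S x 0 = 0.
Proof. by rewrite -(scale0r 0) bfZr mul0r. Qed.

Lemma bfC (K : comNzRingType) (m : nat) (S : 'M[K]_m) (x y : 'rV[K]_m) :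
  S^T = S -> bf S x y = bf S y x.
Proof.
move=> ST; rewrite /bf.
have -> : (x *m S *m y^T) 0 0 = (x *m S *m y^T)^T 0 0 by rewrite [RHS]mxE.
by rewrite !trmx_mul trmxK ST mulmxA.
Qed.

Lemma bf_map (K L : comNzRingType) (f : {rmorphism K -> L}) (m : nat)
  (S : 'M[K]_m) (x y : 'rV[K]_m) :
  bf (map_mx f S) (map_mx f x) (map_mx f y) = f (bf S x y).
Proof. by rewrite /bf map_trmx -!map_mxM mxE. Qed.

Lemma bf_sum (K : comNzRingType) (m : nat) (S : 'M[K]_m) (x y : 'rV[K]_m) :
  bf S x y = \sum_i \sum_j x 0 i * S i j * y 0 j.
Proof.
rewrite /bf mxE exchange_big /=; apply: eq_bigr => j _.
by rewrite !mxE mulr_suml.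
Qed.

Lemma bf_neq0P (K : comNzRingType) (m : nat) (S : 'M[K]_m) (x : 'rV[K]_m) :
  (forall y, bf S x y = 0) <-> x *m S = 0.
Proof.
split=> [h|h y]; last by rewrite /bf h mul0mx mxE.
apply/rowP => j; rewrite [RHS]mxE -(h (delta_mx 0 j)) /bf trmx_delta.
by rewrite -matrix.colE !mxE.
Qed.

Section Norm.
Context (R : realType) (n : nat).
Implicit Types x y v : 'rV[R]_n.+1.

Lemma norm_coord x i : `|x 0 i| <= `|x|.
Proof.
rewrite [leRHS]mx_normrE.
exact: (le_bigmax _ (fun i : 'I_1 * 'I_n.+1 => `|x i.1 i.2|) (0, i)).
Qed.

Lemma norm_le_coord x M : (forall i, `|x 0 i| <= M) -> `|x| <= M.
Proof.
move=> h; rewrite [leLHS]mx_normrE; apply/bigmax_leP; split.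
  by apply: le_trans (h 0).
by move=> [i j] _ /=; rewrite ord1; exact: h.
Qed.

Lemma bf_bound (S : 'M[R]_n.+1) : {C : R | 0 < C & forall x y, `|bf S x y| <= C * `|x| * `|y|}.
Proof.
exists (1 + \sum_i \sum_j `|S i j|).
  by rewrite ltr_pwDl// sumr_ge0// => i _; rewrite sumr_ge0.
move=> x y; rewrite bf_sum.
apply: le_trans (_ : (\sum_i \sum_j `|S i j|) * `|x| * `|y| <= _); last first.
  by rewrite !ler_wpM2r// lerDr.
rewrite -mulrA mulr_suml; apply: le_trans (ler_norm_sum _ _ _) _; apply: ler_sum => i _.
rewrite mulr_suml; apply: le_trans (ler_norm_sum _ _ _) _; apply: ler_sum => j _.
rewrite !normrM [leLHS](_ : _ = `|S i j| * (`|x 0 i| * `|y 0 j|)); last by ring.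
by rewrite ler_wpM2l//; apply: ler_pM => //; exact: norm_coord.
Qed.

Lemma enorm_ge x : `|x| <= enorm x.
Proof.
apply: norm_le_coord => i; rewrite /enorm -sqrtr_sqr ler_wsqrtr//.
rewrite (bigD1 i)//= lerDl; apply: sumr_ge0 => j _; exact: sqr_ge0.
Qed.

Lemma enorm_le x : enorm x <= n.+1%:R * `|x|.
Proof.
rewrite /enorm -(@ger0_norm _ (n.+1%:R * `|x|)) ?mulr_ge0// -sqrtr_sqr ler_wsqrtr//.
apply: le_trans (_ : \sum_(i < n.+1) `|x| ^+ 2 <= _).
  apply: ler_sum => i _; rewrite -[x 0 i ^+ 2]ger0_norm ?sqr_ge0// normrX.
  by rewrite ler_pXn2r ?nnegrE//; exact: norm_coord.
rewrite sumr_const card_ord exprMn -(mulr_natl (`|x| ^+ 2)) ler_wpM2r ?sqr_ge0//.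
by rewrite expr2 ler_peMl// ler1n.
Qed.

Lemma enorm_gt0 x : x != 0 -> 0 < enorm x.
Proof. by move=> x0; apply: lt_le_trans (enorm_ge x); rewrite normr_gt0. Qed.

Lemma wedge_norm_le x v t :
  wedge_norm x v <= 2 * n.+1%:R * `|x - t *: v| * `|v|.
Proof.
set K := _ * `|v|; have K0 : 0 <= K by rewrite /K !mulr_ge0.
rewrite /wedge_norm -(ger0_norm K0) -sqrtr_sqr ler_wsqrtr//.
have hij i j : wedge_coord x v i j ^+ 2 <= (2 * `|x - t *: v| * `|v|) ^+ 2.
  rewrite -[_ ^+ 2]ger0_norm ?sqr_ge0// normrX ler_pXn2r ?nnegrE ?mulr_ge0//.
  have -> : wedge_coord x v i j = (x - t *: v) 0 i * v 0 j - (x - t *: v) 0 j * v 0 i.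
    by rewrite /wedge_coord !mxE; ring.
  apply: le_trans (ler_normB _ _) _; rewrite !normrM -mulrA mulr2n mulrDl !mul1r.
  by apply: lerD; apply: ler_pM => //; exact: norm_coord.
apply: le_trans (_ : \sum_(i < n.+1) \sum_(j < n.+1) (2 * `|x - t *: v| * `|v|) ^+ 2 <= _).
  apply: ler_sum => i _; rewrite [leRHS](bigID (fun j : 'I_n.+1 => (i < j)%N))/=.
  rewrite -[leLHS]addr0; apply: lerD; first by apply: ler_sum => j _; exact: hij.
  by apply: sumr_ge0 => j _; exact: sqr_ge0.
rewrite !sumr_const !card_ord /K; set w := (_ * _) ^+ 2.
rewrite (_ : _ ^+ 2 = n.+1%:R * (n.+1%:R * w)); last by rewrite /w; ring.
by rewrite !mulr_natl.
Qed.

Lemma wedge_norm_ge x v i j : `|wedge_coord x v i j| <= wedge_norm x v.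
Proof.
wlog ij : i j / (i < j)%N => [h|].
  case: (ltngtP i j) => [||/val_inj->]; first exact: h.
    by move=> ji; rewrite /wedge_coord distrC; exact: h.
  by rewrite /wedge_coord subrr normr0 sqrtr_ge0.
rewrite /wedge_norm -sqrtr_sqr ler_wsqrtr//.
rewrite (bigD1 i)//= (bigD1 j)//= -addrA lerDl addr_ge0//.
  by apply: sumr_ge0 => k _; exact: sqr_ge0.
by apply: sumr_ge0 => k _; apply: sumr_ge0 => l _; exact: sqr_ge0.
Qed.

(* The logarithmic form of [D_xi(X) <= X^-l], up to constants, with [X = exp T]. *)
Definition unif v (l : R) : Prop := exists T0 : R, forall T, T0 <= T ->
  exists (x : 'rV[int]_n.+1) (t : R), [/\ x != 0, `|map_mx intr x : 'rV[R]_n.+1| <= expR T &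
    `|map_mx intr x - t *: v| <= expR (- (l * T))].

Lemma unif_scale c v l : c != 0 -> unif v l -> unif (c *: v) l.
Proof.
move=> c0 [T0 h]; exists T0 => T /h[x [t [? ? ?]]]; exists x, (t / c); split => //.
by rewrite scalerA divfK.
Qed.

Lemma unif_le v l l' : l' <= l -> unif v l -> unif v l'.
Proof.
move=> ll [T0 h]; exists (Num.max T0 0) => T; rewrite ge_max => /andP[/h[x [t [? ? hx]]] T0'].
exists x, t; split => //; apply: le_trans hx _.
by rewrite ler_expR lerN2 ler_wpM2r.
Qed.

Lemma expR_absorb (C e : R) : 0 < e -> exists T0, forall T, T0 <= T -> C <= expR (e * T).
Proof.
move=> e0; exists (`|C| / e) => T; rewrite ler_pdivrMr// mulrC => h.
apply: le_trans (ler_norm C) _; apply: le_trans h _.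
by apply: le_trans (expR_ge1Dx _); rewrite lerDr.
Qed.

(** Passing from the wedge norm to the maximum norm with a free multiple [t] costs constant factors
    only. They are absorbed by lowering [l] to [l'], which a supremum does not notice. *)
Lemma unif_of_Dmin (xi : projective_space R n) l l' :
  (\forall X \near +oo, Dmin xi X <= X `^ (- l)) -> l' < l -> unif (rep xi) l'.
Proof.
move=> [X0 [X0r hX]] ll.
have v0 := rep_neq0 xi; set v := rep xi in v0 *.
have [k vk] : exists k, v 0 k != 0 by apply/rV0Pn.
pose C := enorm v / `|v 0 k|.
have [T1 hT1] := @expR_absorb C (l - l') ltac:(by rewrite subr_gt0).
(* The entry 1 + |X0| ensures [X0 < expR T], as [expR T] is at least [1 + T]. *)
exists (Num.max T1 (Num.max 0 (1 + `|X0|))) => T; rewrite !ge_max => /and3P[h1 h2 h3].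
have X1 : 1 <= expR T by rewrite -expR0 ler_expR.
have [x [x0 xX] hx] := Dmin_attained xi X1.
have hD : Dpt xi x <= expR (- (l * T)).
  rewrite -hx; have -> : expR (- (l * T)) = expR T `^ (- l).
    by rewrite -expRM mulrN mulrC.
  apply: hX; apply: le_lt_trans (_ : `|X0| < _); first exact: ler_norm.
  apply: lt_le_trans (_ : T + 1 <= _); last by rewrite addrC expR_ge1Dx.
  by apply: lt_le_trans (_ : T <= _); [apply: lt_le_trans h3; rewrite ltrDr|rewrite lerDl].
exists x, ((map_mx intr x : 'rV[R]_n.+1) 0 k / v 0 k); split => //.
  exact: le_trans (enorm_ge _) xX.
apply: le_trans (_ : C * Dpt xi x <= _).
  apply: norm_le_coord => i.
  have -> : (map_mx intr x - ((map_mx intr x : 'rV[R]_n.+1) 0 k / v 0 k) *: v) 0 i =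
     wedge_coord (map_mx intr x) v i k / v 0 k.
    by rewrite /wedge_coord !mxE; field.
  rewrite normrM normfV /C /Dpt /Dvec -/v.
  have ev : enorm v != 0 by rewrite gt_eqF ?enorm_gt0.
  have -> : enorm v / `|v 0 k| * (wedge_norm (map_mx intr x) v / enorm v) =
    wedge_norm (map_mx intr x) v / `|v 0 k| by field; rewrite normr_eq0 vk ev.
  by rewrite ler_wpM2r ?invr_ge0//; exact: wedge_norm_ge.
apply: le_trans (_ : expR ((l - l') * T) * expR (- (l * T)) <= _).
  apply: ler_pM (hT1 _ h1) hD; first by rewrite divr_ge0// sqrtr_ge0.
  by rewrite /Dpt /Dvec divr_ge0// sqrtr_ge0.
by rewrite -expRD ler_expR; lra.
Qed.

Lemma Dmin_of_unif (xi : projective_space R n) l l' :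
  unif (rep xi) l -> l' < l -> \forall X \near +oo, Dmin xi X <= X `^ (- l').
Proof.
move=> [T0 h] ll; have v0 := rep_neq0 xi; set v := rep xi in h v0 *.
pose c := ln (n.+1%:R : R).
have ec : expR c = n.+1%:R by rewrite lnK// posrE.
pose C := 2 * n.+1%:R * `|v| / enorm v * expR (l * c).
have [T1 hT1] := @expR_absorb C (l - l') ltac:(by rewrite subr_gt0).
exists (Num.max (expR T1) (Num.max 1 (expR (T0 + c)))); split; first exact: num_real.
move=> X; rewrite !gt_max => /and3P[h1 h2 h3].
have X0 : 0 < X by apply: lt_trans h2.
pose T := ln X; have eT : expR T = X by rewrite lnK.
move: h1 h3; rewrite -eT !ltr_expR => h1 h3.
(* The Euclidean norm is at most [n.+1] times the maximum norm, so the point is sought at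
   [T - c]. *)
have /h[x [t [x0 xX hx]]] : T0 <= T - c by rewrite lerBrDr ltW.
have xA : enorm (map_mx intr x : 'rV[R]_n.+1) <= expR T.
  apply: le_trans (enorm_le _) _; rewrite -[leRHS](_ : expR c * expR (T - c) = _).
    by rewrite ec ler_wpM2l.
  by rewrite -expRD addrC subrK.
apply: le_trans (_ : Dpt xi x <= _).
  apply: ge_inf; first by exists 0 => _ [y _ <-]; rewrite /Dpt /Dvec divr_ge0// sqrtr_ge0.
  by exists x.
have -> : expR T `^ (- l') = expR (- (l' * T)) by rewrite -expRM mulrN mulrC.
rewrite /Dpt /Dvec -/v; apply: le_trans (_ : 2 * n.+1%:R * `|map_mx intr x - t *: v| * `|v| / enorm v <= _).
  by rewrite ler_wpM2r ?invr_ge0 ?sqrtr_ge0//; exact: wedge_norm_le.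
apply: le_trans (_ : C * expR (- (l * T)) <= _).
  rewrite /C [leLHS](_ : _ = 2 * n.+1%:R * `|v| / enorm v * `|map_mx intr x - t *: v|); last by ring.
  rewrite -[leRHS]mulrA ler_wpM2l ?divr_ge0 ?mulr_ge0 ?sqrtr_ge0//.
  by apply: le_trans hx _; rewrite -expRD ler_expR; lra.
apply: le_trans (_ : expR ((l - l') * T) * expR (- (l * T)) <= _).
  by rewrite ler_wpM2r ?expR_ge0//; apply: hT1; exact: ltW.
by rewrite -expRD ler_expR; lra.
Qed.

Lemma lambda_hat_ge (xi : projective_space R n) (mu : R) :
  (forall l, l < mu -> unif (rep xi) l) -> (mu%:E <= lambda_hat xi)%E.
Proof.
move=> h; apply/lee_addgt0Pr => e e0; rewrite -leeBlDr//.
apply: ereal_sup_ubound; exists (mu - e) => //=.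
by apply: (@Dmin_of_unif _ (mu - e / 2)); [apply: h; lra|lra].
Qed.

Lemma lambda_hat_le (xi : projective_space R n) (mu : R) :
  (forall l, mu < l -> ~ unif (rep xi) l) -> (lambda_hat xi <= mu%:E)%E.
Proof.
move=> h; apply: ge_ereal_sup => _ [l /= hl <-]; rewrite lee_fin leNgt; apply/negP => ml.
by apply: (h ((mu + l) / 2)); [lra|apply: unif_of_Dmin hl _; lra].
Qed.

Lemma unif_of_lambda_hat (xi : projective_space R n) (mu l : R) :
  lambda_hat xi = mu%:E -> l < mu -> unif (rep xi) l.
Proof.
move=> h lm; have : (l%:E < lambda_hat xi)%E by rewrite h lte_fin.
by move=> /ereal_sup_gt[_ [l' /= hl' <-]]; rewrite lte_fin; exact: unif_of_Dmin.
Qed.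

End Norm.

(** * An integral matrix for the form *)

(** The factor [(i == j).+1] counts a square twice, as the right-hand side does. One formula then
    gives both the diagonal entries and the halved off-diagonal entries of the symmetric matrix of
    the form. *)
Lemma mnm2_eq (n : nat) (i j a b : 'I_n) :
  ((i == j).+1 * (mpoly.mnm_add (mpoly.mnm1 i) (mpoly.mnm1 j)
     == mpoly.mnm_add (mpoly.mnm1 a) (mpoly.mnm1 b)) =
   ((i == a) && (j == b)) + ((i == b) && (j == a)))%N.
Proof.
have hE k l m : mpoly.mnm_add (mpoly.mnm1 k) (mpoly.mnm1 l) m = ((k == m) + (l == m))%N.
  by rewrite mpoly.mnmDE !mpoly.mnm1E.
case: (mpoly.mnm_add (mpoly.mnm1 i) (mpoly.mnm1 j) =P
  mpoly.mnm_add (mpoly.mnm1 a) (mpoly.mnm1 b)) => [e|h].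
  have h k : mpoly.mnm_add (mpoly.mnm1 i) (mpoly.mnm1 j) k =
    mpoly.mnm_add (mpoly.mnm1 a) (mpoly.mnm1 b) k by rewrite e.
  have := h i; have := h j; have := h a; have := h b; rewrite !hE !eqxx.
  rewrite (eq_sym j i) (eq_sym b a) (eq_sym a i) (eq_sym a j) (eq_sym b i) (eq_sym b j).
  by do ?case: eqP => //=; move=> *; subst.
rewrite muln0; apply/esym/eqP; rewrite addn_eq0 !eqb0; apply/andP; split.
  by apply/negP => /andP[/eqP ia /eqP jb]; apply: h; rewrite ia jb.
by apply/negP => /andP[/eqP ib /eqP ja]; apply: h; rewrite ib ja mpoly.addmC.
Qed.

Lemma mdeg2P (n : nat) (m : mpoly.multinom n) : mpoly.mdeg m = 2%N ->
  exists a b, m = mpoly.mnm_add (mpoly.mnm1 a) (mpoly.mnm1 b).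
Proof.
move=> h; have /existsP[a ha] : [exists i, m i != 0%N].
  apply/contraT; rewrite negb_exists => /forallP h0.
  by move: h; rewrite mpoly.mdegE big1// => i _; apply/eqP; rewrite -[_ == _]negbK.
have ma : mpoly.mnm_add (mpoly.mnm_sub m (mpoly.mnm1 a)) (mpoly.mnm1 a) = m.
  by apply/mpoly.submK/mpoly.mnm_lepP => i; rewrite mpoly.mnm1E; case: eqP => // <-; rewrite lt0n.
have /eqP/mpoly.mdeg1P[b /eqP hb] : mpoly.mdeg (mpoly.mnm_sub m (mpoly.mnm1 a)) = 1%N.
  by move: h; rewrite -{1}ma mpoly.mdegD mpoly.mdeg1 => /eqP; rewrite addn1 eqSS => /eqP.
by exists b, a; rewrite -hb ma.
Qed.

Lemma int_scale (m n : nat) (A : 'M[rat]_(m, n)) :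
  exists (S : 'M[int]_(m, n)) (d : int), d != 0 /\ map_mx intr S = d%:~R *: A.
Proof.
pose d i j := denq (A i j).
pose D : int := \prod_i \prod_j d i j.
have D0 : D != 0 by apply/prodf_neq0 => i _; apply/prodf_neq0 => j _; exact: denq_neq0.
have hA i j : {z : int | z%:~R = D%:~R * A i j}.
  exists (numq (A i j) * \prod_(k | k != j) d i k * \prod_(l | l != i) \prod_k d l k).
  have -> : D = d i j * \prod_(k | k != j) d i k * \prod_(l | l != i) \prod_k d l k.
    by rewrite /D (bigD1 i)//= (bigD1 j).
  rewrite !rmorphM /=.
  rewrite -[in RHS](divq_num_den (A i j)) /d.
  have : (denq (A i j))%:~R != 0 :> rat by rewrite intr_eq0 denq_neq0.
  by move=> ?; field.
exists (\matrix_(i, j) sval (hA i j)), D; split => //.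
by apply/matrixP => i j; rewrite !mxE; case: (hA i j).
Qed.

Lemma quad_matrix_rat (n : nat) (q : mpoly.mpoly n.+1 rat) : quadratic_form q ->
  exists A : 'M[rat]_n.+1, [/\ A^T = A, A != 0,
    forall x, qval q x = bf A x x &
    forall (R : realType) x, qval (qreal R q) x = bf (map_mx ratr A) x x].
Proof.
move=> [q0 /mpoly.dhomogP hq].
pose c i j := mpoly.mcoeff (mpoly.mnm_add (mpoly.mnm1 i) (mpoly.mnm1 j)) q.
pose A := \matrix_(i, j) (c i j * (i == j).+1%:R / 2) : 'M[rat]_n.+1.
(* Stated for any field receiving the rationals, since both the rational and the real values are
   needed. *)
have main (K : fieldType) (f : {rmorphism rat -> K}) (x : 'rV[K]_n.+1) :
  (2 : K) != 0 ->
  \sum_(m <- mpoly.msupp q) f (mpoly.mcoeff m q) * \prod_i x 0 i ^+ m i =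
  bf (map_mx f A) x x.
  move=> K2; rewrite bf_sum.
  transitivity (\sum_i \sum_j \sum_(m <- mpoly.msupp q)
     x 0 i * (f (mpoly.mcoeff m q) * ((i == j).+1 * (mpoly.mnm_add (mpoly.mnm1 i) (mpoly.mnm1 j) == m))%:R / 2) * x 0 j); last first.
    apply: eq_bigr => i _; apply: eq_bigr => j _; rewrite -mulr_suml -mulr_sumr.
    congr (_ * _ * _); rewrite !mxE /c !rmorphM /= fmorphV /= !rmorph_nat -mulr_suml; congr (_ / _).
    case: (boolP (mpoly.mnm_add (mpoly.mnm1 i) (mpoly.mnm1 j) \in mpoly.msupp q)) => hm.
      rewrite (bigD1_seq _ hm (mpoly.msupp_uniq _)) /= eqxx muln1 big1 ?addr0// => m /negPf hne.
      by rewrite [_ == m]eq_sym hne muln0 mulr0.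
    rewrite big_seq big1 ?(mpoly.memN_msupp_eq0 hm) ?rmorph0 ?mul0r// => m hm'.
    by case: (mpoly.mnm_add (mpoly.mnm1 i) (mpoly.mnm1 j) =P m) => [e|_]; [move: hm; rewrite e hm'|rewrite muln0 mulr0].
  under [RHS]eq_bigr do rewrite exchange_big /=.
  rewrite exchange_big /= big_seq [RHS]big_seq; apply: eq_bigr => m hm.
  have [a [b em]] := mdeg2P (hq _ hm).
  have -> : \prod_i x 0 i ^+ m i = x 0 a * x 0 b.
    rewrite em; under eq_bigr do rewrite mpoly.mnmDE !mpoly.mnm1E exprD.
    rewrite big_split /= (bigD1 a)//= (bigD1 (P := xpredT) b)//= !eqxx !expr1.
    rewrite [X in _ * X * _]big1 ?[X in _ * _ * (_ * X)]big1 ?mulr1// => i; rewrite eq_sym => /negPf -> //.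
  set F := f _.
  transitivity (\sum_i \sum_j F / 2 * (((i == a) && (j == b))%:R * (x 0 i * x 0 j) + ((i == b) && (j == a))%:R * (x 0 i * x 0 j))); last first.
    apply: eq_bigr => i _; apply: eq_bigr => j _; rewrite em mnm2_eq natrD; ring.
  have hs (u v : 'I_n.+1) : \sum_i \sum_j ((i == u) && (j == v))%:R * (x 0 i * x 0 j) = x 0 u * x 0 v.
    rewrite (bigD1 u)//= (bigD1 v)//= !eqxx mul1r big1 ?addr0.
      by rewrite big1 ?addr0// => i /negPf -> /=; rewrite big1// => j _; rewrite mul0r.
    by move=> j /negPf ->; rewrite mul0r.
  under eq_bigr do rewrite -mulr_sumr big_split.
  rewrite -mulr_sumr big_split /= !hs; by field.
exists A; split.
- apply/matrixP => i j; rewrite !mxE /c mpoly.addmC eq_sym; congr (_ * _ / _).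
- apply/eqP => A0; case/eqP: q0; apply/mpoly.mpolyP => m; rewrite mpoly.mcoeff0.
  case: (boolP (m \in mpoly.msupp q)) => hm; last exact: mpoly.memN_msupp_eq0.
  have [a [b em]] := mdeg2P (hq _ hm).
  move/matrixP: A0 => /(_ a b); rewrite !mxE /c -em => /eqP.
  by rewrite !mulf_eq0 invr_eq0 !pnatr_eq0 !orbF => /eqP.
- move=> x; have := main _ (idfun : {rmorphism rat -> rat}) x ltac:(by []).
  by rewrite (_ : map_mx _ A = A) => [<-//|]; apply/matrixP => i j; rewrite mxE.
- move=> R x; have := main _ (ratr : {rmorphism rat -> R}) x ltac:(by rewrite pnatr_eq0).
  move=> <-; rewrite /qval /qreal mpoly.mevalE.
  rewrite (perm_big _ (mpoly.msupp_map_mpoly _ (fmorph_inj _)))/=.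
  by apply: eq_bigr => m _; rewrite mpoly.mcoeff_map_mpoly.
Qed.

Lemma quad_matrix (n : nat) (q : mpoly.mpoly n.+1 rat) : quadratic_form q ->
  exists (S : 'M[int]_n.+1) (k : rat), [/\ S^T = S, S != 0, k != 0,
    forall x, qval q x = k * bf (map_mx intr S) x x &
    forall (R : realType) x, qval (qreal R q) x = ratr k * bf (map_mx intr S) x x].
Proof.
move=> /quad_matrix_rat[A [AT A0 hA hR]].
have [S [d [d0 hS]]] := int_scale A.
have d0' : d%:~R != 0 :> rat by rewrite intr_eq0.
have inj : injective (fun z : int => z%:~R : rat) by exact: intr_inj.
exists S, (d%:~R^-1); split.
- apply/matrixP => i j; apply: inj; move/matrixP: hS => hS.
  by move: (hS i j) (hS j i); rewrite !mxE => -> ->; rewrite -{1}AT mxE.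
- apply: contraNneq A0 => S0; apply/eqP.
  move: hS; rewrite S0 map_mx0 => /esym/eqP; rewrite scaler_eq0 (negPf d0')/=.
  by move/eqP.
- by rewrite invr_eq0.
- by move=> x; rewrite hA hS /bf -scalemxAr -scalemxAl [in RHS]mxE mulKf.
- move=> R x; rewrite hR.
  have -> : map_mx intr S = d%:~R *: map_mx ratr A :> 'M[R]_n.+1.
    apply/matrixP => i j; move/matrixP: hS => /(_ i j); rewrite !mxE => h.
    by rewrite -[in RHS](ratr_int R) -rmorphM /= -h ratr_int.
  rewrite /bf -scalemxAr -scalemxAl [in RHS]mxE.
  have -> : ratr (d%:~R^-1) = (d%:~R)^-1 :> R by rewrite fmorphV /= ratr_int.
  by rewrite mulKf// intr_eq0.
Qed.

(** * Minimal points *)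

Lemma Q_independentP (R : realType) (n : nat) (v : 'rV[R]_n.+1) :
  Q_independent v <-> (forall l : 'cV[int]_n.+1, v *m map_mx intr l = 0 -> l = 0).
Proof.
split=> [h l hl|h c hc].
  have hh : forall i, (l i 0)%:~R = 0 :> rat.
    apply: (h (fun i => (l i 0)%:~R)).
    transitivity ((v *m map_mx intr l) 0 0); last by rewrite hl mxE.
    by rewrite mxE; apply: eq_bigr => i _; rewrite !mxE ratr_int mulrC.
  by apply/colP => i; apply/eqP; rewrite mxE -(intr_eq0 rat); apply/eqP.
have [l [d [d0 hl]]] := int_scale (\col_i c i).
have l0 : l = 0.
  apply: h; apply/matrixP => i j; rewrite !ord1 !mxE.
  transitivity (d%:~R * \sum_(i < n.+1) ratr (c i) * v 0 i); last by rewrite hc mulr0.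
  rewrite mulr_sumr; apply: eq_bigr => k _; rewrite mxE.
  move/colP: hl => /(_ k); rewrite !mxE => /(congr1 (ratr : rat -> R)).
  by rewrite rmorphM /= !ratr_int => ->; ring.
move=> i; move/colP: hl => /(_ i); rewrite l0 !mxE => /esym/eqP.
by rewrite mulf_eq0 intr_eq0 (negPf d0) => /eqP.
Qed.

Lemma Q_independentZ (R : realType) (n : nat) (v : 'rV[R]_n.+1) c :
  c != 0 -> Q_independent v -> Q_independent (c *: v).
Proof.
move=> c0 /Q_independentP h; apply/Q_independentP => l; rewrite -scalemxAl => /eqP.
by rewrite scaler_eq0 (negPf c0) => /eqP/h.
Qed.

Lemma Q_independent_coord_neq0 (R : realType) (n : nat) (v : 'rV[R]_n.+1) i :
  Q_independent v -> v 0 i != 0.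
Proof.
move=> /Q_independentP h; apply/eqP => vi.
have /h/colP/(_ i)/eqP : v *m map_mx intr (delta_mx i 0 : 'cV[int]_n.+1) = 0.
  by rewrite map_delta_mx -matrix.colE; apply/matrixP => a b; rewrite !ord1 !mxE.
by rewrite !mxE !eqxx.
Qed.

(* For [v] normalised by [v 0 0 = 1], this is within constant factors of the distance from [x] to the
   line of [v]. *)
Definition dist (R : realType) (n : nat) (v : 'rV[R]_n.+1) (x : 'rV[int]_n.+1) : R :=
  `|map_mx intr x - (x 0 0)%:~R *: v|.

Section Minimal.
Context (R : realType) (n : nat) (v : 'rV[R]_n.+1).
Hypothesis v0 : v 0 0 = 1.
Local Notation iv x := (map_mx intr x : 'rV[R]_n.+1).
Implicit Types x y z : 'rV[int]_n.+1.

Lemma dist_ge0 x : 0 <= dist v x. Proof. exact: normr_ge0. Qed.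

Lemma dist_le x t : dist v x <= (1 + `|v|) * `|iv x - t *: v|.
Proof.
rewrite /dist; have -> : iv x - (x 0 0)%:~R *: v =
   (iv x - t *: v) - (iv x - t *: v) 0 0 *: v.
  by apply/rowP => i; rewrite !mxE v0; ring.
apply: le_trans (ler_normB _ _) _; rewrite mulrDl mul1r lerD2l normrZ mulrC.
by rewrite ler_wpM2l//; exact: norm_coord.
Qed.

Lemma dist_gt0 x : Q_independent v -> (0 < n)%N -> x != 0 -> 0 < dist v x.
Proof.
move=> li n0 x0; rewrite lt_neqAle dist_ge0 andbT eq_sym; apply: contra x0.
rewrite normr_eq0 subr_eq0 => /eqP e.
suff x00 : x 0 0 = 0.
  apply/eqP/rowP => i; apply/eqP; rewrite mxE -(intr_eq0 R).
  by move/rowP: e => /(_ i); rewrite !mxE x00 mul0r => ->.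
pose i1 : 'I_n.+1 := inord 1.
have i1n : (0 == i1) = false by rewrite -val_eqE /= inordK.
(* The integral form [x_1 t_0 - x_0 t_1] vanishes at [v], so its coefficient [x_0] is 0. *)
move/Q_independentP: li => /(_ (x 0 i1 *: delta_mx 0 0 - x 0 0 *: delta_mx i1 0)).
move=> /(_ _)/colP/(_ i1); rewrite !mxE !eqxx (eq_sym i1) i1n /= mulr0 mulr1 sub0r.
move=> h; apply/eqP; rewrite -oppr_eq0; apply/eqP/h.
rewrite map_mxB !map_mxZ !map_delta_mx /= mulmxBr -!scalemxAr -!matrix.colE.
apply/matrixP => a b; rewrite !ord1 !mxE v0 mulr1.
by move/rowP: e => /(_ i1); rewrite !mxE => ->; rewrite subrr.
Qed.

Lemma norm_iv x : exists k : nat, `|iv x| = k%:R.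
Proof.
have [->|x0] := eqVneq (iv x) 0; first by exists 0%N; rewrite normr0.
have [[i j] ->] : exists i, `|iv x| = `|iv x i.1 i.2| by apply: mx_norm_neq0; move: x0; rewrite -normr_eq0.
by exists `|x i j|%N; rewrite mxE -intr_norm -abszE.
Qed.

Lemma norm_iv_ge1 x : x != 0 -> 1 <= `|iv x|.
Proof.
move=> x0; have [k hk] := norm_iv x; rewrite hk ler1n lt0n.
apply: contra x0 => /eqP k0; move: hk; rewrite k0 => /eqP; rewrite normr_eq0 => /eqP/rowP h.
by apply/eqP/rowP => i; move: (h i); rewrite !mxE => /eqP; rewrite intr_eq0 => /eqP.
Qed.

Lemma wedge_int_bound x y a b :
  `|(x 0 a * y 0 b - x 0 b * y 0 a)%:~R : R| <= 2 * (`|iv x| * dist v y + `|v| * `|iv y| * dist v x).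
Proof.
pose e z : 'rV[R]_n.+1 := iv z - (z 0 0)%:~R *: v.
have -> : (x 0 a * y 0 b - x 0 b * y 0 a)%:~R =
   (iv x 0 a * e y 0 b - iv x 0 b * e y 0 a) + iv y 0 0 * (e x 0 a * v 0 b - e x 0 b * v 0 a).
  by rewrite /e !mxE rmorphB !rmorphM /=; ring.
have prod_le (c d s t : R) : `|c| <= s -> `|d| <= t -> `|c * d| <= s * t.
  by move=> ? ?; rewrite normrM ler_pM.
apply: le_trans (ler_normD _ _) _; rewrite [leRHS]mulrDr; apply: lerD.
  apply: le_trans (ler_normB _ _) _; rewrite mulr2n mulrDl mul1r.
  by apply: lerD; apply: (prod_le _ _ _ _); exact: norm_coord.
rewrite [leRHS](_ : _ = `|iv y| * (dist v x * `|v| + dist v x * `|v|)); last by ring.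
apply: (prod_le _ _ _ _); first exact: norm_coord.
apply: le_trans (ler_normB _ _) _.
by apply: lerD; apply: (prod_le _ _ _ _); exact: norm_coord.
Qed.

Lemma wedge_eq0 x y : y != 0 -> (forall a b, x 0 a * y 0 b = x 0 b * y 0 a) ->
  exists c : R, iv x = c *: iv y.
Proof.
move=> /rV0Pn[b yb] h; exists ((x 0 b)%:~R / (y 0 b)%:~R).
apply/rowP => a; rewrite !mxE mulrAC -rmorphM /= -h rmorphM /= mulfK//.
by rewrite intr_eq0.
Qed.

(** Norms increase only weakly: the successor of a point has least norm among the strictly closer
    ones, but it need not be the closest of that norm. *)
Definition minimal_seq (x : nat -> 'rV[int]_n.+1) : Prop :=
  [/\ forall i, x i != 0, forall i, `|iv (x i)| <= `|iv (x i.+1)|,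
     forall i, dist v (x i.+1) < dist v (x i) &
     forall i z, z != 0 -> `|iv z| < `|iv (x i.+1)| -> dist v (x i) <= dist v z].

Lemma unif_dist l : unif v l -> exists T0, forall T, T0 <= T ->
  exists x, [/\ x != 0, `|iv x| <= expR T & dist v x <= (1 + `|v|) * expR (- (l * T))].
Proof.
move=> [T0 h]; exists T0 => T /h[x [t [? ? ht]]]; exists x; split => //.
by apply: le_trans (dist_le x t) _; rewrite ler_wpM2l// addr_ge0.
Qed.

Lemma minimal_seq_exists l : Q_independent v -> (0 < n)%N -> 0 < l -> unif v l ->
  exists s, minimal_seq s.
Proof.
move=> li n0 l0 /unif_dist[T0 hT].
(* Maximum norms of integral points are natural numbers, so a least one exists. *)
pose nn z := xget 0%N [set k | `|iv z| = k%:R].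
have hnn z : `|iv z| = (nn z)%:R.
  by have [k hk] := norm_iv z; rewrite /nn; case: xgetP => [j _ //|/(_ k)].
pose P x y := [/\ y != 0, dist v y < dist v x & forall z, z != 0 -> dist v z < dist v x ->
   (nn y <= nn z)%N].
pose NZ := {x : 'rV[int]_n.+1 | x != 0}.
have step (x : NZ) : exists y : NZ, P (val x) (val y).
  case: x => x x0 /=; have e0 := dist_gt0 li n0 x0.
  have [T1 hT1] := expR_absorb ((1 + `|v|) / dist v x + 1) l0.
  have ex : exists k, `[< exists z, [/\ z != 0, dist v z < dist v x & nn z = k] >].
    have [z [z0 _ hz]] := hT (Num.max T0 T1) ltac:(by rewrite le_max lexx).
    exists (nn z); apply/asboolP; exists z; split => //; apply: le_lt_trans hz _.
    rewrite expRN -ltr_pdivlMr ?invr_gt0 ?expR_gt0// invrK.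
    rewrite mulrC -ltr_pdivrMr//; apply: lt_le_trans (hT1 _ _); last by rewrite le_max lexx orbT.
    by rewrite ltrDl.
  case: (ex_minnP ex) => k /asboolP[y [y0 ey ny]] hk.
  exists (exist (fun x : 'rV[int]_n.+1 => x != 0) y y0); split => //= z z0 ez; rewrite ny; apply: hk; apply/asboolP.
  by exists z.
have [f hf] := choice step.
have d0 : (delta_mx 0 0 : 'rV[int]_n.+1) != 0 by apply/rV0Pn; exists 0; rewrite !mxE.
pose s0 : NZ := exist (fun x : 'rV[int]_n.+1 => x != 0) _ d0.
(* Starting at the first iterate gives [x 0] a predecessor too, which is how its norm is compared
   with that of [x 1]. *)
pose x i := val (iter i.+1 f s0).
have hx i : P (x i) (x i.+1) by exact: hf.
exists x; split.
- by move=> i; exact: (valP (iter i.+1 f s0)).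
- move=> i; rewrite !hnn ler_nat.
  have [_ e1 _] := hx i.
  have [y0 _ h] : P (val (iter i f s0)) (x i) by exact: hf.
  apply: h; first by have [] := hx i.
  apply: lt_trans e1 _.
  by have [] : P (val (iter i f s0)) (x i) by exact: hf.
- by move=> i; have [] := hx i.
- move=> i z z0; rewrite !hnn ltr_nat => hz; rewrite leNgt; apply/negP => ez.
  by have [_ _ /(_ z z0 ez)] := hx i; rewrite leqNgt hz.
Qed.

Section Seq.
Context (x : nat -> 'rV[int]_n.+1).
Hypothesis hx : minimal_seq x.

Lemma ms_norm_mono i j : (i <= j)%N -> `|iv (x i)| <= `|iv (x j)|.
Proof.
case: hx => _ h _ _; elim: j => [|j IH]; first by rewrite leqn0 => /eqP ->.
rewrite leq_eqVlt => /orP[/eqP-> //|]; rewrite ltnS => /IH/le_trans; apply; exact: h.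
Qed.

Lemma ms_dist_anti i j : (i < j)%N -> dist v (x j) < dist v (x i).
Proof.
case: hx => _ _ h _; elim: j => // j IH; rewrite ltnS leq_eqVlt => /orP[/eqP-> //|].
by move=> /IH; apply: lt_trans.
Qed.

Lemma ms_nprop i j c : (i < j)%N -> iv (x i) <> c *: iv (x j).
Proof.
move=> ij e; have [x0 _ _ _] := hx.
have hn := ms_norm_mono (ltnW ij); have he := ms_dist_anti ij.
have c1 : `|c| <= 1.
  by move: hn; rewrite e normrZ ger_pMl//; apply: lt_le_trans (norm_iv_ge1 (x0 j)).
have : dist v (x i) = `|c| * dist v (x j).
  rewrite /dist -normrZ e; congr (`|_|); rewrite scalerBr scalerA; congr (_ - _ *: _).
  by move/rowP: e => /(_ 0); rewrite !mxE.
move=> e2; move: he; rewrite e2 ltNge => /negP; apply.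
by apply: ler_piMl => //; exact: dist_ge0.
Qed.

Lemma ms_infty M : exists I, forall i, (I <= i)%N -> M <= `|iv (x i)|.
Proof.
apply: contrapT => /forallNP h.
have hb i : enorm (iv (x i)) <= n.+1%:R * M.
  apply: le_trans (enorm_le _) _; rewrite ler_wpM2l//.
  have /existsNP[j /not_implyP[ij /negP]] := h i; rewrite -ltNge => /ltW; apply: le_trans.
  exact: ms_norm_mono.
have fin := finite_int_ball n (n.+1%:R * M).
have : finite_set [set: nat].
  have xinj : {in x @^-1` [set y | enorm (iv y) <= n.+1%:R * M] &, injective x}.
    move=> i j _ _ e; case: (ltngtP i j) => // /ms_dist_anti; by rewrite e ltxx.
  have := finite_preimage xinj fin; congr finite_set.
  by apply/seteqP; split => // i _ /=; exact: hb.
exact: infinite_nat.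
Qed.

Lemma ms_ln_infty M : exists I, forall i, (I <= i)%N -> M <= ln `|iv (x i)|.
Proof.
have [I hI] := ms_infty (expR M); exists I => i /hI h.
by rewrite -(expRK M) ler_ln ?posrE ?expR_gt0//; apply: lt_le_trans h; exact: expR_gt0.
Qed.

Lemma ms_expK i : expR (ln `|iv (x i)|) = `|iv (x i)|.
Proof. by case: hx => x0 _ _ _; rewrite lnK// posrE (lt_le_trans _ (norm_iv_ge1 (x0 i))). Qed.

Lemma ms_dist_le l : unif v l -> exists C I, 0 < C /\ forall i, (I <= i)%N ->
  dist v (x i) <= C * expR (- (l * ln `|iv (x i.+1)|)).
Proof.
move=> /unif_dist[T0 hT]; have [I hI] := ms_ln_infty (T0 + 1).
exists ((1 + `|v|) * expR l), I; split; first by rewrite mulr_gt0 ?expR_gt0// ltr_pwDl.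
move=> i Ii; set T := ln _.
(* The shift by 1 makes the norm of [z] strictly smaller than that of [x i.+1], as minimality
   requires; it costs the factor [expR l]. *)
have /hT[z [z0 zT hz]] : T0 <= T - 1 by rewrite lerBrDr; apply: hI; exact: leqW.
have [_ _ _ h] := hx; apply: le_trans (h i z z0 _) _.
  by apply: le_lt_trans zT _; rewrite -ms_expK ltr_expR ltrBlDr ltrDl.
by apply: le_trans hz _; rewrite -mulrA ler_wpM2l ?addr_ge0// -expRD ler_expR; lra.
Qed.

(** Consecutive points are not proportional, so some minor of order 2 is a non-zero integer. This is
    what caps all exponents at 1 in [unif_le1]. *)
Lemma ms_wedge_ge1 i : 1 <= 2 * (1 + `|v|) * `|iv (x i.+1)| * dist v (x i).
Proof.
have [x0 hm he _] := hx.
have [a [b hab]] : exists a b, x i 0 a * x i.+1 0 b - x i 0 b * x i.+1 0 a != 0.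
  apply: contrapT => /forallNP h; have [c hc] : exists c : R, iv (x i) = c *: iv (x i.+1).
    apply: wedge_eq0 => // a b; apply/eqP; rewrite -subr_eq0; apply/negP => hab.
    by apply: (h a); exists b; apply/negP.
  exact: ms_nprop hc.
have : 1 <= `|(x i 0 a * x i.+1 0 b - x i 0 b * x i.+1 0 a)%:~R : R|.
  by rewrite -intr_norm -[1]/(1%:~R) ler_int -gtz0_ge1 normr_gt0.
move/le_trans; apply; apply: le_trans (wedge_int_bound _ _ _ _) _.
rewrite -!mulrA ler_wpM2l// mulrDl mul1r; apply: lerD => //.
by apply: ler_pM => //; [exact: dist_ge0|exact: ltW].
Qed.

End Seq.

Lemma unif_le1 l : Q_independent v -> (0 < n)%N -> 1 < l -> ~ unif v l.
Proof.
move=> li n0 l1 hu; have [x hx] := minimal_seq_exists li n0 (lt_trans ltr01 l1) hu.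
have [C [I [C0 hI]]] := ms_dist_le hx hu.
have l10 : 0 < l - 1 by rewrite subr_gt0.
have [T0 hT0] := expR_absorb (2 * (1 + `|v|) * C + 1) l10.
have [J hJ] := ms_ln_infty hx T0.
pose i := maxn I J; have := ms_wedge_ge1 hx i.
have e := hI i (leq_maxl _ _); set X := `|iv (x i.+1)| in e *.
move: (hT0 (ln X) (hJ i.+1 (leqW (leq_maxr _ _)))) => hA; rewrite leNgt => /negP; apply.
apply: le_lt_trans (_ : 2 * (1 + `|v|) * X * (C * expR (- (l * ln X))) < _).
  by apply: ler_wpM2l e; rewrite ?mulr_ge0 ?addr_ge0 ?normr_ge0 //; apply: normr_ge0.
rewrite -[X in _ * X * _](ms_expK hx) -/X.
rewrite [ltLHS](_ : _ = 2 * (1 + `|v|) * C * expR (- ((l - 1) * ln X))); last first.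
  by rewrite (_ : - ((l - 1) * ln X) = ln X + - (l * ln X)) ?expRD; ring.
by rewrite expRN ltr_pdivrMr ?expR_gt0// mul1r (lt_le_trans _ hA)// ltrDl.
Qed.

End Minimal.

(** * Minimal points and the Witt index *)

(* The form of [m <= 1] used for the upper bound: two orthogonal isotropic vectors are proportional
   modulo the kernel. *)
Definition witt_le1 (n : nat) (S : 'M[rat]_n.+1) : Prop :=
  forall x y : 'rV[rat]_n.+1, bf S x x = 0 -> bf S y y = 0 -> bf S x y = 0 ->
  (exists z, bf S x z != 0) -> exists c, forall z, bf S (y - c *: x) z = 0.

Lemma qbilE (n : nat) (q : mpoly.mpoly n.+1 rat) (S : 'M[rat]_n.+1) k x y :
  S^T = S -> (forall x, qval q x = k * bf S x x) -> qbil q x y = 2 * k * bf S x y.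
Proof. by move=> ST hq; rewrite /qbil !hq !bfE (bfC y x ST); ring. Qed.

Lemma witt_index_le1 (n : nat) (q : mpoly.mpoly n.+1 rat) (S : 'M[rat]_n.+1) k m :
  S^T = S -> k != 0 -> (forall x, qval q x = k * bf S x x) ->
  is_witt_index q m -> (m <= 1)%N -> witt_le1 S.
Proof.
move=> ST k0 hq [K [H [W [[hK hH hW] [[oKH oKW _ oHW] [_ hfull]]]]]] m1.
have k2 : 2 * k != 0 by rewrite mulf_neq0.
have B0 u w : qbil q u w = 0 -> bf S u w = 0.
  by rewrite (qbilE _ _ ST hq) => /eqP; rewrite mulf_eq0 (negPf k2) => /eqP.
have hKl u w : u \in K -> bf S u w = 0 by move=> /hK h; exact: B0.
have hKr u w : u \in K -> bf S w u = 0 by move=> /hKl h; rewrite (bfC _ _ ST).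
have aW w : w \in W -> bf S w w = 0 -> w = 0 by move=> ww e; apply: hW => //; rewrite hq e mulr0.
have dec x : exists k h w, [/\ k \in K, h \in (\sum_(i < m) H i)%VS, w \in W & x = k + h + w].
  have : x \in (K + (\sum_(i < m) H i) + W)%VS by rewrite hfull memvf.
  move=> /memv_addP[u /memv_addP[a aK [b bH ->]] [w wW ->]].
  by exists a, b, w.
move=> x y xx yy xy [z xz].
have [kx [hx [wx [kxK hxH wxW ex]]]] := dec x.
have [ky [hy [wy [kyK hyH wyW ey]]]] := dec y.
case: m m1 H hH oKH oHW hfull dec hxH hyH => [|[|//]] _ H hH oKH oHW _ _.
  (* For [m = 0] an isotropic vector has no component in [W] and lies in the kernel, which [xz]
     forbids. *)
  rewrite !big_ord0 !memv0 => /eqP hx0 _; exfalso; move: xz xx.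
  rewrite ex hx0 addr0 !bfE !(hKl kx)// !(hKr kx)// !add0r => xz /aW w0.
  by move: xz; rewrite w0// bf0l eqxx.
rewrite !big_ord1 => hxH hyH.
have [e [f [/andP[/eqP spn _] qe qf cef]]] := hH ord0.
have dH h : h \in H ord0 -> exists a b, h = a *: e + b *: f.
  rewrite -spn span_cons span_seq1 => /memv_addP[_ /vlineP[a ->] [_ /vlineP[b ->] ->]].
  by exists a, b.
have eH : e \in H ord0 by rewrite -spn memv_span// mem_head.
have fH : f \in H ord0 by rewrite -spn memv_span// !inE eqxx orbT.
have ee : bf S e e = 0 by move: qe; rewrite hq => /eqP; rewrite mulf_eq0 (negPf k0) => /eqP.
have ff : bf S f f = 0 by move: qf; rewrite hq => /eqP; rewrite mulf_eq0 (negPf k0) => /eqP.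
have c0 : bf S e f != 0.
  by apply: contraNneq cef => c0; rewrite (qbilE _ _ ST hq) c0 mulr0.
have fe : bf S f e = bf S e f by exact: bfC.
set c := bf S e f in c0 fe.
have ew w : w \in W -> bf S e w = 0 by move=> wW; apply: B0; exact: oHW eH wW.
have fw w : w \in W -> bf S f w = 0 by move=> wW; apply: B0; exact: oHW fH wW.
have we w : w \in W -> bf S w e = 0 by move=> wW; rewrite (bfC _ _ ST) ew.
have wf w : w \in W -> bf S w f = 0 by move=> wW; rewrite (bfC _ _ ST) fw.
have [a [b ehx]] := dH _ hxH; have [a' [b' ehy]] := dH _ hyH.
have simp u v (p r p' r' : rat) (w w' : 'rV[rat]_n.+1) : u \in K -> v \in K -> w \in W -> w' \in W ->
    bf S (u + (p *: e + r *: f) + w) (v + (p' *: e + r' *: f) + w') = (p * r' + r * p') * c + bf S w w'.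
  move=> uK vK wW w'W; rewrite !bfE !(hKl u)// !(hKr v)// ee ff fe -/c.
  by rewrite !(ew, fw, we, wf)//; ring.
rewrite ex ehx in xx xy xz *; rewrite ey ehy in yy xy *.
rewrite !simp// in xx yy xy.
set X := _ + wx in xz *; set Y := _ + wy.
(* If [x] has no [f]-component, isotropy removes [wx] and orthogonality removes [b'], so that modulo
   the kernel [x] and [y] are multiples of [e]. *)
have [b0|b0] := eqVneq b 0.
  have w0 : wx = 0 by apply: aW => //; rewrite -xx b0; ring.
  have a0 : a != 0.
    apply: contraNneq xz => a0; rewrite /X a0 b0 w0 !scale0r !addr0 hKl//.
  have b'0 : b' = 0.
    move: xy; rewrite w0 b0 bf0l mul0r !addr0 => /eqP; rewrite !mulf_eq0 (negPf a0) (negPf c0) orbF => /eqP //.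
  have w'0 : wy = 0 by apply: aW => //; rewrite -yy b'0; ring.
  exists (a' / a) => z'; have -> : Y - (a' / a) *: X = ky - (a' / a) *: kx.
    apply/rowP => i; rewrite /X /Y w0 w'0 b0 b'0 !mxE; by field.
  by apply: hKl; rewrite memvB// memvZ.
(* The vector [b' x - b y] is isotropic without [f]-component, so its part in [W] is isotropic,
   hence 0. Pairing with [x] then removes its [e]-component. *)
have w0 : b' *: wx - b *: wy = 0.
  apply: aW; first by rewrite memvB// memvZ.
  rewrite !bfE (bfC wy wx ST).
  have -> : bf S wx wx = - (2 * a * b * c) by apply/eqP; rewrite -addr_eq0 -xx; apply/eqP; ring.
  have -> : bf S wy wy = - (2 * a' * b' * c) by apply/eqP; rewrite -addr_eq0 -yy; apply/eqP; ring.
  have -> : bf S wx wy = - ((a * b' + b * a') * c) by apply/eqP; rewrite -addr_eq0 -xy; apply/eqP; ring.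
  ring.
have l0 : b' * a - b * a' = 0.
  have /eqP : (b' * a - b * a') * (b * c) = 0.
    have h : bf S X (b' *: X - b *: Y) = 0.
      by rewrite bfDr bfNr !bfZr /X /Y !simp// xx xy !mulr0 subr0.
    rewrite -[RHS]h /X.
    have -> : b' *: X - b *: Y = (b' *: kx - b *: ky) + ((b' * a - b * a') *: e + 0 *: f) + (b' *: wx - b *: wy).
      by apply/rowP => i; rewrite /X /Y !mxE; ring.
    rewrite simp ?memvB ?memvZ// w0 bf0r; ring.
  by rewrite mulf_eq0 mulf_eq0 (negPf b0) (negPf c0) !orbF => /eqP.
exists (b' / b) => z'.
have -> : Y - (b' / b) *: X = ky - (b' / b) *: kx.
  apply/rowP => i; move/rowP: w0 => /(_ i); rewrite /X /Y !mxE => w0i.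
  apply: (mulfI b0); move: w0i => /eqP; rewrite subr_eq0 => /eqP w0i.
  have -> : b * (ky 0 i + (a' * e 0 i + b' * f 0 i) + wy 0 i - b' / b * (kx 0 i + (a * e 0 i + b * f 0 i) + wx 0 i)) =
     b * (ky 0 i - b' / b * kx 0 i) - (b' * a - b * a') * e 0 i - (b' * wx 0 i - b * wy 0 i) by field.
  by rewrite l0 w0i; ring.
by apply: hKl; rewrite memvB// memvZ.
Qed.

Section Isotropic.
Context (R : realType) (n : nat) (v : 'rV[R]_n.+1) (S : 'M[int]_n.+1).
Hypotheses (v0 : v 0 0 = 1) (li : Q_independent v) (ST : S^T = S) (S0 : S != 0).
Local Notation iv x := (map_mx intr x : 'rV[R]_n.+1).
Local Notation SR := (map_mx intr S : 'M[R]_n.+1).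
Hypothesis Qv : bf SR v v = 0.
Context (x : nat -> 'rV[int]_n.+1).
Hypothesis hx : minimal_seq v x.

Let SRT : SR^T = SR. Proof. by rewrite map_trmx ST. Qed.
Let bfi y z : bf SR (iv y) (iv z) = (bf S y z)%:~R. Proof. exact: bf_map. Qed.

Let v_gt0 : 0 < `|v|.
Proof. by apply: lt_le_trans (norm_coord v 0); rewrite v0 normr1. Qed.

Lemma ms_dist_bound i : dist v (x i) <= dist v (x 0%N).
Proof. by case: i => // i; apply/ltW/(ms_dist_anti hx). Qed.

Lemma ms_coord0 : exists I, forall i, (I <= i)%N -> `|iv (x i)| <= 2 * `|v| * `|(x i 0 0)%:~R|.
Proof.
have [I hI] := ms_infty hx (2 * dist v (x 0%N)); exists I => i /hI h.
have e : `|iv (x i)| <= `|(x i 0 0)%:~R : R| * `|v| + dist v (x i).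
  rewrite -normrZ; apply: le_trans (ler_normD _ _).
  by rewrite addrC subrK.
have := ms_dist_bound i; lra.
Qed.

(** The value of the form at [x i] is the zeroth coordinate of [x i] times the non-zero value at
    [v], up to a bounded error. *)
Lemma ms_lin (l : 'cV[int]_n.+1) : l != 0 ->
  exists I, forall i, (I <= i)%N -> x i *m l != 0.
Proof.
move=> l0; have vl : (v *m map_mx intr l) 0 0 != 0.
  apply: contra l0 => /eqP h; apply/eqP; move/Q_independentP: li; apply.
  by apply/matrixP => a b; rewrite !ord1 h mxE.
set d := (v *m _) 0 0 in vl.
pose C := \sum_i `|(l i 0)%:~R : R|.
have [I hI] := ms_coord0.
have [J hJ] := ms_infty hx (2 * `|v| * ((dist v (x 0%N) * C) / `|d|) + 1).
exists (maxn I J) => i; rewrite geq_max => /andP[/hI h1 /hJ h2]; apply/negP => /eqP xl.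
have e : (x i 0 0)%:~R * d = - ((iv (x i) - (x i 0 0)%:~R *: v) *m map_mx intr l) 0 0.
  by rewrite mulmxBl -map_mxM xl map_mx0 sub0r -scalemxAl /d !mxE opprK.
have e2 : `|(x i 0 0)%:~R| * `|d| <= dist v (x 0%N) * C.
  rewrite -normrM e normrN mxE /C mulr_sumr; apply: le_trans (ler_norm_sum _ _ _) _.
  apply: ler_sum => j _; rewrite normrM [(map_mx _ l) j 0]mxE ler_wpM2r//.
  exact: le_trans (norm_coord _ _) (ms_dist_bound i).
move: h1; rewrite leNgt => /negP; apply; apply: lt_le_trans h2.
rewrite -ler_pdivlMr ?normr_gt0// in e2.
by apply: le_lt_trans (_ : 2 * `|v| * (dist v (x 0%N) * C / `|d|) < _); rewrite ?ltrDl// ler_wpM2l.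
Qed.

Lemma norm_lt1_eq0 (z : 'rV[int]_n.+1) : `|iv z| < 1 -> z = 0.
Proof. by move=> h; apply/eqP; apply: contraTT h => /(norm_iv_ge1 R); rewrite -leNgt. Qed.

(* The reflection of [x_(i+1)] in [x_i] is an integer point; if [q(x_(i+1)) = 0] it only depends
   quadratically on the distance from [x_i] to the line of [x_(i+1)], and hence vanishes. *)
Lemma ms_isotropic_prev l : 1 / 2 < l -> unif v l ->
  exists I, forall i, (I <= i)%N -> bf S (x i.+1) (x i.+1) = 0 ->
    bf S (x i) (x i) = 0 /\ bf S (x i) (x i.+1) = 0.
Proof.
move=> l2 hu; have [C [C0 hC]] := bf_bound SR.
have [C1 [I1 [C1_0 h1]]] := ms_dist_le v0 hx hu; have [I2 h2] := ms_coord0.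
pose D := 1 + 2 * `|v|.
pose A := 3 * C * (D * C1) ^+ 2.
have [T0 hT0] := @expR_absorb R (A + 1) (2 * l - 1) ltac:(lra).
have [I3 h3] := ms_ln_infty hx T0.
exists (maxn I1 (maxn I2 I3)) => i; rewrite !geq_max => /and3P[/h1 e1 i2 /leqW/h3/hT0 hA] Q0.
have {h2} h2 := h2 _ (leqW i2).
set X := x i.+1 in Q0 e1 h2 hA *; set y := x i.
have X0 : 0 < `|iv X|.
  by have [x0 _ _ _] := hx; exact: lt_le_trans ltr01 (norm_iv_ge1 R (x0 i.+1)).
have a0 : (X 0 0)%:~R != 0 :> R.
  by apply/eqP => a0; move: h2; rewrite a0 normr0 mulr0 leNgt X0.
pose t : R := (y 0 0)%:~R / (X 0 0)%:~R.
pose y' := iv y - t *: iv X.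
have hy' : `|y'| <= D * dist v y.
  have -> : y' = (iv y - (y 0 0)%:~R *: v) - t *: (iv X - (X 0 0)%:~R *: v).
    rewrite scalerBr scalerA divfK//; apply/rowP => j; rewrite !mxE; ring.
  apply: le_trans (ler_normB _ _) _; rewrite normrZ mulrDl mul1r lerD2l.
  apply: ler_pM => //; last by apply/ltW/(ms_dist_anti hx).
  rewrite normrM normfV ler_pdivrMr ?normr_gt0//; apply: le_trans h2.
  apply: le_trans (ms_norm_mono hx (leqnSn i)).
  by apply: le_trans (norm_coord _ 0); rewrite mxE.
pose z := bf S y y *: X - (2 * bf S X y) *: y.
have ez : iv z = bf SR y' y' *: iv X - (2 * bf SR (iv X) y') *: y'.
  have QR : bf SR (iv X) (iv X) = 0 by rewrite bfi Q0.
  have -> : iv z = bf SR (iv y) (iv y) *: iv X - (2 * bf SR (iv X) (iv y)) *: iv y.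
    by rewrite /z map_mxB !map_mxZ /= rmorphM /= !bfi.
  (* Adding a multiple of an isotropic [u] to [w] does not change this expression, so [y] may be
     replaced by the short vector [y']. *)
  have key (w u : 'rV[R]_n.+1) : bf SR u u = 0 ->
    bf SR (t *: u + w) (t *: u + w) *: u - (2 * bf SR u (t *: u + w)) *: (t *: u + w) =
    bf SR w w *: u - (2 * bf SR u w) *: w.
    by move=> h; rewrite !bfE h (bfC w u SRT); apply/rowP => j; rewrite !mxE; ring.
  have ey : t *: iv X + y' = iv y by rewrite addrC subrK.
  by rewrite -(key y')// ey.
have z0 : z = 0.
  apply: norm_lt1_eq0; apply: le_lt_trans (_ : 3 * C * `|iv X| * `|y'| ^+ 2 < _).
    rewrite ez; apply: le_trans (ler_normB _ _) _; rewrite !normrZ.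
    have b1 := hC y' y'; have b2 := hC (iv X) y'.
    rewrite [leRHS](_ : _ = C * `|y'| * `|y'| * `|iv X| + `|2| * (C * `|iv X| * `|y'|) * `|y'|).
      by apply: lerD; rewrite ler_wpM2r// ler_wpM2l.
    by rewrite ger0_norm//; ring.
  apply: le_lt_trans (_ : 3 * C * `|iv X| * (D * (C1 * expR (- (l * ln `|iv X|)))) ^+ 2 < _).
    have D0 : 0 <= D by rewrite addr_ge0// mulr_ge0.
    have G0 : 0 <= C1 * expR (- (l * ln `|iv X|)) by rewrite mulr_ge0 ?expR_ge0// ltW.
    rewrite ler_wpM2l ?mulr_ge0 ?(ltW C0)// ler_pXn2r ?nnegrE ?(mulr_ge0 D0)//.
    by apply: le_trans hy' _; rewrite ler_wpM2l.
  rewrite -{1}(ms_expK hx i.+1) -/X.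
  rewrite [ltLHS](_ : _ = A * expR (- ((2 * l - 1) * ln `|iv X|))); last first.
    rewrite (_ : - ((2 * l - 1) * ln `|iv X|) = ln `|iv X| + (- (l * ln `|iv X|) + - (l * ln `|iv X|))).
      by rewrite !expRD /A; ring.
    by ring.
  by rewrite expRN ltr_pdivrMr ?expR_gt0// mul1r (lt_le_trans _ hA)// ltrDl.
have B0 : bf S X y = 0.
  apply/eqP/negPn/negP => B0; apply: (@ms_nprop _ _ _ _ hx i i.+1 ((bf S y y)%:~R / (2 * bf S X y)%:~R)) => //.
  have bR : (2 * bf S X y)%:~R != 0 :> R by rewrite intr_eq0 mulf_neq0.
  apply: (scalerI bR); rewrite scalerA mulrCA divff// mulr1 -!map_mxZ /= -/X -/y.
  by congr (map_mx _ _); apply/esym/eqP; rewrite -subr_eq0; apply/eqP.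
split; last by rewrite (bfC _ _ ST).
move: z0; rewrite /z B0 mulr0 scale0r subr0 => /rowP/(_ 0); rewrite !mxE => /eqP.
by rewrite mulf_eq0 => /orP[/eqP//|/eqP X00]; move: a0; rewrite X00 eqxx.
Qed.

Hypothesis hw : witt_le1 (map_mx intr S).

(** By [ms_isotropic_prev] isotropy descends from any large index to all indices above [I0].
    Infinitely many isotropic points thus make all late ones isotropic with consecutive ones
    orthogonal, hence all proportional to one [x i1] modulo the kernel and orthogonal to it. The
    linear form given by [x i1] then contradicts [ms_lin]. *)
Lemma ms_anisotropic l : 1 / 2 < l -> unif v l ->
  exists I, forall i, (I <= i)%N -> bf S (x i) (x i) != 0.
Proof.
move=> l2 hu; have [I0 h0] := ms_isotropic_prev l2 hu.
apply: contrapT => /forallNP hinf.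
have Q0 i : (I0 <= i)%N -> bf S (x i) (x i) = 0.
  move=> Ii; have /existsNP[j /not_implyP[ij /negP/negPn/eqP]] := hinf i.
  rewrite -(subnK ij); elim: (j - i)%N => // k IH; rewrite addSn => hk; apply: IH.
  by have [|//] := h0 (k + i)%N _ hk; rewrite (leq_trans Ii)// leq_addl.
have B0 i : (I0 <= i)%N -> bf S (x i) (x i.+1) = 0.
  by move=> Ii; have [|//] := h0 i Ii; apply: Q0; exact: leqW.
(* A non-zero column of [S] is an integral form to which [ms_lin] applies, so late points are
   outside the kernel. *)
have [I1 h1] : exists I, forall i, (I <= i)%N -> x i *m S != 0.
  have [[a b]] : exists ab : 'I_n.+1 * 'I_n.+1, S ab.1 ab.2 != 0.
    by move/matrix0Pn: S0 => [a [b h]]; exists (a, b).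
  move=> /= Sab; have [] := @ms_lin (matrix.col b S).
    by apply/eqP => /colP/(_ a); rewrite !mxE; apply/eqP.
  move=> I hI; exists I => i /hI; apply: contra => /eqP h.
  by rewrite matrix.colE mulmxA h mul0mx.
pose i1 := maxn I0 I1.
have [I hI] : exists I, forall i, (I <= i)%N -> x i *m (S *m (x i1)^T) != 0.
  apply: ms_lin; apply: contra (h1 i1 (leq_maxr _ _)) => /eqP/(congr1 trmx).
  by rewrite trmx_mul trmxK ST trmx0 => ->.
pose rv (y : 'rV[int]_n.+1) : 'rV[rat]_n.+1 := map_mx intr y.
have bfq y z : bf (map_mx intr S) (rv y) (rv z) = (bf S y z)%:~R by exact: bf_map.
have hK k : exists c, forall z, bf (map_mx intr S) (rv (x (k + i1)%N) - c *: rv (x i1)) z = 0.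
  elim: k => [|k [c hc]]; first by exists 1 => z; rewrite scale1r subrr bf0l.
  have le0 : (I0 <= k + i1)%N by rewrite (leq_trans (leq_maxl I0 I1))// leq_addl.
  have le1 : (I1 <= k + i1)%N by rewrite (leq_trans (leq_maxr I0 I1))// leq_addl.
  have [||||c' hc'] := hw (x := rv (x (k + i1)%N)) (y := rv (x (k + i1).+1)).
  - by rewrite bfq Q0.
  - by rewrite bfq Q0// leqW.
  - by rewrite bfq B0.
  - apply: contrapT => /forallNP h; have /negP := h1 _ le1; apply.
    have : rv (x (k + i1)%N) *m map_mx intr S = 0.
      by apply/bf_neq0P => y; apply/eqP; apply: contrapT => /negP hy; exact: (h y).
    rewrite -map_mxM => /matrixP h2; apply/eqP/matrixP => a b.
    by move: (h2 a b); rewrite !mxE => /eqP; rewrite intr_eq0 => /eqP.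
  exists (c' * c) => z; rewrite addSn.
  have -> : rv (x (k + i1).+1) - (c' * c) *: rv (x i1) =
    (rv (x (k + i1).+1) - c' *: rv (x (k + i1)%N)) + c' *: (rv (x (k + i1)%N) - c *: rv (x i1)).
    by rewrite scalerBr scalerA addrA subrK.
  by rewrite bfDl bfZl hc hc' mulr0 addr0.
have := hI (I + i1)%N (leq_addr _ _); apply/negP/negPn/eqP/matrixP => a b.
rewrite !ord1 mulmxA [RHS]mxE -[LHS]/(bf S _ _); apply/eqP; rewrite -(intr_eq0 rat) -bfq.
have [c hc] := hK I; move: (hc (rv (x i1))); rewrite bfDl bfNl bfZl.
by rewrite [bf _ (rv (x i1)) _]bfq Q0 ?leq_maxl// mulr0 subr0 => ->.
Qed.

(** In [x i = a v + e] the term in [a ^+ 2] is absent because [v] is isotropic, and all remaining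
    terms contain the short vector [e]. *)
Lemma form_bound : exists2 C, 0 < C & forall i,
  `|(bf S (x i) (x i))%:~R : R| <= C * `|iv (x i)| * dist v (x i).
Proof.
have [C [C0 hC]] := bf_bound SR; pose E := dist v (x 0%N).
exists (C * (2 * `|v| + E)); first by rewrite mulr_gt0// ltr_pwDl ?mulr_gt0// dist_ge0.
move=> i; rewrite -bfi; set y := iv (x i).
pose a : R := (x i 0 0)%:~R; pose e := y - a *: v.
have -> : bf SR y y = 2 * a * bf SR v e + bf SR e e.
  have key w : bf SR (a *: v + w) (a *: v + w) = 2 * a * bf SR v w + bf SR w w.
    by rewrite !bfE Qv (bfC w v SRT); ring.
  by rewrite -key /e addrC subrK.
have y1 : 1 <= `|y| by apply: norm_iv_ge1; case: hx.
have ha : `|a| <= `|y| by apply: le_trans (norm_coord _ 0); rewrite mxE.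
have he : `|e| <= E by exact: ms_dist_bound.
apply: le_trans (ler_normD _ _) _.
rewrite [leRHS](_ : _ = 2 * `|y| * (C * `|v| * `|e|) + C * (E * `|y|) * `|e|); last by rewrite /dist -/y -/a -/e; ring.
apply: lerD.
  by rewrite !normrM ger0_norm// ler_pM ?mulr_ge0// ler_wpM2l.
apply: le_trans (hC _ _) _; rewrite ler_wpM2r// ler_wpM2l ?(ltW C0)//.
by apply: le_trans he _; rewrite ler_peMr// dist_ge0.
Qed.

Lemma ms_lower l : 1 / 2 < l -> unif v l ->
  exists2 c, 0 < c & exists I, forall i, (I <= i)%N -> c <= `|iv (x i)| * dist v (x i).
Proof.
move=> l2 hu; have [C C0 hC] := form_bound; have [I hI] := ms_anisotropic l2 hu.
exists C^-1; first by rewrite invr_gt0.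
exists I => i /hI h; rewrite -[C^-1]mulr1 ler_pdivrMl// mulrA; apply: le_trans (hC i).
by rewrite -intr_norm -[1]/(1%:~R) ler_int -gtz0_ge1 normr_gt0.
Qed.

End Isotropic.

(** * Determinants of minimal points *)

Lemma det_le_prod (R : realType) (m : nat) (B : 'M[R]_m.+1) :
  `|\det B| <= (m.+1)`!%:R * \prod_j `|row j B|.
Proof.
have h (s : 'S_m.+1) : `|(-1) ^+ s * \prod_i B i (s i)| <= \prod_j `|row j B|.
  rewrite normrM normr_sign mul1r normr_prod.
  apply: ler_prod => i _; rewrite normr_ge0 /=.
  by apply: le_trans (norm_coord _ (s i)); rewrite mxE.
rewrite /determinant; apply: le_trans (ler_norm_sum _ _ _) _.
apply: le_trans (ler_sum _ (fun s _ => h s)) _.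
by rewrite sumr_const card_Sn mulr_natl.
Qed.

Section Chain.
Context (R : realType) (n : nat) (v : 'rV[R]_n.+1).
Hypotheses (v0 : v 0 0 = 1) (li : Q_independent v).
Local Notation iv x := (map_mx intr x : 'rV[R]_n.+1).
Local Notation rv x := (map_mx intr x : 'rV[rat]_n.+1).
Context (x : nat -> 'rV[int]_n.+1).
Hypothesis hx : minimal_seq v x.

(* Up to a constant, the norm of [x_(i+1)] modulo a multiple of [x_i]. *)
Definition gap i : R := (1 + 2 * `|v|) * (`|iv (x i.+1)| * dist v (x i) / `|iv (x i)|).

(* [A] spans the points [x_j], [i0 <= j <= i], and its rows are obtained by a unimodular
   transformation from rows whose norms have product at most [P]. *)
Definition spanned r (A : 'M[int]_(r, n.+1)) i0 i (P : R) : Prop :=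
  [/\ exists (T : 'M[R]_r) (B : 'M[R]_(r, n.+1)),
        [/\ map_mx intr A = T *m B, \det T = 1 & \prod_j `|row j B| <= P],
      \rank (map_mx intr A : 'M[rat]_(r, n.+1)) = r &
      forall j, (i0 <= j <= i)%N -> (rv (x j) <= map_mx intr A)%MS].

Lemma ms_neq0 i : x i != 0. Proof. by case: hx. Qed.

Lemma ms_gt0 i : 0 < `|iv (x i)|.
Proof. exact: lt_le_trans ltr01 (norm_iv_ge1 R (ms_neq0 i)). Qed.

Lemma gap_step : exists I, forall i, (I <= i)%N -> exists t : R,
  `|iv (x i.+1) - t *: iv (x i)| <= gap i.
Proof.
have [I hI] := ms_coord0 hx; exists I => i /hI h.
have X0 := ms_gt0 i.
have a0 : (x i 0 0)%:~R != 0 :> R.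
  by apply/eqP => a0; move: h; rewrite a0 normr0 mulr0 leNgt X0.
(* For the quotient of the zeroth coordinates the multiples of [v] cancel and only distances
   remain. *)
exists ((x i.+1 0 0)%:~R / (x i 0 0)%:~R); set t := _ / _.
have -> : iv (x i.+1) - t *: iv (x i) =
   (iv (x i.+1) - (x i.+1 0 0)%:~R *: v) - t *: (iv (x i) - (x i 0 0)%:~R *: v).
  rewrite scalerBr scalerA divfK//; apply/rowP => j; rewrite !mxE; ring.
have hm := ms_norm_mono hx (leqnSn i).
apply: le_trans (ler_normB _ _) _; rewrite /gap mulrDl mul1r normrZ.
rewrite [`|iv (x i.+1)| * _ / _]mulrAC; apply: lerD.
  apply: le_trans (ltW (ms_dist_anti hx (ltnSn i))) _.
  by rewrite ler_peMl ?dist_ge0// ler_pdivlMr// mul1r.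
rewrite mulrA ler_wpM2r// normrM normfV ler_pdivrMr ?normr_gt0//.
rewrite [leRHS](_ : _ = `|iv (x i.+1)| * (2 * `|v| * `|(x i 0 0)%:~R| / `|iv (x i)|)); last by ring.
apply: le_trans (_ : `|iv (x i.+1)| <= _).
  by apply: le_trans (norm_coord _ 0); rewrite mxE.
by rewrite ler_peMr// ler_pdivlMr// mul1r.
Qed.

Lemma spanned_step r (A : 'M[int]_(r, n.+1)) i0 i P t : (i0 <= i)%N ->
  `|iv (x i.+1) - t *: iv (x i)| <= gap i ->
  spanned A i0 i P -> ~~ (rv (x i.+1) <= map_mx intr A)%MS ->
  spanned (col_mx (x i.+1) A) i0 i.+1 (P * gap i).
Proof.
move=> i0i ht [[T [B [eA dT hP]]] rk hA] nA; split.
- have /submxP[c hc] : (rv (x i) <= map_mx intr A)%MS by apply: hA; rewrite i0i leqnn.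
  have hcR : iv (x i) = map_mx ratr c *m (T *m B).
    have e2 : map_mx ratr (map_mx intr A : 'M[rat]_(r, n.+1)) = map_mx intr A :> 'M[R]_(r, n.+1).
      by apply/matrixP => a b; rewrite !mxE ratr_int.
    have /(congr1 (map_mx (ratr : rat -> R))) := hc.
    rewrite map_mxM e2 -eA => <-.
    by apply/rowP => j; rewrite !mxE ratr_int.
  (* As [x i] is a combination of the rows of [A], subtracting [t] times it from the new row is a
     unimodular operation; the new factor of the product is [gap i] instead of the norm of
     [x i.+1]. *)
  exists (block_mx 1 (t *: map_mx ratr c *m T) 0 T), (col_mx (iv (x i.+1) - t *: iv (x i)) B).
  split.
  + rewrite map_col_mx mul_block_col mul1mx mul0mx add0r eA; congr (col_mx _ _).
    by rewrite -scalemxAl -scalemxAl -mulmxA -hcR subrK.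
  + by rewrite det_ublock det1 mul1r.
  + rewrite (@big_split_ord _ _ _ 1 r)/= big_ord1 mulrC; apply: ler_pM => //.
    * by apply: prodr_ge0.
    * under eq_bigr do rewrite rowKd; exact: hP.
    * by rewrite rowKu; rewrite (_ : row _ _ = iv (x i.+1) - t *: iv (x i))//; apply/rowP => j; rewrite !mxE !ord1.
- rewrite map_col_mx -addsmxE; apply/eqP; rewrite eqn_leq; apply/andP; split.
    by apply: leq_trans (mxrank_adds_leqif _ _) _; rewrite rk leq_add2r; exact: rank_leq_row.
  rewrite -[X in (X < _)%N]rk ltn_neqAle mxrankS ?addsmxSr// andbT.
  apply: contra nA => /eqP e; have := addsmxSr (rv (x i.+1)) (map_mx intr A : 'M[rat]_(r, n.+1)).
  have := (mxrank_leqif_sup (addsmxSr (rv (x i.+1)) (map_mx intr A : 'M[rat]_(r, n.+1)))).2.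
  by rewrite e eqxx => /esym h _; rewrite (submx_trans (addsmxSl _ _) h).
- move=> j /andP[i0j]; rewrite leq_eqVlt map_col_mx -addsmxE => /orP[/eqP->|].
    exact: addsmxSl.
  rewrite ltnS => ji; apply: submx_trans (addsmxSr _ _); apply: hA; exact/andP.
Qed.

(** A proper rational subspace is killed by a non-zero integral form, here a cleared column of the
    cokernel matrix, and [ms_lin] shows that the points leave it. The index [i'] is the last one
    before they do. *)
Lemma spanned_exit r (A : 'M[int]_(r, n.+1)) i0 i P : (r <= n)%N -> spanned A i0 i P ->
  exists2 i', (i <= i')%N & spanned A i0 i' P /\ ~~ (rv (x i'.+1) <= map_mx intr A)%MS.
Proof.
move=> rn [hTB rk hA].
have ex : exists j, (i < j)%N && ~~ (rv (x j) <= map_mx intr A)%MS.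
  have /matrix0Pn[a [b hab]] : cokermx (map_mx intr A : 'M[rat]_(r, n.+1)) != 0.
    rewrite -mxrank_eq0 mxrank_coker rk -lt0n subn_gt0 ltnS//.
  have [l [d [d0 hl]]] := int_scale (matrix.col b (cokermx (map_mx intr A : 'M[rat]_(r, n.+1)))).
  have l0 : l != 0.
    apply: contraNneq hab => l0; move: hl; rewrite l0 map_mx0 => /colP/(_ a); rewrite !mxE.
    by move=> /esym/eqP; rewrite mulf_eq0 intr_eq0 (negPf d0) => /eqP ->.
  have [J hJ] := ms_lin li hx l0.
  exists (maxn J i.+1); rewrite leq_maxr /=; apply: contra (hJ _ (leq_maxl _ i.+1)).
  rewrite submxE => /eqP h; apply/eqP/matrixP => a' b'.
  have : rv (x (maxn J i.+1)) *m map_mx intr l = 0.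
    by rewrite hl -scalemxAr matrix.colE mulmxA h mul0mx scaler0.
  by rewrite -map_mxM => /matrixP/(_ a' b'); rewrite !mxE => /eqP; rewrite intr_eq0 => /eqP.
case: (ex_minnP ex) => j /andP[ij nj] hmin.
have j1 : j.-1.+1 = j by rewrite prednK// (leq_ltn_trans _ ij).
exists j.-1; first by rewrite -ltnS j1.
split; last by rewrite j1.
split => // k /andP[i0k]; rewrite -ltnS j1 => kj.
case: (leqP k i) => ki; first by apply: hA; rewrite i0k.
by apply: contraTT kj => nk; rewrite -leqNgt hmin// ki.
Qed.

Lemma spanned_full (A : 'M[int]_n.+1) i0 i P : spanned A i0 i P -> 1 <= (n.+1)`!%:R * P.
Proof.
move=> [[T [B [eA dT hP]]] rk _].
have dA : \det A != 0.
  have : (map_mx intr A : 'M[rat]_n.+1) \in unitmx by rewrite -row_free_unit /row_free rk.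
  by rewrite unitmxE det_map_mx unitfE intr_eq0.
have : 1 <= `|(\det A)%:~R : R|.
  by rewrite -intr_norm -[1]/(1%:~R) ler_int -gtz0_ge1 normr_gt0.
move/le_trans; apply; rewrite -det_map_mx eA det_mulmx dT mul1r.
by apply: le_trans (det_le_prod B) _; rewrite ler_wpM2l.
Qed.

Lemma chain_from I : (forall i, (I <= i)%N -> exists t : R, `|iv (x i.+1) - t *: iv (x i)| <= gap i) ->
  forall d r (A : 'M[int]_(r, n.+1)) i0 i P, (I <= i0)%N -> (i0 <= i)%N -> (r + d = n)%N ->
  spanned A i0 i P -> ~~ (rv (x i.+1) <= map_mx intr A)%MS ->
  exists idx : nat -> nat, [/\ idx 0%N = i, forall j, (j < d)%N -> (idx j < idx j.+1)%N &
    1 <= (n.+1)`!%:R * (P * \prod_(j < d.+1) gap (idx j))].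
Proof.
move=> hI; elim=> [|d IH] r A i0 i P Ii0 i0i rd hA nA;
  have [t ht] := hI i (leq_trans Ii0 i0i);
  have h' := spanned_step i0i ht hA nA.
  rewrite addn0 in rd; subst r.
  by exists (fun=> i); split => //; rewrite big_ord1; exact: spanned_full h'.
have [i' ii' [h'' n'']] := spanned_exit (r := (1 + r)%N) ltac:(by rewrite -rd addnS ltnS leq_addr) h'.
have [idx [i0' mono hp]] := IH (1 + r)%N _ i0 i' _ Ii0 (leq_trans i0i (leq_trans (leqnSn _) ii')) ltac:(by move: rd; lia) h'' n''.
exists (fun j => if j is j'.+1 then idx j' else i); split => //.
  by case=> [|j] hj; [rewrite i0'|exact: mono].
by rewrite big_ord_recl [P * (_ * _)]mulrA; exact: hp.
Qed.

(** The first two rows are treated by hand because the equality case has to know that [idx 1] is the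
    last index before the points leave the plane of [x i0] and [x i0.+1]. *)
Lemma chain : (1 < n)%N -> exists I, forall i0, (I <= i0)%N ->
  exists idx : nat -> nat, [/\ idx 0%N = i0, forall j, (j < n.-1)%N -> (idx j < idx j.+1)%N,
    1 <= (n.+1)`!%:R * (`|iv (x i0)| * \prod_(j < n) gap (idx j)),
    (forall j, (i0 <= j <= idx 1)%N -> (rv (x j) <= col_mx (rv (x i0.+1)) (rv (x i0)))%MS) &
    ~~ (rv (x (idx 1).+1) <= col_mx (rv (x i0.+1)) (rv (x i0)))%MS].
Proof.
move=> n1; have [I hI] := gap_step; exists I => i0 Ii0.
have s1 : spanned (x i0) i0 i0 `|iv (x i0)|.
  split.
  - exists 1%:M, (iv (x i0)); split; [by rewrite mul1mx|by rewrite det1|].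
    by rewrite big_ord1 (_ : row _ _ = iv (x i0))//; apply/rowP => j; rewrite !mxE.
  - rewrite rank_rV; suff -> : rv (x i0) != 0 by [].
    apply: contraNneq (ms_neq0 i0) => /rowP h; apply/eqP/rowP => j.
    by move: (h j); rewrite !mxE => /eqP; rewrite intr_eq0 => /eqP.
  - by move=> j; rewrite -eqn_leq => /eqP ->.
have n1' : ~~ (rv (x i0.+1) <= (rv (x i0)))%MS.
  apply/negP => /sub_rVP[a ha].
  have a0 : a != 0.
    apply: contraNneq (ms_neq0 i0.+1) => a0; apply/eqP/rowP => j.
    by move/rowP: ha => /(_ j); rewrite a0 !mxE mul0r => /eqP; rewrite intr_eq0 => /eqP.
  apply: (@ms_nprop _ _ _ _ hx i0 i0.+1 (ratr a^-1)) => //; apply/rowP => j.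
  move/rowP: ha => /(_ j); rewrite !mxE => /(congr1 (fun z => ratr (a^-1 * z) : R)).
  by rewrite mulKf// rmorphM /= !ratr_int => ->.
have [t ht] := hI i0 Ii0; have s2 := spanned_step (leqnn i0) ht s1 n1'.
have [i1 i01 [s2' n2]] := spanned_exit (r := 2) n1 s2.
have [idx [e mono hp]] := chain_from hI (d := n - 2) (r := 2) (i0 := i0) Ii0 (ltnW i01) ltac:(by rewrite subnKC) s2' n2.
exists (fun j => if j is j'.+1 then idx j' else i0); split => //.
- by case=> [|j] hj; [rewrite e|apply: mono; move: hj; lia].
- move: hp; rewrite -(big_mkord xpredT (fun j => gap (idx j))).
  rewrite -(big_mkord xpredT (fun j => gap (if j is j'.+1 then idx j' else i0))).
  rewrite [\prod_(0 <= j < n) _]big_ltn ?(ltnW n1)// big_add1 (_ : (n - 2).+1 = n.-1)//; last by lia.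
  by rewrite -[`|iv (x i0)| * gap i0 * _]mulrA.
- by rewrite e => j hj; rewrite -map_col_mx; case: s2' => _ _; exact.
- by rewrite /= e -map_col_mx.
Qed.

End Chain.

(** * The number rho and weighted inequalities *)

Lemma rho_polyE (R : realType) (n : nat) (x : R) :
  (rho_poly R n).[x] = x ^+ n - \sum_(i < n) x ^+ i.
Proof.
rewrite /rho_poly hornerD hornerN horner_sum hornerXn; congr (_ - _).
by apply: eq_bigr => i _; rewrite hornerXn.
Qed.

Lemma rho_exists (R : realType) (n : nat) : (2 <= n)%N ->
  exists rho : R, [/\ 1 < rho < 2, root (rho_poly R n) rho
      & forall x : R, 0 < x -> root (rho_poly R n) x -> x = rho].
Proof.
move=> n2.
have p1 : (rho_poly R n).[1] < 0.
  rewrite rho_polyE expr1n (eq_bigr (fun=> 1)) => [|i _]; last by rewrite expr1n.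
  by rewrite sumr_const card_ord subr_lt0 ltr1n.
have p2 : (rho_poly R n).[2] = 1.
  by have := subrX1 (2 : R) n; rewrite rho_polyE (_ : 2 - 1 = 1) ?mul1r; lra.
have [rho /andP[r1 r2] hr] : exists2 x, 1 <= x <= 2 & root (rho_poly R n) x.
  by apply: poly_ivt; [lra|rewrite p2 ler01 andbT ltW].
have uniq (x y : R) : 0 < x -> x < y -> root (rho_poly R n) x -> root (rho_poly R n) y -> False.
  move=> x0 xy; have y0 := lt_trans x0 xy.
  rewrite /root !rho_polyE !subr_eq0 => /eqP ex /eqP ey.
  (* Replacing [x] by [c * x] multiplies the [n]-th power by [c ^+ n], but the sum by at most
     [c ^+ n.-1]. *)
  pose c := y / x; have c1 : 1 < c by rewrite ltr_pdivlMr// mul1r.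
  have yc i : y ^+ i = c ^+ i * x ^+ i by rewrite -exprMn divfK// gt_eqF.
  have : \sum_(i < n) y ^+ i <= c ^+ n.-1 * x ^+ n.
    rewrite ex mulr_sumr; apply: ler_sum => i _; rewrite yc ler_wpM2r ?exprn_ge0 ?(ltW x0)//.
    by rewrite ler_weXn2l ?(ltW c1)//; move: (ltn_ord i); lia.
  rewrite -ey yc ler_pM2r ?exprn_gt0// leNgt => /negP; apply.
  by rewrite ltr_eXn2l//; lia.
exists rho; split => //.
- rewrite !lt_neqAle r1 r2 !andbT; apply/andP; split; apply/eqP => e.
    by move: p1; rewrite e (eqP hr) ltxx.
  by move: p2; rewrite -e (eqP hr) => /eqP; rewrite eq_sym oner_eq0.
- move=> x x0 hx; have r0 : 0 < rho by exact: lt_le_trans r1.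
  by case: (ltgtP x rho) => // h; exfalso; [exact: (uniq x rho)|exact: (uniq rho x)].
Qed.

Section Weights.
Context (R : realType) (n : nat) (rho : R).
Hypotheses (n1 : (1 < n)%N) (rho1 : 1 < rho) (rho2 : rho < 2) (hrho : root (rho_poly R n) rho).

Let r0 : 0 < rho. Proof. exact: lt_trans ltr01 rho1. Qed.
Let al := rho^-1.

Lemma rho_inv_bounds : 1 / 2 < rho^-1 < 1.
Proof.
apply/andP; split; first by rewrite div1r ltf_pV2 ?posrE//; lra.
by rewrite invf_lt1//; lra.
Qed.

Let al0 : 0 < al. Proof. by rewrite invr_gt0. Qed.

Lemma rho_root : rho ^+ n = \sum_(i < n) rho ^+ i.
Proof. by move: hrho; rewrite /root rho_polyE subr_eq0 => /eqP. Qed.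

Lemma rho_mul : (2 - rho) * rho ^+ n = 1.
Proof.
have := subrX1 rho n; rewrite -rho_root => h.
have -> : (2 - rho) * rho ^+ n = rho ^+ n - (rho - 1) * rho ^+ n by ring.
by rewrite -h; ring.
Qed.

(* Weights for which the sum in [weighted_sum] telescopes, the root equation giving [mu n = 1]. *)
Fixpoint mu k : R := if k is k'.+1 then al * (1 + mu k') else 0.

Lemma mu_mul k : mu k * rho ^+ k = \sum_(i < k) rho ^+ i.
Proof.
elim: k => [|k IH]; first by rewrite mul0r big_ord0.
rewrite big_ord_recr /= -IH exprS /al; have := r0 => ?; field; lra.
Qed.

Lemma mu_n : mu n = 1.
Proof.
have := mu_mul n; rewrite -rho_root -[in RHS](mul1r (rho ^+ n)) => /mulIf; apply.
by rewrite expf_neq0// gt_eqF.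
Qed.

Lemma mu_diff k : mu k.+1 - mu k = al ^+ k.+1.
Proof.
elim: k => [|k IH]; first by rewrite /= addr0 mulr1 subr0 expr1.
by rewrite exprS -IH /=; ring.
Qed.

Lemma mu_le j k : (j <= k)%N -> mu j <= mu k.
Proof.
move=> /subnK <-; elim: (k - j)%N => // d IH; apply: le_trans IH _.
by rewrite addSn -subr_ge0 mu_diff exprn_ge0 ?ltW.
Qed.

Lemma mu_bounds k : (k < n.-1)%N -> al ^+ n <= mu k.+1 /\ al ^+ n <= 1 - mu k.+1.
Proof.
move=> kn; have /andP[a1 a2] := rho_inv_bounds; split.
  apply: le_trans (_ : mu 1 <= _); last exact: mu_le.
  by rewrite /= addr0 mulr1 -[leRHS]expr1 ler_wiXn2l// ?ltW//; lia.
have -> : al ^+ n = 1 - mu n.-1 by rewrite -mu_n -{2}(prednK (ltnW n1)) mu_diff prednK// ltnW.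
by rewrite lerD2l lerN2 mu_le.
Qed.

(** In the application [p k], [a k] and [d k] are the logarithms of the norm at [idx k], of the norm
    at the next index and of the inverse distance at [idx k]; the hypothesis is the determinant
    inequality. Every bracket on the left is then non-negative up to small errors: [d] is at least
    about [al * a] by the exponent, [p k.+1] is at least [a k] by monotonicity, and [p] is at least
    about [d]. So the inequality leaves no room. *)
Lemma weighted_sum (K : R) (p a d : nat -> R) :
  0 <= K + p 0%N + \sum_(k < n) (a k - d k - p k) ->
  \sum_(k < n) (d k - al * a k) +
  \sum_(k < n.-1) ((1 - mu k.+1) * (p k.+1 - a k) + mu k.+1 * (p k.+1 - al * a k.+1)) <= K.
Proof.
(* A partial sum leaves the remainder [(1 - mu m.+1) * a m], which disappears at [m = n.-1]. *)
have key m : p 0%N + \sum_(k < m.+1) (a k - d k - p k) = - \sum_(k < m.+1) (d k - al * a k)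
    - \sum_(k < m) ((1 - mu k.+1) * (p k.+1 - a k) + mu k.+1 * (p k.+1 - al * a k.+1))
    + (1 - mu m.+1) * a m.
  elim: m => [|m IH]; first by rewrite !big_ord_recr !big_ord0 /=; ring.
  rewrite big_ord_recr addrA IH [X in _ = _ - X + _]big_ord_recr [X in _ = - X - _ + _]big_ord_recr /=; ring.
have := key n.-1; rewrite prednK ?(ltnW n1)// mu_n subrr mul0r addr0 => e.
rewrite -addrA e; lra.
Qed.

Lemma sum_single m (F : nat -> R) e j : 0 <= e -> (forall k, (k < m)%N -> - e <= F k) ->
  (j < m)%N -> F j <= \sum_(k < m) F k + m%:R * e.
Proof.
move=> e0 h jm; have -> : \sum_(k < m) F k + m%:R * e = \sum_(k < m) (F k + e).
  by rewrite big_split /= sumr_const card_ord mulr_natl.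
rewrite (bigD1 (Ordinal jm))//= -addrA lerDl addr_ge0// sumr_ge0// => i _.
by have := h i (ltn_ord i); lra.
Qed.

(** Each bracket of [weighted_sum] is bounded below up to [e], hence also above; but [e] involves
    the last and largest value [La]. The same bounds show that [a] at most doubles at each step up
    to [c], so [La] is bounded by a multiple of [a 0], and errors relative to [La] become errors
    relative to [a 0]. *)
Lemma weighted_tight (delta : R) : 0 < delta -> exists2 delta', 0 < delta' &
  forall K C, 0 <= K -> 0 <= C -> exists A0, forall p a d : nat -> R, A0 <= a 0%N ->
  (forall k, (k < n)%N -> 0 <= a k) -> (forall k, (k < n)%N -> p k <= a k) ->
  (forall k, (k < n.-1)%N -> a k <= p k.+1) ->
  (forall k, (k < n)%N -> (al - delta') * a k - C <= d k) ->
  (forall k, (k < n)%N -> d k <= p k + C) ->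
  0 <= K + p 0%N + \sum_(k < n) (a k - d k - p k) ->
  [/\ d 0%N <= (al + delta) * a 0%N, p 1%N <= (1 + delta) * a 0%N,
     al * a 1%N - delta * a 0%N <= p 1%N & p 1%N <= al * a 1%N + delta * a 0%N].
Proof.
move=> dl0; have /andP[al1 al2] := rho_inv_bounds; rewrite -/al in al1 al2.
pose eta := al ^+ n; have eta0 : 0 < eta by rewrite exprn_gt0.
have eta1 : eta <= 1 by rewrite exprn_ile1 ?ltW.
pose N := 2 * (2 * n%:R + 1) / eta; have N0 : 0 < N by rewrite divr_gt0// mulr_gt0// ltr_pwDr// mulr_ge0.
have PN0 : 0 < 2 ^+ n * N by rewrite mulr_gt0// exprn_gt0.
(* The first bound keeps [al - de] at least 1/2. The second breaks the circle that [c] depends on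
   [La]: the contribution of [de * La] to the estimate [Lb] is at most half of [La], and its
   contribution to the conclusion at most half of [delta]. *)
pose de := Num.min (al - 1 / 2) (Num.min (1 / 2) (delta / 2) / (2 ^+ n * N)).
have de0 : 0 < de by rewrite lt_min subr_gt0 al1 /= divr_gt0// lt_min; apply/andP; split; lra.
have [deal [deN deD]] : [/\ de <= al - 1 / 2, 2 ^+ n * N * de <= 1 / 2 & 2 ^+ n * N * de <= delta / 2].
  have h : de <= Num.min (1 / 2) (delta / 2) / (2 ^+ n * N) by rewrite ge_min lexx orbT.
  rewrite ler_pdivlMr// mulrC le_min in h; case/andP: h => h1 h2; split => //.
  by rewrite ge_min lexx.
exists de => // K C K0 C0.
pose C2 := (2 * K + 4 * (2 * n%:R + 1) * C) / eta + 4 * C.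
pose C3 := (K + 2 * (2 * n%:R + 1) * C) / eta.
have n0 : 0 <= n%:R :> R by [].
have C30 : 0 <= C3 by rewrite divr_ge0 ?(ltW eta0)// addr_ge0// !mulr_ge0// addr_ge0// mulr_ge0.
have C20 : 0 <= C2.
  rewrite addr_ge0 ?mulr_ge0// ?invr_ge0 ?(ltW eta0)// addr_ge0 ?mulr_ge0// addr_ge0// mulr_ge0//.
exists (2 * (C2 + C3) / delta) => p a d hA a0 pa ap hd1 hd2 hs.
have {hs} hs := weighted_sum hs.
pose La := a n.-1; have nn : n.-1.+1 = n by rewrite prednK// ltnW.
have a_mono j k : (j <= k)%N -> (k < n)%N -> a j <= a k.
  move=> /subnK <-; elim: (k - j)%N => // i IH hi; apply: le_trans (IH (ltnW hi)) _.
  apply: le_trans (ap _ _) _; first by rewrite -ltnS nn.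
  by apply: pa; rewrite -addSn.
have aL k : (k < n)%N -> a k <= La by move=> kn; apply: a_mono; rewrite ?nn// -ltnS nn.
have L0 : 0 <= La by apply: a0; rewrite nn.
pose e := de * La + 2 * C; have e0 : 0 <= e by rewrite addr_ge0 ?mulr_ge0 ?(ltW de0).
have log_dist k : (k < n)%N -> de * a k <= de * La by move=> kn; rewrite ler_wpM2l ?(ltW de0)// aL.
have hE k : (k < n)%N -> - e <= d k - al * a k.
  by move=> kn; have := hd1 k kn; have := log_dist k kn; rewrite /e mulrBl; lra.
have hG k : (k < n)%N -> - e <= p k - al * a k.
  by move=> kn; have := hd1 k kn; have := hd2 k kn; have := log_dist k kn; rewrite /e mulrBl; lra.
have hm k : (k < n.-1)%N -> eta <= mu k.+1 /\ eta <= 1 - mu k.+1 by exact: mu_bounds.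
have kS k : (k < n.-1)%N -> (k.+1 < n)%N by rewrite -{2}nn ltnS.
have hW k : (k < n.-1)%N -> - e <= (1 - mu k.+1) * (p k.+1 - a k) + mu k.+1 * (p k.+1 - al * a k.+1).
  move=> kn; have [m1 m2] := hm k kn; have h1 := ap k kn; have h2 := hG _ (kS _ kn).
  have : 0 <= (1 - mu k.+1) * (p k.+1 - a k) by rewrite mulr_ge0 ?subr_ge0//; lra.
  have : mu k.+1 * (- e) <= mu k.+1 * (p k.+1 - al * a k.+1) by rewrite ler_wpM2l//; lra.
  have : 0 <= (1 - mu k.+1) * e by rewrite mulr_ge0//; lra.
  rewrite mulrBl mulrN; lra.
pose M := K + 2 * n%:R * e.
have M0 : 0 <= M by rewrite addr_ge0// !mulr_ge0.
have nm : n.-1%:R = n%:R - 1 :> R by rewrite -{2}nn -natr1 addrK.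
set SE := \sum_(k < n) (d k - al * a k) in hs.
set SW := \sum_(k < n.-1) _ in hs.
have SE0 : - (n%:R * e) <= SE.
  by rewrite mulrC -mulNr mulr_natr -[X in _ *+ X]card_ord -sumr_const; apply: ler_sum => k _; exact: hE.
have SW0 : - (n.-1%:R * e) <= SW.
  by rewrite mulrC -mulNr mulr_natr -[X in _ *+ X]card_ord -sumr_const; apply: ler_sum => k _; exact: hW.
have E0M : d 0%N - al * a 0%N <= M.
  have := @sum_single n (fun k => d k - al * a k) e 0 e0 hE (ltnW n1); rewrite -/SE /M.
  rewrite nm mulrBl in SW0; lra.
have WM k : (k < n.-1)%N -> (1 - mu k.+1) * (p k.+1 - a k) + mu k.+1 * (p k.+1 - al * a k.+1) <= M.
  move=> kn; have := @sum_single n.-1 (fun k => (1 - mu k.+1) * (p k.+1 - a k) + mu k.+1 * (p k.+1 - al * a k.+1)) e k e0 hW kn; rewrite -/SW /M.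
  rewrite nm mulrBl; lra.
pose M' := (M + e) / eta.
have MM' : M + e <= M' by rewrite ler_pdivlMr// ler_piMr// addr_ge0.
have HM k : (k < n.-1)%N -> p k.+1 - a k <= M'.
  move=> kn; have [m1 m2] := hm k kn; have h1 := ap k kn; have h2 := hG _ (kS _ kn).
  rewrite ler_pdivlMr// mulrC; apply: le_trans (_ : (1 - mu k.+1) * (p k.+1 - a k) <= _).
    by rewrite ler_wpM2r// subr_ge0.
  have := WM k kn.
  have : mu k.+1 * (- e) <= mu k.+1 * (p k.+1 - al * a k.+1) by rewrite ler_wpM2l//; lra.
  have : 0 <= (1 - mu k.+1) * e by rewrite mulr_ge0//; lra.
  rewrite mulrBl mulrN; lra.
have GM k : (k < n.-1)%N -> p k.+1 - al * a k.+1 <= M'.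
  move=> kn; have [m1 m2] := hm k kn; have h1 := ap k kn.
  have [h|h] := lerP (p k.+1 - al * a k.+1) 0; first by apply: le_trans h _; lra.
  rewrite ler_pdivlMr// mulrC; apply: le_trans (_ : mu k.+1 * (p k.+1 - al * a k.+1) <= _).
    by rewrite ler_wpM2r// ltW.
  have : 0 <= (1 - mu k.+1) * (p k.+1 - a k) by rewrite mulr_ge0 ?subr_ge0//; lra.
  have := WM k kn; lra.
pose c := 2 * M' + 4 * C.
have step k : (k < n.-1)%N -> a k.+1 <= 2 * a k + c.
  move=> kn; have h1 := HM k kn; have h2 := hd1 _ (kS _ kn); have h3 := hd2 _ (kS _ kn).
  have : 1 / 2 * a k.+1 <= (al - de) * a k.+1 by rewrite ler_wpM2r ?a0 ?kS//; lra.
  rewrite /c; lra.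
have grow k : (k < n)%N -> a k + c <= 2 ^+ k * (a 0%N + c).
  elim: k => [|k IH] kn; first by rewrite mul1r.
  have := IH (ltnW kn); have := step k; rewrite -ltnS nn => /(_ kn); rewrite exprS -mulrA; lra.
have c0 : 0 <= c by rewrite /c; lra.
have Lb : La <= 2 ^+ n * (a 0%N + c).
  apply: le_trans (_ : La + c <= _); first by rewrite lerDl.
  apply: le_trans (grow _ _) _; rewrite ?nn// ler_wpM2r//.
    by rewrite addr_ge0// a0// ltnW.
  by rewrite ler_weXn2l// ?ler1n// leq_pred.
have eM' : M' = N / 2 * (de * La) + C3.
  by rewrite /M' /M /e /N /C3; field; rewrite gt_eqF.
have ec : c = N * (de * La) + C2.
  by rewrite /c eM' /C3 /C2; field; rewrite gt_eqF.
have deL : 2 ^+ n * N * de * La <= 1 / 2 * La by rewrite ler_wpM2r.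
have Lb2 : La <= 2 * 2 ^+ n * (a 0%N + C2).
  have h : 2 ^+ n * (a 0%N + c) = 2 ^+ n * (a 0%N + C2) + 2 ^+ n * N * de * La by rewrite ec; ring.
  rewrite h in Lb; lra.
have M'b : M' <= delta * a 0%N.
  have h0 : N / 2 * de * La <= N / 2 * de * (2 * 2 ^+ n * (a 0%N + C2)).
    by apply: ler_wpM2l Lb2; rewrite mulr_ge0 ?(ltW de0)// mulr_ge0 ?(ltW N0).
  have aC : 0 <= a 0%N + C2 by rewrite addr_ge0// a0// ltnW.
  have h1 : 2 ^+ n * N * de * a 0%N <= delta / 2 * a 0%N by rewrite ler_wpM2r// a0// ltnW.
  have h2 : 2 ^+ n * N * de * C2 <= C2 by rewrite ler_piMl//; lra.
  have h3 : C2 + C3 <= delta / 2 * a 0%N by move: hA; rewrite ler_pdivrMr//; lra.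
  have h4 : N / 2 * de * (2 * 2 ^+ n * (a 0%N + C2)) = 2 ^+ n * N * de * a 0%N + 2 ^+ n * N * de * C2 by field.
  rewrite eM' mulrA; lra.
have n1' : (0 < n.-1)%N by rewrite -ltnS nn.
have r1 := HM 0%N n1'; have r2 := hG 1%N n1; have r3 := GM 0%N n1'.
clear -M0 e0 E0M MM' M'b r1 r2 r3.
by split; rewrite ?mulrDl ?mul1r; lra.
Qed.

End Weights.

(** * The upper bound *)

Section Logs.
Context (R : realType) (n : nat) (v : 'rV[R]_n.+1).
Hypotheses (n1 : (1 < n)%N) (v0 : v 0 0 = 1) (li : Q_independent v).
Local Notation iv x := (map_mx intr x : 'rV[R]_n.+1).
Local Notation rv x := (map_mx intr x : 'rV[rat]_n.+1).
Context (x : nat -> 'rV[int]_n.+1).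
Hypothesis hx : minimal_seq v x.

Definition log_norm i : R := ln `|iv (x i)|.
Definition log_dist i : R := - ln (dist v (x i)).

Let n0 : (0 < n)%N. Proof. exact: ltnW. Qed.

Lemma expR_log_norm i : expR (log_norm i) = `|iv (x i)|.
Proof. exact: ms_expK hx i. Qed.

Lemma expR_log_dist i : expR (- log_dist i) = dist v (x i).
Proof. by rewrite /log_dist opprK lnK// posrE dist_gt0// (ms_neq0 hx). Qed.

Lemma log_norm_mono i j : (i <= j)%N -> log_norm i <= log_norm j.
Proof. by move=> ij; rewrite -ler_expR !expR_log_norm; exact: ms_norm_mono hx _ _ ij. Qed.

Lemma log_norm_ge0 i : 0 <= log_norm i.
Proof. by rewrite ln_ge0// norm_iv_ge1// (ms_neq0 hx). Qed.

Lemma log_norm_infty M : exists I, forall i, (I <= i)%N -> M <= log_norm i.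
Proof. exact: ms_ln_infty hx M. Qed.

Lemma chain_log : exists2 K, 0 <= K & exists I, forall i0, (I <= i0)%N ->
  exists idx : nat -> nat, [/\ idx 0%N = i0, forall j, (j < n.-1)%N -> (idx j < idx j.+1)%N,
    0 <= K + log_norm i0 + \sum_(k < n) (log_norm (idx k).+1 - log_dist (idx k) - log_norm (idx k)),
    (forall j, (i0 <= j <= idx 1)%N -> (rv (x j) <= col_mx (rv (x i0.+1)) (rv (x i0)))%MS) &
    ~~ (rv (x (idx 1).+1) <= col_mx (rv (x i0.+1)) (rv (x i0)))%MS].
Proof.
pose D : R := 1 + 2 * `|v|; have D1 : 1 <= D by rewrite lerDl mulr_ge0.
pose F : R := (n.+1)`!%:R; have F1 : 1 <= F by rewrite ler1n fact_gt0.
exists (ln F + n%:R * ln D); first by rewrite addr_ge0 ?mulr_ge0 ?ln_ge0.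
have [I hI] := chain li hx n1; exists I => i0 /hI[idx [h1 h2 h3 h4 h5]].
exists idx; split => //; rewrite -ler_expR expR0.
suff -> : expR (ln F + n%:R * ln D + log_norm i0 + \sum_(k < n) (log_norm (idx k).+1 - log_dist (idx k) - log_norm (idx k)))
  = F * (`|iv (x i0)| * \prod_(j < n) gap v x (idx j)) by [].
have -> : ln F + n%:R * ln D + log_norm i0 + \sum_(k < n) (log_norm (idx k).+1 - log_dist (idx k) - log_norm (idx k))
  = ln F + (log_norm i0 + \sum_(k < n) (ln D + (log_norm (idx k).+1 - log_dist (idx k) - log_norm (idx k)))).
  by rewrite [in RHS]big_split /= sumr_const card_ord -(mulr_natl (ln D)); ring.
rewrite !expRD expR_log_norm lnK ?posrE; last by apply: lt_le_trans F1.
rewrite expR_sum; congr (_ * (_ * _)); apply: eq_bigr => k _.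
by rewrite !expRD expR_log_dist expRN !expR_log_norm lnK ?posrE ?(lt_le_trans ltr01 D1).
Qed.

Lemma log_dist_ge l : unif v l -> exists2 C, 0 <= C & exists I, forall i, (I <= i)%N ->
  l * log_norm i.+1 - C <= log_dist i.
Proof.
move=> /(ms_dist_le v0 hx)[C [I [C0 hI]]]; exists `|ln C|; rewrite ?normr_ge0//.
exists I => i /hI; rewrite -expR_log_dist -[X in X * _]lnK ?posrE// -expRD ler_expR -/(log_norm _).
have := ler_norm (ln C); lra.
Qed.

Lemma log_dist_le c : 0 < c -> (exists I, forall i, (I <= i)%N -> c <= `|iv (x i)| * dist v (x i)) ->
  exists2 C, 0 <= C & exists I, forall i, (I <= i)%N -> log_dist i <= log_norm i + C.
Proof.
move=> c0 [I hI]; exists `|ln c|; rewrite ?normr_ge0//; exists I => i /hI.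
rewrite -expR_log_dist -expR_log_norm -expRD -[leLHS]lnK ?posrE// ler_expR.
have := ler_norm (- ln c); rewrite normrN; lra.
Qed.

Lemma idx_ge idx i0 : idx 0%N = i0 -> (forall j, (j < n.-1)%N -> (idx j < idx j.+1)%N) ->
  forall k, (k < n)%N -> (i0 <= idx k)%N.
Proof.
move=> <- mono; elim=> // k IH kn; apply: leq_trans (IH (ltnW kn)) (ltnW (mono _ _)).
by rewrite ltn_predRL.
Qed.

Section Exponent.
Context (rho : R).
Hypotheses (rho1 : 1 < rho) (rho2 : rho < 2) (hrho : root (rho_poly R n) rho).
Hypothesis hlow : exists2 c, 0 < c &
  exists I, forall i, (I <= i)%N -> c <= `|iv (x i)| * dist v (x i).

(** The bracket at [k = 0] gains [(l - rho^-1) * log_norm i0.+1], which is unbounded in [i0], while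
    the other brackets are bounded below. *)
Lemma no_unif_gt l : rho^-1 < l -> ~ unif v l.
Proof.
move=> rl hu; have [c c0 /(log_dist_le c0)[C2 C20 [I2 h2]]] := hlow.
have [C1 C10 [I1 h1]] := log_dist_ge hu; have [K K0 [I hI]] := chain_log.
have lr0 : 0 < l - rho^-1 by rewrite subr_gt0.
have [I3 h3] := log_norm_infty ((K + n%:R * C1 + n%:R * (C1 + C2)) / (l - rho^-1) + 1).
pose i0 := maxn I (maxn I1 (maxn I2 I3)).
have [idx [e0 mono hs _ _]] := hI i0 (leq_maxl _ _).
have ge := idx_ge e0 mono.
have iI1 k : (k < n)%N -> (I1 <= idx k)%N.
  by move=> /ge; apply: leq_trans; rewrite /i0 !leq_max leqnn !orbT.
have iI2 k : (k < n)%N -> (I2 <= idx k)%N.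
  by move=> /ge; apply: leq_trans; rewrite /i0 !leq_max leqnn !orbT.
rewrite -{1}e0 in hs.
have hw := weighted_sum n1 rho1 hrho (p := fun k => log_norm (idx k)) (a := fun k => log_norm (idx k).+1) (d := fun k => log_dist (idx k)) hs.
have /andP[a1 a2] := rho_inv_bounds rho1 rho2.
have E k : (k < n)%N -> - C1 <= log_dist (idx k) - rho^-1 * log_norm (idx k).+1.
  move=> kn; have := h1 _ (iI1 k kn).
  have : 0 <= (l - rho^-1) * log_norm (idx k).+1 by rewrite mulr_ge0 ?(ltW lr0) ?log_norm_ge0.
  rewrite mulrBl; lra.
have E0 : (l - rho^-1) * log_norm i0.+1 - C1 <= log_dist (idx 0%N) - rho^-1 * log_norm (idx 0%N).+1.
  by have := h1 _ (iI1 0%N n0); rewrite e0 mulrBl; lra.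
have W k : (k < n.-1)%N -> - (C1 + C2) <= (1 - mu rho k.+1) * (log_norm (idx k.+1) - log_norm (idx k).+1) +
    mu rho k.+1 * (log_norm (idx k.+1) - rho^-1 * log_norm (idx k.+1).+1).
  move=> kn; have kn' : (k.+1 < n)%N by rewrite -ltn_predRL.
  have [m1 m2] := mu_bounds n1 rho1 rho2 hrho kn.
  have p0 : 0 < rho^-1 ^+ n by rewrite exprn_gt0//; lra.
  have t1 : 0 <= (1 - mu rho k.+1) * (log_norm (idx k.+1) - log_norm (idx k).+1).
    by rewrite mulr_ge0 ?subr_ge0 ?log_norm_mono ?mono//; lra.
  have t2 : mu rho k.+1 * (- (C1 + C2)) <= mu rho k.+1 * (log_norm (idx k.+1) - rho^-1 * log_norm (idx k.+1).+1).
    apply: ler_wpM2l; first by lra.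
    have := E _ kn'; have := h2 _ (iI2 _ kn'); lra.
  have t3 : 0 <= (1 - mu rho k.+1) * (C1 + C2) by rewrite mulr_ge0 ?(addr_ge0 C10 C20)//; lra.
  apply: le_trans (lerD t1 t2); rewrite add0r mulrN lerN2 -subr_ge0.
  by apply: le_trans t3 _; rewrite mulrBl mul1r.
have := h3 i0.+1; rewrite /i0 !leqW ?leq_max ?leqnn ?orbT// => /(_ isT); rewrite -/i0.
have sW : - (n%:R * (C1 + C2)) <= \sum_(k < n.-1) ((1 - mu rho k.+1) * (log_norm (idx k.+1) - log_norm (idx k).+1) +
    mu rho k.+1 * (log_norm (idx k.+1) - rho^-1 * log_norm (idx k.+1).+1)).
  apply: le_trans (_ : \sum_(k < n.-1) - (C1 + C2) <= _); last by apply: ler_sum => k _; exact: W.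
  by rewrite sumr_const card_ord mulNrn -(mulr_natl (C1 + C2)) lerN2 ler_wpM2r ?addr_ge0// ler_nat leq_pred.
have sE : (l - rho^-1) * log_norm i0.+1 - n%:R * C1 <= \sum_(k < n) (log_dist (idx k) - rho^-1 * log_norm (idx k).+1).
  rewrite (bigD1 (Ordinal n0))//=.
  have -> : (l - rho^-1) * log_norm i0.+1 - n%:R * C1 = ((l - rho^-1) * log_norm i0.+1 - C1) + (- ((n%:R - 1) * C1)) by ring.
  apply: lerD => //.
  apply: le_trans (_ : \sum_(k < n | k != Ordinal n0) - C1 <= _); last by apply: ler_sum => k _; exact: E.
  by rewrite sumr_const cardC1 card_ord mulNrn -(mulr_natl C1) lerN2 -subn1 natrB.
rewrite -lerBrDr ler_pdivrMr// [X in _ <= X * _ -> _](_ : _ = log_norm i0.+1 - 1)// mulrBl mul1r [log_norm _ * _]mulrC; lra.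
Qed.

Hypothesis hu : forall l, l < rho^-1 -> unif v l.

Lemma log_dist_tight (e : R) : 0 < e -> exists I, forall i, (I <= i)%N ->
  [/\ (rho^-1 - e) * log_norm i.+1 <= log_dist i, log_dist i <= (rho^-1 + e) * log_norm i.+1 &
   exists i1, [/\ (i < i1)%N,
     (forall j, (i <= j <= i1)%N -> (rv (x j) <= col_mx (rv (x i.+1)) (rv (x i)))%MS),
     ~~ (rv (x i1.+1) <= col_mx (rv (x i.+1)) (rv (x i)))%MS, log_norm i1 <= (1 + e) * log_norm i.+1 &
     rho^-1 * log_norm i1.+1 - e * log_norm i.+1 <= log_norm i1 <= rho^-1 * log_norm i1.+1 + e * log_norm i.+1]].
Proof.
move=> e0; have [c c0 /(log_dist_le c0)[C2 C20 [I2 h2]]] := hlow.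
have [de de0 hde] := weighted_tight n1 rho1 rho2 hrho e0.
have [C1 C10 [I1 h1]] := log_dist_ge (hu (ltac:(by rewrite ltrBlDr ltrDl) : rho^-1 - de < rho^-1)).
have [C3 C30 [I3 h3]] := log_dist_ge (hu (ltac:(by rewrite ltrBlDr ltrDl divr_gt0) : rho^-1 - e / 2 < rho^-1)).
have [K K0 [I hI]] := chain_log.
have C120 : 0 <= C1 + C2 by rewrite addr_ge0.
have [A0 hA] := hde K (C1 + C2) K0 C120.
have [I4 h4] := log_norm_infty (Num.max A0 (C3 / (e / 2))).
exists (maxn I (maxn I1 (maxn I2 (maxn I3 I4)))) => i; rewrite !geq_max => /and5P[iI iI1 iI2 iI3 iI4].
have [idx [e0' mono hs hin hout]] := hI i iI.
have ge := idx_ge e0' mono.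
have := h4 i.+1 (leqW iI4); rewrite ge_max => /andP[hA0 hC3].
rewrite -{1}e0' in hs.
have [||||||q1 q2 q3 q4] := hA (fun k => log_norm (idx k)) (fun k => log_norm (idx k).+1) (fun k => log_dist (idx k)) _ _ _ _ _ _ hs.
- by rewrite e0'.
- by move=> k _; exact: log_norm_ge0.
- by move=> k _; exact: log_norm_mono.
- by move=> k kn; apply/log_norm_mono/mono.
- by move=> k kn; have := h1 _ (leq_trans iI1 (ge k kn)); lra.
- by move=> k kn; have := h2 _ (leq_trans iI2 (ge k kn)); lra.
rewrite e0' in q1 q2 q3 q4; split => //.
  have := h3 i iI3; move: hC3; rewrite ler_pdivrMr ?divr_gt0//; lra.
exists (idx 1%N); split => //; first by rewrite -e0'; apply: mono; rewrite ltn_predRL.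
exact/andP.
Qed.

End Exponent.
End Logs.

(** * Reflections *)

(** This is [- bf S x x] times the reflection of [y] in the hyperplane orthogonal to [x]. Without
    denominators it maps integral points to integral points and makes sense for isotropic [x]. *)
Definition reflv (K : comNzRingType) (m : nat) (S : 'M[K]_m) (x y : 'rV[K]_m) : 'rV[K]_m :=
  (2 * bf S x y) *: x - bf S x x *: y.

Lemma reflvK (K : comNzRingType) (m : nat) (S : 'M[K]_m) (x y : 'rV[K]_m) :
  reflv S x (reflv S x y) = bf S x x ^+ 2 *: y.
Proof.
rewrite /reflv bfDr bfNr !bfZr scalerBr !scalerA; apply/rowP => i; rewrite !mxE; ring.
Qed.

Lemma reflvZ (K : comNzRingType) (m : nat) (S : 'M[K]_m) (x y : 'rV[K]_m) a b :
  reflv S (a *: x) (b *: y) = (a ^+ 2 * b) *: reflv S x y.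
Proof. by rewrite /reflv !bfE; apply/rowP => i; rewrite !mxE; ring. Qed.

Lemma reflv_map (K L : comNzRingType) (f : {rmorphism K -> L}) (m : nat)
  (S : 'M[K]_m) (x y : 'rV[K]_m) :
  reflv (map_mx f S) (map_mx f x) (map_mx f y) = map_mx f (reflv S x y).
Proof. by rewrite /reflv map_mxB !map_mxZ !bf_map rmorphM /= rmorph_nat. Qed.

Definition minor3 (K : comNzRingType) (m : nat) (a b c : 'rV[K]_m) (i j k : 'I_m) : K :=
  a 0 i * (b 0 j * c 0 k - b 0 k * c 0 j) - a 0 j * (b 0 i * c 0 k - b 0 k * c 0 i)
  + a 0 k * (b 0 i * c 0 j - b 0 j * c 0 i).

Lemma minor3_dep (m : nat) (w y z : 'rV[int]_m) a b :
  (forall i j k, minor3 w y z i j k = 0) -> y 0 a * z 0 b - y 0 b * z 0 a != 0 ->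
  exists p r : rat, map_mx intr w = p *: map_mx intr y + r *: (map_mx intr z : 'rV[rat]_m).
Proof.
move=> h d0; set d := (_ - _) in d0; have d0' : d%:~R != 0 :> rat by rewrite intr_eq0.
exists ((w 0 a * z 0 b - w 0 b * z 0 a)%:~R / d%:~R), ((w 0 b * y 0 a - w 0 a * y 0 b)%:~R / d%:~R).
apply/rowP => i; rewrite !mxE; apply: (mulIf d0').
transitivity ((w 0 a * z 0 b - w 0 b * z 0 a)%:~R * (y 0 i)%:~R +
   (w 0 b * y 0 a - w 0 a * y 0 b)%:~R * (z 0 i)%:~R : rat); last by field.
rewrite -!rmorphM /= -rmorphD; congr (_%:~R).
by have := h i a b; rewrite /minor3 /d => e; apply/eqP; rewrite -subr_eq0 -e; apply/eqP; ring.
Qed.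

Section Estimates.
Context (R : realType) (n : nat) (v : 'rV[R]_n.+1).
Hypothesis v0 : v 0 0 = 1.
Local Notation iv x := (map_mx intr x : 'rV[R]_n.+1).

Lemma minor3_le (a b c : 'rV[R]_n.+1) i j k :
  `|minor3 a b c i j k| <= 6 * (`|a| * `|b| * `|c|).
Proof.
have h2 p q : `|b 0 p * c 0 q - b 0 q * c 0 p| <= 2 * (`|b| * `|c|).
  rewrite mulr2n mulrDl mul1r; apply: le_trans (ler_normB _ _) _; rewrite !normrM.
  by apply: lerD; apply: ler_pM => //; exact: norm_coord.
have h3 p q r : `|a 0 p * (b 0 q * c 0 r - b 0 r * c 0 q)| <= 2 * (`|a| * `|b| * `|c|).
  rewrite normrM [leRHS](_ : _ = `|a| * (2 * (`|b| * `|c|))); last by ring.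
  by apply: ler_pM => //; exact: norm_coord.
apply: le_trans (ler_normD _ _) _.
apply: le_trans (lerD (ler_normB _ _) (lexx _)) _.
have := h3 i j k; have := h3 j i k; have := h3 k i j; lra.
Qed.

Lemma dist_le_norm (x : 'rV[int]_n.+1) : dist v x <= (1 + `|v|) * `|iv x|.
Proof. by have := dist_le v0 x 0; rewrite scale0r subr0. Qed.

(** Each argument is a multiple of [v] plus a short vector. As the minor is alternating, terms
    containing [v] twice vanish, so every surviving term has at least two short factors; the term
    with three is absorbed by [dist_le_norm]. *)
Lemma minor3_bound (a b c : 'rV[int]_n.+1) i j k :
  `|(minor3 a b c i j k)%:~R : R| <= 6 * (1 + 2 * `|v|) *
    (`|iv a| * dist v b * dist v c + dist v a * `|iv b| * dist v c + dist v a * dist v b * `|iv c|).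
Proof.
pose e z : 'rV[R]_n.+1 := iv z - (z 0 0)%:~R *: v.
have -> : (minor3 a b c i j k)%:~R = minor3 (e a) (e b) (e c) i j k +
   ((a 0 0)%:~R * minor3 v (e b) (e c) i j k + (b 0 0)%:~R * minor3 (e a) v (e c) i j k
    + (c 0 0)%:~R * minor3 (e a) (e b) v i j k).
  by rewrite /minor3 /e !mxE !(rmorphD, rmorphN, rmorphM) /=; ring.
have ee z : `|e z| = dist v z by [].
have h0 (z : 'rV[int]_n.+1) (t T : R) : `|t| <= T -> `|(z 0 0)%:~R * t| <= `|iv z| * T.
  by move=> tT; rewrite normrM ler_pM//; apply: le_trans (norm_coord _ 0); rewrite mxE.
have ha := h0 a _ _ (minor3_le v (e b) (e c) i j k).
have hb := h0 b _ _ (minor3_le (e a) v (e c) i j k).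
have hc := h0 c _ _ (minor3_le (e a) (e b) v i j k).
have hd := minor3_le (e a) (e b) (e c) i j k.
have h4 : `|e a| * `|e b| * `|e c| <= (1 + `|v|) * (`|iv a| * `|e b| * `|e c|).
  by rewrite !mulrA !ler_wpM2r//; exact: dist_le_norm.
apply: le_trans (ler_normD _ _) _.
apply: le_trans (lerD (lexx _) (le_trans (ler_normD _ _) (lerD (ler_normD _ _) (lexx _)))) _.
rewrite -!ee; apply: le_trans (lerD hd (lerD (lerD ha hb) hc)) _.
set A := `|iv a| in h4 *; set B := `|iv b|; set C := `|iv c|.
set p := `|e a| in h4 *; set q := `|e b| in h4 *; set r := `|e c| in h4 *; set V := `|v| in h4 *.
have V0 : 0 <= V by exact: normr_ge0.
have t1 : 0 <= p * B * r by rewrite !mulr_ge0 ?normr_ge0.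
have t2 : 0 <= p * q * C by rewrite !mulr_ge0 ?normr_ge0.
have t1V : 0 <= V * (p * B * r) by rewrite mulr_ge0.
have t2V : 0 <= V * (p * q * C) by rewrite mulr_ge0.
rewrite [leLHS](_ : _ = 6 * (p * q * r) + 6 * V * (A * q * r + p * B * r + p * q * C)); last by ring.
rewrite [leRHS](_ : _ = 6 * ((1 + V) * (A * q * r)) + 6 * V * (A * q * r + p * B * r + p * q * C)
   + 6 * (p * B * r) + 6 * (p * q * C) + 6 * (V * (p * B * r)) + 6 * (V * (p * q * C))); last by ring.
lra.
Qed.

Lemma minor3_eq0 (a b c : 'rV[int]_n.+1) i j k :
  6 * (1 + 2 * `|v|) *
    (`|iv a| * dist v b * dist v c + dist v a * `|iv b| * dist v c + dist v a * dist v b * `|iv c|) < 1 ->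
  minor3 a b c i j k = 0.
Proof.
move=> /(le_lt_trans (minor3_bound a b c i j k)).
by rewrite -intr_norm -[1]/(1%:~R) ltr_int; case: (minor3 _ _ _ _ _ _) => [[]|[]].
Qed.

Context (S : 'M[int]_n.+1).
Hypothesis ST : S^T = S.
Local Notation SR := (map_mx intr S : 'M[R]_n.+1).
Hypothesis Qv : bf SR v v = 0.

Lemma reflv_bound : exists2 C, 0 < C & forall x y : 'rV[int]_n.+1,
  `|iv (reflv S x y)| <= C * (`|iv x| ^+ 2 * dist v y + `|iv y| * dist v x ^+ 2) /\
  dist v (reflv S x y) <= C * (`|iv x| * dist v x * dist v y + `|iv y| * dist v x ^+ 2).
Proof.
have SRT : SR^T = SR by rewrite map_trmx ST.
have [C C0 hC] := bf_bound SR.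
pose V := `|v|; have V0 : 0 <= V by exact: normr_ge0.
pose D := 1 + V; have D1 : 1 <= D by rewrite lerDl.
pose C1 := 10 * C * D ^+ 2.
have D0 : 0 < D by exact: lt_le_trans ltr01 D1.
have C10 : 0 < C1 by rewrite !mulr_gt0.
exists (C1 * D + C1 * D); first by rewrite addr_gt0// mulr_gt0.
move=> x y; pose e z : 'rV[R]_n.+1 := iv z - (z 0 0)%:~R *: v.
pose a : R := (x 0 0)%:~R; pose b : R := (y 0 0)%:~R.
have eD z : iv z = (z 0 0)%:~R *: v + e z by rewrite addrC subrK.
set X := `|iv x|; set Y := `|iv y|; set p := dist v x; set r := dist v y.
have hpX : p <= D * X by exact: dist_le_norm.
have hrY : r <= D * Y by exact: dist_le_norm.
have [X0 Y0 p0 r0] : [/\ 0 <= X, 0 <= Y, 0 <= p & 0 <= r] by rewrite !normr_ge0.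
have aX : `|a| <= X by apply: le_trans (norm_coord _ 0); rewrite mxE.
have bY : `|b| <= Y by apply: le_trans (norm_coord _ 0); rewrite mxE.
pose c1 := bf SR v (e y); pose c2 := bf SR v (e x); pose c3 := bf SR (e x) (e y); pose c4 := bf SR (e x) (e x).
have hc1 : `|c1| <= C * D * r by apply: le_trans (hC _ _) _; rewrite ler_wpM2r// ler_wpM2l ?(ltW C0)// lerDr.
have hc2 : `|c2| <= C * D * p by apply: le_trans (hC _ _) _; rewrite ler_wpM2r// ler_wpM2l ?(ltW C0)// lerDr.
have hc3 : `|c3| <= C * p * r by exact: hC.
have hc4 : `|c4| <= C * p * p by exact: hC.
have key s t (w z : 'rV[R]_n.+1) : bf SR (s *: v + w) (t *: v + z) =
   s * bf SR v z + t * bf SR v w + bf SR w z.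
  by rewrite !bfE Qv (bfC w v SRT); ring.
have hB : bf SR (iv x) (iv y) = a * c1 + b * c2 + c3 by rewrite !eD key.
have hQ : bf SR (iv x) (iv x) = 2 * a * c2 + c4 by rewrite !eD key /a /c2 /c4; ring.
have CD : 0 <= C * D by rewrite mulr_ge0 ?(ltW C0)// (le_trans ler01 D1).
have prod_le (s t s' t' : R) : `|s| <= s' -> `|t| <= t' -> `|s * t| <= s' * t'.
  by move=> ? ?; rewrite normrM ler_pM.
have bB : `|bf SR (iv x) (iv y)| <= C * D * (2 * X * r + Y * p).
  rewrite hB; apply: le_trans (ler_normD _ _) _; apply: le_trans (lerD (ler_normD _ _) (lexx _)) _.
  have t1 := prod_le _ _ _ _ aX hc1; have t2 := prod_le _ _ _ _ bY hc2.
  have t3 : C * p * r <= C * (D * X) * r by rewrite ler_wpM2r// ler_wpM2l// ltW.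
  apply: le_trans (lerD (lerD t1 t2) (le_trans hc3 t3)) _; rewrite le_eqVlt; apply/orP; left; apply/eqP; ring.
have bQ : `|bf SR (iv x) (iv x)| <= C * D * (3 * X * p).
  rewrite hQ; apply: le_trans (ler_normD _ _) _.
  have t1 := prod_le _ _ _ _ aX hc2.
  have t3 : C * p * p <= C * (D * X) * p by rewrite ler_wpM2r// ler_wpM2l// ltW.
  rewrite -mulrA normrM ger0_norm//.
  apply: le_trans (lerD (ler_wpM2l _ t1) (le_trans hc4 t3)) _ => //.
  rewrite le_eqVlt; apply/orP; left; apply/eqP; ring.
set w := reflv S x y.
have ew : iv w = (2 * bf SR (iv x) (iv y)) *: iv x - bf SR (iv x) (iv x) *: iv y.
  by rewrite /w -reflv_map.
have w0 : (w 0 0)%:~R = 2 * bf SR (iv x) (iv y) * a - bf SR (iv x) (iv x) * b.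
  by move/rowP: ew => /(_ 0); rewrite !mxE.
have errw : dist v w <= C1 * (X * p * r + Y * p ^+ 2).
  rewrite /dist ew w0.
  have -> : (2 * bf SR (iv x) (iv y)) *: iv x - bf SR (iv x) (iv x) *: iv y -
     (2 * bf SR (iv x) (iv y) * a - bf SR (iv x) (iv x) * b) *: v =
     (2 * bf SR (iv x) (iv y)) *: e x - bf SR (iv x) (iv x) *: e y.
    by apply/rowP => i; rewrite !mxE; ring.
  apply: le_trans (ler_normB _ _) _; rewrite !normrZ (_ : `|e x| = p)// (_ : `|e y| = r)//.
  have t1 := ler_wpM2r p0 bB; have t2 := ler_wpM2r r0 bQ.
  have -> : `|2 : R| = 2 by rewrite ger0_norm.
  have D2 : C * D <= C * D ^+ 2 by rewrite ler_wpM2l ?(ltW C0)// expr2 ler_peMr// (le_trans ler01 D1).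
  have P0 : 0 <= X * p * r by rewrite !mulr_ge0.
  have P1 : 0 <= Y * p ^+ 2 by rewrite !mulr_ge0.
  have s1 := ler_wpM2r P0 D2; have s2 := ler_wpM2r P1 D2.
  have s3 : 0 <= C * D * (X * p * r) by rewrite mulr_ge0.
  have s4 : 0 <= C * D * (Y * p ^+ 2) by rewrite mulr_ge0.
  rewrite [in leRHS]/C1 -/p -/r.
  have -> : 10 * C * D ^+ 2 * (X * p * r + Y * p ^+ 2) = 10 * (C * D ^+ 2 * (X * p * r)) + 10 * (C * D ^+ 2 * (Y * p ^+ 2)) by ring.
  have e1 : C * D * (2 * X * r + Y * p) * p = 2 * (C * D * (X * p * r)) + C * D * (Y * p ^+ 2) by ring.
  have e2 : C * D * (3 * X * p) * r = 3 * (C * D * (X * p * r)) by ring.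
  rewrite e1 in t1; rewrite e2 in t2; rewrite -mulrA; clear -t1 t2 s1 s2 s3 s4; lra.
split; last first.
  apply: le_trans errw _; rewrite ler_wpM2r ?addr_ge0 ?mulr_ge0 ?exprn_ge0//.
  have : C1 <= C1 * D by rewrite ler_peMr ?(ltW C10).
  clear -C10; lra.
have hw0 : `|(w 0 0)%:~R : R| <= C1 * (X ^+ 2 * r + Y * p ^+ 2).
  (* The two terms [2 * a * b * c2] cancel. Bounded separately they would contribute the product of
     both norms with the distance of [x], which is too large. *)
  have -> : (w 0 0)%:~R = a * (a * (2 * c1) + 2 * c3) - b * c4 :> R by rewrite w0 hB hQ; ring.
  apply: le_trans (ler_normB _ _) _.
  have n2 : `|2 * c1| <= 2 * (C * D * r) by rewrite normrM ger0_norm// ler_wpM2l.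
  have n3 : `|2 * c3| <= 2 * (C * (D * X) * r).
    rewrite normrM ger0_norm// ler_wpM2l//; apply: le_trans hc3 _.
    by rewrite ler_wpM2r// ler_wpM2l// ltW.
  have t1 := prod_le _ _ _ _ aX (le_trans (ler_normD _ _) (lerD (prod_le _ _ _ _ aX n2) n3)).
  have t2 := prod_le _ _ _ _ bY hc4.
  have D2 : C * D <= C * D ^+ 2 by rewrite ler_wpM2l ?(ltW C0)// expr2 ler_peMr// (le_trans ler01 D1).
  have D3 : C <= C * D ^+ 2 by rewrite ler_peMr ?(ltW C0)// exprn_ege1.
  have P0 : 0 <= X ^+ 2 * r by rewrite !mulr_ge0 ?exprn_ge0.
  have P1 : 0 <= Y * p ^+ 2 by rewrite !mulr_ge0.
  have s1 := ler_wpM2r P0 D2; have s2 := ler_wpM2r P1 D3.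
  have s3 : 0 <= C * D * (X ^+ 2 * r) by rewrite mulr_ge0.
  have s4 : 0 <= C * (Y * p ^+ 2) by rewrite mulr_ge0 ?(ltW C0).
  rewrite [in leRHS]/C1.
  have -> : 10 * C * D ^+ 2 * (X ^+ 2 * r + Y * p ^+ 2) = 10 * (C * D ^+ 2 * (X ^+ 2 * r)) + 10 * (C * D ^+ 2 * (Y * p ^+ 2)) by ring.
  have e1 : X * (X * (2 * (C * D * r)) + 2 * (C * (D * X) * r)) = 4 * (C * D * (X ^+ 2 * r)) by ring.
  have e2 : Y * (C * p * p) = C * (Y * p ^+ 2) by ring.
  rewrite e1 in t1; rewrite e2 in t2; clear -t1 t2 s1 s2 s3 s4; lra.
have -> : iv w = (w 0 0)%:~R *: v + (iv w - (w 0 0)%:~R *: v) by rewrite addrC subrK.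
apply: le_trans (ler_normD _ _) _; rewrite normrZ [leRHS]mulrDl; apply: lerD.
  apply: le_trans (ler_wpM2r V0 hw0) _; rewrite mulrAC; apply: ler_wpM2r.
    by rewrite addr_ge0 ?mulr_ge0 ?exprn_ge0.
  by rewrite ler_wpM2l ?(ltW C10)// lerDr.
apply: le_trans errw _; rewrite -[C1 * D * _]mulrA ler_wpM2l ?(ltW C10)// mulrDr; apply: lerD.
  rewrite [leRHS](_ : _ = (D * X) * (X * r)); last by ring.
  by rewrite mulrAC [leLHS]mulrC ler_wpM2r ?mulr_ge0.
by rewrite ler_peMl// mulr_ge0// exprn_ge0.
Qed.

End Estimates.

(** * The recurrence satisfied by extremal points *)

(** These are the exponents of the three terms of [minor3_bound] in units of [ln |y_j|], with [r]
    and [t] those of [y_(j+1)] and [y_(j+2)] and [6 * e] the accumulated error. The critical one is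
    the last, equal to [- c + 6 * e]; whence the factor 12. *)
Lemma minor_exponents1 (R : realFieldType) (r t e c : R) :
  c = 12 * e -> c <= 1 -> t = 2 * r - c -> 1 <= t ->
  [/\ r + 4 * e + (- r + e) + (- t + e) <= - (c / 2),
     - r + 4 * e + (r + e) + (- t + e) <= - (c / 2) &
     - r + 4 * e + (- r + e) + (t + e) <= - (c / 2)].
Proof. by move=> ? ? ? ?; split; lra. Qed.

Lemma minor_exponents2 (R : realFieldType) (r e c : R) :
  c = 12 * e -> c <= 1 -> 1 < r ->
  [/\ r + 4 * e + (- 1 + e) + (- r + e) <= - (c / 2),
     - r + 4 * e + (1 + e) + (- r + e) <= - (c / 2) &
     - r + 4 * e + (- 1 + e) + (r + e) <= - (c / 2)].
Proof. by move=> ? ? ?; split; lra. Qed.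

Section Rigidity.
Context (R : realType) (n : nat) (v : 'rV[R]_n.+1) (S : 'M[int]_n.+1).
Hypotheses (n1 : (1 < n)%N) (v0 : v 0 0 = 1) (li : Q_independent v).
Hypotheses (ST : S^T = S) (Qv : bf (map_mx intr S) v v = 0).
Local Notation iv x := (map_mx intr x : 'rV[R]_n.+1).
Local Notation rv x := (map_mx intr x : 'rV[rat]_n.+1).
Context (rho : R).
Hypotheses (rho1 : 1 < rho) (rho2 : rho < 2) (hrho : root (rho_poly R n) rho).

Section Essential.
Context (x : nat -> 'rV[int]_n.+1).
Hypothesis hx : minimal_seq v x.
Hypothesis hlow : exists2 c, 0 < c &
  exists I, forall i, (I <= i)%N -> c <= `|iv (x i)| * dist v (x i).
Hypothesis hu : forall l, l < rho^-1 -> unif v l.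
Local Notation log_norm := (log_norm R x).
Local Notation log_dist := (log_dist v x).

(** The index [s j.+1] is the last one before the points leave the plane of [x (s j)] and its
    successor. Hence [x (s j.+2)] lies in the plane spanned at [s j.+1], whose intersection with the
    previous plane is the line of [x (s j.+1)]; this gives the independence of three consecutive
    terms. *)
Lemma essential_seq I : exists s : nat -> nat, [/\ (I <= s 0%N)%N, forall j, (s j < s j.+1)%N,
  forall j p r, rv (x (s j.+2)) <> p *: rv (x (s j)) + r *: rv (x (s j.+1)) &
  forall e, 0 < e -> exists J, forall j, (J <= j)%N ->
    `|log_norm (s j.+1) - rho * log_norm (s j)| <= e * log_norm (s j) /\ `|log_dist (s j) - log_norm (s j)| <= e * log_norm (s j)].
Proof.
have tight := log_dist_tight n1 v0 li hx rho1 rho2 hrho hlow hu.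
pose span i := (col_mx (rv (x i.+1)) (rv (x i))).
pose Ex i i1 := [/\ (i < i1)%N, (forall j, (i <= j <= i1)%N -> (rv (x j) <= span i)%MS) &
  ~~ (rv (x i1.+1) <= span i)%MS].
(* The estimate [tight] yields an index for each precision [e]; uniqueness makes it the same for
   all, so that one sequence serves every [e]. *)
have Ex_uniq i a b : Ex i a -> Ex i b -> a = b.
  move=> [ia ha na] [ib hb nb]; case: (ltngtP a b) => // h.
    by move: na; rewrite hb// leqW// ltnW.
  by move: nb; rewrite ha// leqW// ltnW.
have [I0 hI0] := tight 1 ltr01.
have /choice[f hf] : forall i, exists i1, (I0 <= i)%N -> Ex i i1.
  move=> i; case: (leqP I0 i) => [/hI0[_ _ [i1 [? ? ? _ _]]]|_]; last by exists 0%N.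
  by exists i1.
pose s j := iter j f (maxn I I0).
have sI0 j : (I0 <= s j)%N /\ Ex (s j) (s j.+1).
  elim: j => [|j [IH1 [IH2 _ _]]]; first by split; [|apply: hf]; exact: leq_maxr.
  have h : (I0 <= s j.+1)%N by apply: leq_trans IH1 (ltnW IH2).
  by split => //; exact: hf.
have sE j : Ex (s j) (s j.+1) by have [] := sI0 j.
have s_lt j : (s j < s j.+1)%N by have [] := sE j.
have s_ge j : (j <= s j)%N by elim: j => // j IH; apply: leq_ltn_trans IH (s_lt j).
exists s; split => //; first exact: leq_maxl.
  move=> j p r e; have [_ hin hout] := sE j; have [_ hin' _] := sE j.+1.
  have y2 : (rv (x (s j.+2)) <= span (s j))%MS.
    by rewrite e addmx_sub// scalemx_sub// hin// leqnn ltnW.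
  have y1 : (rv (x (s j.+1)) <= span (s j))%MS by rewrite hin// leqnn ltnW.
  have /submxP[D hD] : (rv (x (s j.+2)) <= span (s j.+1))%MS by rewrite hin'// leqnn ltnW.
  have hD' : rv (x (s j.+2)) = D 0 (lshift 1 0) *: rv (x (s j.+1).+1) + D 0 (rshift 1 0) *: rv (x (s j.+1)).
    rewrite hD -{1}[D]hsubmxK mul_row_col; congr (_ + _).
      by apply/rowP => k; rewrite !mxE big_ord1 !mxE.
    by apply/rowP => k; rewrite !mxE big_ord1 !mxE.
  have [D0|D0] := eqVneq (D 0 (lshift 1 0)) 0.
    rewrite D0 scale0r add0r in hD'; set b := D _ _ in hD'.
    have b0 : b != 0.
      apply: contraNneq (ms_neq0 hx (s j.+2)) => b0; apply/eqP/rowP => k.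
      by move/rowP: hD' => /(_ k); rewrite b0 !mxE mul0r => /eqP; rewrite intr_eq0 => /eqP.
    apply: (@ms_nprop _ _ _ _ hx (s j.+1) (s j.+2) (ratr b^-1)) => //; apply/rowP => k.
    move/rowP: hD' => /(_ k); rewrite !mxE => /(congr1 (fun z => ratr (b^-1 * z) : R)).
    by rewrite mulKf// rmorphM /= !ratr_int => <-.
  move: hout; apply/negP; rewrite negbK.
  have -> : rv (x (s j.+1).+1) = (D 0 (lshift 1 0))^-1 *: (rv (x (s j.+2)) - D 0 (rshift 1 0) *: rv (x (s j.+1))).
    by rewrite hD' addrK scalerA mulVf// scale1r.
  by rewrite scalemx_sub// addmx_sub// -scaleNr scalemx_sub.
move=> e e0; pose d := Num.min 1 (e / 10); have d0 : 0 < d by rewrite lt_min ltr01 divr_gt0.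
have [d1 de] : d <= 1 /\ 10 * d <= e.
  split; first by rewrite ge_min lexx.
  by rewrite mulrC -ler_pdivlMr// ge_min lexx orbT.
have [J hJ] := tight d d0.
(* The shift is due to the use of [tight] twice: at [s j] it compares the norm at [s j.+1] with the
   norm at the next index, at [s j.+1] it compares the latter with the norm at [s j.+2]. *)
exists J.+1 => -[//|j] /ltnSE hj; set A := log_norm (s j.+1).+1.
have [_ _ [i1 [q1 q2 q3 q4 q5]]] := hJ (s j) (leq_trans hj (s_ge j)).
have e1 : i1 = s j.+1 by apply: (Ex_uniq (s j)).
have [w1 w2 [i2 [q1' q2' q3' q4' q5']]] := hJ (s j.+1) (leq_trans hj (leq_trans (ltnW (s_ge j.+1)) (leqnn _))).
have e2 : i2 = s j.+2 by apply: (Ex_uniq (s j.+1)).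
rewrite e1 in q5; rewrite e2 in q4'; rewrite -/A in q5 w1 w2 q4'.
have u1 : log_norm (s j).+1 <= log_norm (s j.+1) by exact: (log_norm_mono hx).
have u2 : A <= log_norm (s j.+2) by exact: (log_norm_mono hx).
have u0 : 0 <= log_norm (s j.+1) by exact: (log_norm_ge0 hx).
set u := log_norm (s j.+1) in q5 u1 u0 *; set w := log_norm (s j.+2) in q4' u2 *.
have du : d * log_norm (s j).+1 <= d * u by rewrite ler_wpM2l// ltW.
move/andP: q5 => [q5 q6].
have ru : rho * rho^-1 = 1 by rewrite divff// gt_eqF// (lt_trans ltr01).
have r0 : 0 < rho by rewrite (lt_trans ltr01).
have A1 : A <= rho * (1 + d) * u.
  have -> : A = rho * (rho^-1 * A) by rewrite mulrA ru mul1r.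
  rewrite -[leRHS]mulrA ler_wpM2l ?(ltW r0)// mulrDl mul1r; lra.
have A2 : rho * (1 - d) * u <= A.
  have -> : A = rho * (rho^-1 * A) by rewrite mulrA ru mul1r.
  rewrite -[leLHS]mulrA ler_wpM2l ?(ltW r0)// mulrBl mul1r; lra.
have dA : d * A <= 4 * (d * u).
  have -> : 4 * (d * u) = d * (4 * u) by ring.
  rewrite ler_wpM2l ?(ltW d0)//; apply: le_trans A1 _; rewrite ler_wpM2r//.
  have : rho * (1 + d) <= 2 * 2 by rewrite ler_pM ?(ltW r0) ?(ltW rho2)//; lra.
  lra.
have rdu : rho * (d * u) <= 2 * (d * u) by rewrite ler_wpM2r ?mulr_ge0 ?(ltW d0) ?(ltW rho2).
have du0 : 0 <= d * u by rewrite mulr_ge0 ?(ltW d0).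
have eu : 10 * (d * u) <= e * u by rewrite mulrA ler_wpM2r.
have A1' : A <= rho * u + rho * (d * u) by apply: le_trans A1 _; rewrite le_eqVlt; apply/orP; left; apply/eqP; ring.
have A2' : rho * u - rho * (d * u) <= A by apply: le_trans A2; rewrite le_eqVlt; apply/orP; left; apply/eqP; ring.
rewrite mulrDl mul1r in q4'.
have r1 : rho^-1 * (rho * u) = u by rewrite mulrA mulVf ?mul1r// gt_eqF.
have r2 : rho^-1 * (rho * (d * u)) = d * u by rewrite mulrA mulVf ?mul1r// gt_eqF.
have ri0 : 0 <= rho^-1 by rewrite invr_ge0 ltW.
have s1 := ler_wpM2l ri0 A1'; have s2 := ler_wpM2l ri0 A2'.
rewrite mulrDr r1 r2 in s1; rewrite mulrBr r1 r2 in s2.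
rewrite mulrDl in w2; rewrite mulrBl in w1.
split; rewrite ler_norml; apply/andP; split.
- lra.
- lra.
- lra.
- lra.
Qed.

End Essential.

Section Recurrence.
Context (y : nat -> 'rV[int]_n.+1) (u d : nat -> R).
Hypotheses (hu : forall j, `|iv (y j)| = expR (u j)) (hd : forall j, dist v (y j) = expR (- d j)).
Hypothesis u_infty : forall M, exists J, forall j, (J <= j)%N -> M <= u j.
Hypothesis u_asym : forall e, 0 < e -> exists J, forall j, (J <= j)%N ->
  `|u j.+1 - rho * u j| <= e * u j /\ `|d j - u j| <= e * u j.
Hypothesis Qy : forall j, bf S (y j) (y j) != 0.
Hypothesis dep2 : forall j, exists a b, y j 0 a * y j.+1 0 b - y j 0 b * y j.+1 0 a != 0.
Hypothesis indep : forall j p r, rv (y j.+2) <> p *: rv (y j) + r *: rv (y j.+1).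

Lemma asym_iter i e : 0 < e -> exists J, forall j, (J <= j)%N ->
  `|u (j + i)%N - rho ^+ i * u j| <= e * u j /\ `|d (j + i)%N - rho ^+ i * u j| <= e * u j.
Proof.
have r0 : 0 < rho by rewrite (lt_trans ltr01).
suff main i' e' : 0 < e' -> exists J, forall j, (J <= j)%N ->
  `|u (j + i')%N - rho ^+ i' * u j| <= e' * u j.
  move=> e0; pose e1 := Num.min 1 (e / 2) / (rho ^+ i + 1).
  have ri : 0 < rho ^+ i + 1 by rewrite addr_gt0// exprn_gt0.
  have e10 : 0 < e1 by rewrite divr_gt0// lt_min ltr01 divr_gt0.
  have [e1a e1b] : e1 * (rho ^+ i + 1) <= 1 /\ e1 * (rho ^+ i + 1) <= e / 2.
    by rewrite /e1 divfK ?gt_eqF// !ge_min !lexx orbT.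
  have [J1 h1] := main i _ e10; have [J2 h2] := u_asym e10; have [J3 h3] := u_infty 0.
  exists (maxn J1 (maxn J2 J3)) => j; rewrite !geq_max => /and3P[/h1 g1 j2 /h3 u0].
  have [_ g2] := h2 (j + i)%N (leq_trans j2 (leq_addr _ _)).
  have e12 : e1 <= e / 2.
    apply: le_trans e1b; rewrite ler_peMr ?(ltW e10)// lerDr exprn_ge0 ?(ltW r0)//.
  have g1' : e1 * u j <= e / 2 * u j by rewrite ler_wpM2r.
  split; first by have : e / 2 * u j <= e * u j; [rewrite ler_wpM2r//; lra|lra].
  have ub : u (j + i)%N <= (rho ^+ i + 1) * u j.
    move: g1; rewrite ler_norml => /andP[_ g1].
    have : e1 * u j <= 1 * u j.
      rewrite ler_wpM2r//; apply: le_trans e1a; rewrite ler_peMr ?(ltW e10)// lerDr exprn_ge0 ?(ltW r0)//.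
    rewrite mulrDl; lra.
  have := ler_wpM2l (ltW e10) ub; rewrite mulrA => g3.
  have g4 : e1 * (rho ^+ i + 1) * u j <= e / 2 * u j by rewrite ler_wpM2r.
  have := ler_distD (u (j + i)%N) (d (j + i)%N) (rho ^+ i * u j).
  have : e / 2 * u j + e / 2 * u j = e * u j by field.
  lra.
elim: i' e' => [|i' IH] e' e0'.
  have [J h] := u_infty 0; exists J => j /h uj.
  by rewrite addn0 mul1r subrr normr0 mulr_ge0// ltW.
pose e1 := Num.min 1 (e' / 2) / (rho ^+ i' + 1 + rho).
have ri : 0 < rho ^+ i' + 1 + rho by rewrite addr_gt0// addr_gt0// exprn_gt0.
have e10 : 0 < e1 by rewrite divr_gt0// lt_min ltr01 divr_gt0.
have [e1a e1b] : e1 * (rho ^+ i' + 1 + rho) <= 1 /\ e1 * (rho ^+ i' + 1 + rho) <= e' / 2.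
  by rewrite /e1 divfK ?gt_eqF// !ge_min !lexx orbT.
have [J1 h1] := IH _ e10; have [J2 h2] := u_asym e10; have [J3 h3] := u_infty 0.
exists (maxn J1 (maxn J2 J3)) => j; rewrite !geq_max => /and3P[/h1 g1 j2 /h3 u0].
have [g2 _] := h2 (j + i')%N (leq_trans j2 (leq_addr _ _)).
have P0 : 0 <= rho ^+ i' by rewrite exprn_ge0 ?(ltW r0).
have e11 : e1 <= 1.
  apply: le_trans e1a; rewrite ler_peMr ?(ltW e10)//; lra.
have ub : u (j + i')%N <= (rho ^+ i' + 1) * u j.
  move: g1; rewrite ler_norml => /andP[_ g1].
  have : e1 * u j <= 1 * u j by rewrite ler_wpM2r.
  rewrite mulrDl; lra.
have := ler_wpM2l (ltW e10) ub => g3.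
have g4 : e1 * (rho ^+ i' + 1 + rho) * u j <= e' / 2 * u j by rewrite ler_wpM2r.
have g5 := ler_wpM2l (ltW r0) g1.
have g6 : `|rho * u (j + i')%N - rho ^+ i'.+1 * u j| <= rho * (e1 * u j).
  by rewrite exprS -mulrA -mulrBr normrM gtr0_norm.
have := ler_distD (rho * u (j + i')%N) (u (j + i').+1) (rho ^+ i'.+1 * u j).
have : 0 <= e' / 2 * u j by rewrite mulr_ge0// divr_ge0// ltW.
have : e' / 2 * u j + e' / 2 * u j = e' * u j by field.
have : e1 * (rho ^+ i' + 1 + rho) * u j = e1 * ((rho ^+ i' + 1) * u j) + rho * (e1 * u j) by ring.
rewrite addnS; lra.
Qed.

(** The vanishing minors place the reflection [w] both in the plane of [y j], [y j.+1] and in that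
    of [y j.+1], [y j.+2]. By [indep] these planes meet in the line of [y j.+1]. Reflecting once
    more expresses [Y] through [X] and [y j.+1], which is the recurrence at the index [j.+1]. *)
Lemma recurrence : exists J, forall j, (J <= j)%N -> exists2 c : rat, c != 0 &
  rv (y (j + n.+1)%N) = c *: reflv (map_mx intr S) (rv (y (j + n)%N)) (rv (y j)).
Proof.
have r0 : 0 < rho by rewrite (lt_trans ltr01).
pose c := rho * (2 - rho); have c0 : 0 < c by rewrite mulr_gt0// subr_gt0.
pose e := c / 12; have e0 : 0 < e by rewrite divr_gt0.
have [C C0 hC] := reflv_bound v0 ST Qv.
pose D := 6 * (1 + 2 * `|v|); have D0 : 0 < D by rewrite mulr_gt0// ltr_pwDl// mulr_ge0.
have c20 : 0 < c / 2 by rewrite divr_gt0.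
have [T0 hT0] := expR_absorb (2 * C) e0; have [T1 hT1] := expR_absorb (3 * D + 1) c20.
have [J0 h0] := asym_iter 0 e0; have [J1 h1] := asym_iter 1 e0; have [J2 h2] := asym_iter 2 e0.
have [J3 h3] := asym_iter n.+1 e0; have [J4 h4] := asym_iter n.+2 e0.
have [J5 h5] := u_infty (Num.max 0 (Num.max T0 T1)).
exists (maxn (maxn J0 J1) (maxn (maxn J2 J3) (maxn J4 J5))).+1 => -[//|j] /ltnSE.
rewrite !geq_max => /andP[/andP[j0 j1] /andP[/andP[j2 j3] /andP[j4 j5]]].
have := h5 j j5; rewrite !ge_max => /and3P[U0 UT0 UT1].
have {hT0} hC2 := hT0 _ UT0; have {hT1} hD3 := hT1 _ UT1.
set U := u j in U0 UT0 UT1 hC2 hD3 *.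
have bnd i k : `|u k - rho ^+ i * U| <= e * U /\ `|d k - rho ^+ i * U| <= e * U ->
   `|iv (y k)| <= expR ((rho ^+ i + e) * U) /\ dist v (y k) <= expR ((- rho ^+ i + e) * U).
  rewrite hu hd !ler_expR !ler_norml => -[/andP[a1 a2] /andP[b1 b2]].
  rewrite !mulrDl mulNr; split; lra.
have [N0 E0] := bnd _ _ (h0 j j0); have [N1 E1] := bnd _ _ (h1 j j1).
have [N2 E2] := bnd _ _ (h2 j j2); have [N3 E3] := bnd _ _ (h3 j j3).
have [N4 E4] := bnd _ _ (h4 j j4).
rewrite addn0 expr0 in N0 E0; rewrite addn1 expr1 in N1 E1; rewrite addn2 in N2 E2.
have eX : (j + n.+1 = j.+1 + n)%N by rewrite addnS addSn.
have eY : (j + n.+2 = j.+1 + n.+1)%N by rewrite addnS addSn.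
rewrite eX in N3 E3; rewrite eY in N4 E4.
set X := y (j.+1 + n)%N in N3 E3 *; set Y := y (j.+1 + n.+1)%N in N4 E4 *.
pose w := reflv S X Y.
have [bw ew] := hC X Y; rewrite -/w in bw ew.
have mulE a b a' b' : 0 <= a -> 0 <= b -> a <= expR (a' * U) -> b <= expR (b' * U) -> a * b <= expR ((a' + b') * U).
  by move=> ? ? ? ?; rewrite mulrDl expRD; apply: ler_pM.
(* This form of the root equation brings the reflection back to the size of [y j.+1]. *)
have rm : rho ^+ n.+2 = 2 * rho ^+ n.+1 - rho.
  have h : rho = rho * ((2 - rho) * rho ^+ n) by rewrite rho_mul// mulr1.
  by rewrite [X in _ - X]h !exprS; ring.
have nX : 0 <= `|iv X| by []; have nY : 0 <= `|iv Y| by [].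
have pX := dist_ge0 v X; have pY := dist_ge0 v Y.
have r1 : rho <= rho ^+ n.+2 by rewrite -[leLHS]expr1 ler_weXn2l// ltW.
have b1 : `|iv X| ^+ 2 * dist v Y <= expR ((rho + 3 * e) * U).
  have := mulE _ _ _ _ (mulr_ge0 nX nX) pY (mulE _ _ _ _ nX nX N3 N3) E4.
  by rewrite rm -expr2 (_ : _ + _ + _ = rho + 3 * e); last by ring.
have b2 : `|iv Y| * dist v X ^+ 2 <= expR ((- rho + 3 * e) * U).
  have := mulE _ _ _ _ nY (mulr_ge0 pX pX) N4 (mulE _ _ _ _ pX pX E3 E3).
  by rewrite rm -expr2 (_ : _ + _ + _ = - rho + 3 * e); last by ring.
have b3 : `|iv X| * dist v X * dist v Y <= expR ((- rho + 3 * e) * U).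
  apply: le_trans (mulE _ _ _ _ (mulr_ge0 nX pX) pY (mulE _ _ _ _ nX pX N3 E3) E4) _.
  by rewrite ler_expR ler_wpM2r//; lra.
have abs t : 2 * C * expR ((t + 3 * e) * U) <= expR ((t + 4 * e) * U).
  rewrite (_ : (t + 4 * e) * U = e * U + (t + 3 * e) * U); last by ring.
  by rewrite expRD ler_wpM2r// expR_ge0.
have Nw : `|iv w| <= expR ((rho + 4 * e) * U).
  apply: le_trans (abs _); apply: le_trans bw _; rewrite -[leRHS]mulrA [leRHS]mulrCA ler_wpM2l ?(ltW C0)//.
  rewrite mulr2n mulrDl mul1r; apply: lerD => //; apply: le_trans b2 _.
  by rewrite ler_expR ler_wpM2r//; lra.
have Ew : dist v w <= expR ((- rho + 4 * e) * U).
  apply: le_trans (abs _); apply: le_trans ew _; rewrite -[leRHS]mulrA [leRHS]mulrCA ler_wpM2l ?(ltW C0)//.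
  by rewrite mulr2n mulrDl mul1r; apply: lerD.
have nw : 0 <= `|iv w| by []; have pw := dist_ge0 v w.
have small : D * (3 * expR (- (c / 2 * U))) < 1.
  rewrite expRN mulrA mulrC -ltr_pdivlMl ?invr_gt0 ?expR_gt0// invrK mulr1 mulrC.
  by apply: lt_le_trans hD3; rewrite ltrDl.
have min0 a b (ta tb sa sb : R) : `|iv a| <= expR (ta * U) -> dist v a <= expR (sa * U) ->
    `|iv b| <= expR (tb * U) -> dist v b <= expR (sb * U) ->
    rho + 4 * e + sa + sb <= - (c / 2) -> - rho + 4 * e + ta + sb <= - (c / 2) ->
    - rho + 4 * e + sa + tb <= - (c / 2) -> forall i k l, minor3 w a b i k l = 0.
  move=> Na Ea Nb Eb k1 k2 k3 i k l; apply: (minor3_eq0 v0); apply: le_lt_trans small.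
  rewrite ler_wpM2l ?(ltW D0)// (_ : 3 * _ = expR (- (c / 2 * U)) + expR (- (c / 2 * U)) + expR (- (c / 2 * U))); last by ring.
  have na : 0 <= `|iv a| by []; have nb : 0 <= `|iv b| by [].
  have pa := dist_ge0 v a; have pb := dist_ge0 v b.
  apply: lerD; first apply: lerD.
  - apply: le_trans (mulE _ _ _ _ (mulr_ge0 nw pa) pb (mulE _ _ _ _ nw pa Nw Ea) Eb) _.
    by rewrite ler_expR -mulNr ler_wpM2r.
  - apply: le_trans (mulE _ _ _ _ (mulr_ge0 pw na) pb (mulE _ _ _ _ pw na Ew Na) Eb) _.
    by rewrite ler_expR -mulNr ler_wpM2r.
  - apply: le_trans (mulE _ _ _ _ (mulr_ge0 pw pa) nb (mulE _ _ _ _ pw pa Ew Ea) Nb) _.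
    by rewrite ler_expR -mulNr ler_wpM2r.
have ce : c = 12 * e by rewrite /e; field.
have c1 : c <= 1.
  rewrite -subr_ge0 (_ : 1 - c = (rho - 1) ^+ 2); last by rewrite /c; ring.
  exact: sqr_ge0.
have cE : rho ^+ 2 = 2 * rho - c by rewrite /c; ring.
have rr : 1 <= rho ^+ 2 by rewrite expr_ge1 ?(ltW rho1)// (ltW r0).
have m1 := min0 _ _ _ _ _ _ N1 E1 N2 E2.
have m2 := min0 _ _ _ _ _ _ N0 E0 N1 E1.
have {}m1 : forall i k l, minor3 w (y j.+1) (y j.+2) i k l = 0.
  by have [k1 k2 k3] := minor_exponents1 ce c1 cE rr; exact: m1.
have {}m2 : forall i k l, minor3 w (y j) (y j.+1) i k l = 0.
  by have [k1 k2 k3] := minor_exponents2 ce c1 rho1; exact: m2.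
have [a1 [a2 hd1]] := dep2 j.+1; have [p [r hw1]] := minor3_dep m1 hd1.
have [a3 [a4 hd2]] := dep2 j; have [p' [r' hw2]] := minor3_dep m2 hd2.
have rz : r = 0.
  apply/eqP/negPn/negP => rn0; apply: (indep (j := j) (p := p' / r) (r := (r' - p) / r)).
  apply: (scalerI rn0); rewrite scalerDr !scalerA !(mulrC r) !divfK//.
  transitivity ((p *: rv (y j.+1) + r *: rv (y j.+2)) - p *: rv (y j.+1)).
    by rewrite addrAC subrr add0r.
  by rewrite -hw1 hw2 scalerBl addrA.
rewrite rz scale0r addr0 in hw1.
pose SQ := map_mx intr S : 'M[rat]_n.+1.
have QX : bf SQ (rv X) (rv X) != 0 by rewrite bf_map intr_eq0 Qy.
have hY : bf SQ (rv X) (rv X) ^+ 2 *: rv Y = p *: reflv SQ (rv X) (rv (y j.+1)).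
  have <- : reflv SQ (rv X) (rv w) = bf SQ (rv X) (rv X) ^+ 2 *: rv Y.
    by rewrite /w -reflv_map reflvK.
  by rewrite hw1 -[X in reflv _ X _]scale1r reflvZ expr1n mul1r.
exists (p / bf SQ (rv X) (rv X) ^+ 2); last first.
  by rewrite mulrC -scalerA -hY scalerA mulVf ?scale1r// expf_neq0.
rewrite mulf_neq0 ?invr_neq0 ?expf_neq0//; apply: contraNneq (Qy (j.+1 + n.+1)%N) => p0.
move: hY; rewrite p0 scale0r => /eqP; rewrite scaler_eq0 expf_eq0 /= (negPf QX) /= => /eqP hY.
rewrite -(intr_eq0 rat) -bf_map -/Y.
by rewrite (_ : map_mx _ Y = 0) ?bf0l.
Qed.

End Recurrence.
End Rigidity.

(** * Extremal points are determined by finitely many integral points *)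

Section RigidData.
Context (R : realType) (n : nat) (S : 'M[int]_n.+1) (rho : R).
Hypotheses (n1 : (1 < n)%N) (ST : S^T = S) (S0 : S != 0) (hw : witt_le1 (map_mx intr S)).
Hypotheses (rho1 : 1 < rho) (rho2 : rho < 2) (hrho : root (rho_poly R n) rho).
Local Notation iv x := (map_mx intr x : 'rV[R]_n.+1).
Local Notation rv x := (map_mx intr x : 'rV[rat]_n.+1).

Lemma unif_le_rho (v : 'rV[R]_n.+1) l : v 0 0 = 1 -> Q_independent v ->
  bf (map_mx intr S) v v = 0 -> rho^-1 < l -> ~ unif v l.
Proof.
move=> v0 li Qv rl hu; have /andP[a1 _] := rho_inv_bounds rho1 rho2.
have l2 : 1 / 2 < l by exact: lt_trans rl.
have l0 : 0 < l by apply: lt_trans l2; rewrite divr_gt0.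
have [x hx] := minimal_seq_exists v0 li (ltnW n1) l0 hu.
exact: (no_unif_gt n1 v0 li hx rho1 rho2 hrho (ms_lower v0 li ST S0 Qv hx hw l2 hu) rl hu).
Qed.

Definition recurrent_seq (y : nat -> 'rV[int]_n.+1) : Prop :=
  forall j, exists2 c : rat, c != 0 &
    rv (y (j + n.+1)%N) = c *: reflv (map_mx intr S) (rv (y (j + n)%N)) (rv (y j)).

Definition approximating (v : 'rV[R]_n.+1) (y : nat -> 'rV[int]_n.+1) : Prop :=
  [/\ forall j, y j != 0, exists E, forall j, dist v (y j) <= E &
     forall M, exists J, forall j, (J <= j)%N -> M <= `|iv (y j)|].

Lemma recurrent_exists (v : 'rV[R]_n.+1) : v 0 0 = 1 -> Q_independent v ->
  bf (map_mx intr S) v v = 0 -> (forall l, l < rho^-1 -> unif v l) ->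
  exists y, recurrent_seq y /\ approximating v y.
Proof.
move=> v0 li Qv hu; have /andP[a1 _] := rho_inv_bounds rho1 rho2.
pose l := (1 / 2 + rho^-1) / 2.
have l2 : 1 / 2 < l by rewrite /l; lra.
have hl : unif v l by apply: hu; rewrite /l; lra.
have l0 : 0 < l by apply: lt_trans l2; rewrite divr_gt0.
have [x hx] := minimal_seq_exists v0 li (ltnW n1) l0 hl.
have hlow := ms_lower v0 li ST S0 Qv hx hw l2 hl.
have [I hI] := ms_anisotropic v0 li ST S0 hx hw l2 hl.
have [s [Is s_lt indep asym]] := essential_seq n1 v0 li rho1 rho2 hrho hx hlow hu I.
have s_ge j : (j <= s j)%N by elim: j => // j IH; apply: leq_ltn_trans IH (s_lt j).
have I_s j : (I <= s j)%N by elim: j => // j IH; apply: leq_trans IH (ltnW (s_lt j)).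
pose y j := x (s j).
have y0 j : y j != 0 by exact: (ms_neq0 hx).
have yinf M : exists J, forall j, (J <= j)%N -> M <= log_norm R x (s j).
  have [J hJ] := log_norm_infty hx M; exists J => j jJ; apply: hJ; exact: leq_trans jJ (s_ge j).
have dep2 j : exists a b, y j 0 a * y j.+1 0 b - y j 0 b * y j.+1 0 a != 0.
  apply: contrapT => h; have [|c hc] := @wedge_eq0 R n (y j) (y j.+1) (y0 j.+1).
    move=> a b; apply/eqP; rewrite -subr_eq0; apply/negP => hab.
    by apply: h; exists a, b; apply/negP.
  exact: (ms_nprop hx (s_lt j) hc).
have [J hJ] := recurrence v0 ST Qv rho1 rho2 hrho (y := y)
  (fun j => esym (expR_log_norm hx (s j))) (fun j => esym (expR_log_dist n1 v0 li hx (s j))) yinf asym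
  (fun j => hI _ (I_s j)) dep2 indep.
exists (fun j => y (J + j)%N); split.
  by move=> j; rewrite !addnA; apply: hJ; exact: leq_addr.
split => //.
  by exists (dist v (x 0%N)) => j; exact: ms_dist_bound hx _.
move=> M; have [K hK] := ms_infty hx M; exists K => j Kj; apply: hK.
by apply: leq_trans Kj (leq_trans (leq_addl J j) (s_ge _)).
Qed.

(** Reflections are homogeneous in both arguments, so proportionality of the two sequences
    propagates from the first [n.+1] terms. Bounded distances and unbounded norms make the
    normalised terms converge to [v] and to [v']. *)
Lemma recurrent_unique (v v' : 'rV[R]_n.+1) y y' : v 0 0 = 1 -> v' 0 0 = 1 ->
  recurrent_seq y -> approximating v y -> recurrent_seq y' -> approximating v' y' ->
  (forall j, (j <= n)%N -> y j = y' j) -> v = v'.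
Proof.
move=> v0 v'0 hy [y0 [E hE] yinf] hy' [y'0 [E' hE'] yinf'] h0.
have prop j : exists c : rat, c != 0 /\ rv (y j) = c *: rv (y' j).
  elim/ltn_ind: j => j IH; case: (leqP j n) => [jn|nj].
    by exists 1; rewrite oner_eq0 scale1r h0.
  have ej : j = ((j - n.+1) + n.+1)%N by rewrite subnK.
  have [c c0 e] := hy (j - n.+1)%N; have [c' c'0 e'] := hy' (j - n.+1)%N.
  rewrite -ej in e e'.
  have [|a [a0 ea]] := IH ((j - n.+1) + n)%N; first by rewrite {2}ej addnS.
  have [|b [b0 eb]] := IH (j - n.+1)%N; first by rewrite {2}ej addnS ltnS leq_addr.
  exists (c * (a ^+ 2 * b) / c'); split; first by rewrite !mulf_neq0// ?expf_neq0// invr_neq0.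
  by rewrite e e' ea eb reflvZ !scalerA divfK.
apply/eqP; rewrite -subr_eq0 -normr_eq0; apply/eqP/le_anti; rewrite normr_ge0 andbT.
apply/ler_addgt0Pr => e e0; rewrite add0r.
pose F (w : 'rV[R]_n.+1) B := 2 * `|w| * B.
have half (w : 'rV[R]_n.+1) (z : nat -> 'rV[int]_n.+1) B : w 0 0 = 1 -> (forall j, dist w (z j) <= B) ->
    (forall M, exists J, forall j, (J <= j)%N -> M <= `|iv (z j)|) ->
    exists J, forall j, (J <= j)%N -> (z j 0 0)%:~R != 0 :> R /\
       `|((z j 0 0)%:~R)^-1 *: iv (z j) - w| <= e / 2.
  move=> w0 hB hinf; have B0 : 0 <= B by apply: le_trans (hB 0%N); exact: dist_ge0.
  have w1 : 0 < `|w| by apply: lt_le_trans (norm_coord w 0); rewrite w0 normr1.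
  have [J hJ] := hinf (B + `|w| * (B / (e / 2) + 1)); exists J => j /hJ hj.
  have e1 : `|iv (z j)| <= `|(z j 0 0)%:~R : R| * `|w| + B.
    rewrite -normrZ; apply: le_trans (_ : `|(z j 0 0)%:~R *: w| + dist w (z j) <= _).
      by apply: le_trans (ler_normD _ _); rewrite addrC subrK.
    by rewrite lerD2l.
  have e2 : B / (e / 2) + 1 <= `|(z j 0 0)%:~R : R|.
    by rewrite -(ler_pM2l w1) [leRHS]mulrC -(lerD2r B) [leLHS]addrC; exact: le_trans hj e1.
  have zj : 0 < `|(z j 0 0)%:~R : R|.
    by apply: lt_le_trans e2; rewrite ltr_pwDr// divr_ge0// ltW// divr_gt0.
  have zj0 : (z j 0 0)%:~R != 0 :> R by rewrite -normr_gt0.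
  split => //.
  have -> : ((z j 0 0)%:~R)^-1 *: iv (z j) - w = ((z j 0 0)%:~R)^-1 *: (iv (z j) - (z j 0 0)%:~R *: w).
    by rewrite scalerBr scalerA mulVf// scale1r.
  rewrite normrZ normfV mulrC ler_pdivrMr//; apply: le_trans (hB j) _.
  rewrite mulrC -ler_pdivrMr ?divr_gt0//; apply: le_trans e2; by rewrite lerDl.
have [J hJ] := half v y E v0 hE yinf; have [J' hJ'] := half v' y' E' v'0 hE' yinf'.
pose j := maxn J J'; have [z1 h1] := hJ j (leq_maxl _ _); have [z2 h2] := hJ' j (leq_maxr _ _).
have [c [c0 ec]] := prop j.
have ecR : iv (y j) = ratr c *: iv (y' j).
  apply/rowP => i; move/rowP: ec => /(_ i); rewrite !mxE => /(congr1 (ratr : rat -> R)).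
  by rewrite rmorphM /= !ratr_int.
have eqn : ((y j 0 0)%:~R)^-1 *: iv (y j) = ((y' j 0 0)%:~R)^-1 *: iv (y' j).
  have e00 : (y j 0 0)%:~R = ratr c * (y' j 0 0)%:~R :> R by move/rowP: ecR => /(_ 0); rewrite !mxE.
  have c0' : ratr c != 0 :> R by rewrite fmorph_eq0.
  by rewrite e00 ecR scalerA invfM mulrAC mulVf// mul1r.
rewrite eqn distrC in h1; have := ler_distD (((y' j 0 0)%:~R)^-1 *: iv (y' j)) v v'.
move=> /le_trans; apply; rewrite (splitr e); apply: lerD => //.
Qed.

End RigidData.

(** * Projective points and their representatives *)

Section Points.
Context (R : realType) (n : nat).
Implicit Types (xi : projective_space R n) (v : 'rV[R]_n.+1).

Lemma line_rep xi : line xi = <[rep xi]>%VS.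
Proof.
apply/esym/eqP; rewrite eqEdim -memvE mem_rep /=.
by rewrite dim_vline rep_neq0 (eqP (svalP xi)).
Qed.

Lemma point_eq xi xi' c : c != 0 -> rep xi = c *: rep xi' -> xi = xi'.
Proof.
move=> c0 e; apply/val_inj; rewrite /= -/(line xi) -/(line xi') !line_rep e.
apply/eqP; rewrite eqEdim !dim_vline scaler_eq0 (negPf c0) /= leqnn andbT.
by rewrite -memvE memvZ// memv_line.
Qed.

Lemma point_exists v : v != 0 -> exists xi, exists2 c, c != 0 & rep xi = c *: v.
Proof.
move=> v0; have h : \dim <[v]>%VS == 1%N by rewrite dim_vline v0.
pose xi : projective_space R n := exist (fun L : {vspace 'rV[R]_n.+1} => \dim L == 1%N) _ h.
exists xi.
have : rep xi \in <[v]>%VS by exact: mem_rep.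
move=> /vlineP[c e]; exists c => //; apply: contraNneq (rep_neq0 xi) => c0.
by rewrite e c0 scale0r.
Qed.

Lemma li_pointsP (q : mpoly.mpoly n.+1 rat) (S : 'M[int]_n.+1) (k : rat) xi : k != 0 ->
  (forall x : 'rV[R]_n.+1, qval (qreal R q) x = ratr k * bf (map_mx intr S) x x) ->
  li_points (hypersurface R q) xi <->
  Q_independent (rep xi) /\ bf (map_mx intr S) (rep xi) (rep xi) = 0.
Proof.
move=> k0 h; have kR : ratr k != 0 :> R by rewrite fmorph_eq0.
split=> [[hz hl]|[hl hz]].
  split; first by apply: hl; rewrite ?mem_rep ?rep_neq0.
  by apply/eqP; have := hz _ (mem_rep xi); rewrite h => /eqP; rewrite mulf_eq0 (negPf kR).
split=> x; rewrite line_rep => /vlineP[c ->].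
  by rewrite h bfZl bfZr hz !mulr0.
rewrite scaler_eq0 negb_or => /andP[c0 _]; exact: Q_independentZ.
Qed.

Definition nrep xi := (rep xi 0 0)^-1 *: rep xi.

Lemma nrepP xi (S : 'M[int]_n.+1) : Q_independent (rep xi) ->
  bf (map_mx intr S) (rep xi) (rep xi) = 0 ->
  [/\ nrep xi 0 0 = 1, Q_independent (nrep xi), bf (map_mx intr S) (nrep xi) (nrep xi) = 0 &
     forall l, unif (rep xi) l <-> unif (nrep xi) l].
Proof.
move=> hl hz; have c0 := Q_independent_coord_neq0 0 hl; have c0' : (rep xi 0 0)^-1 != 0 by rewrite invr_eq0.
split; first by rewrite mxE mulVf.
- exact: Q_independentZ.
- by rewrite bfZl bfZr hz !mulr0.
- move=> l; split; first exact: unif_scale.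
  by move=> /(unif_scale c0); rewrite /nrep scalerA divff// scale1r.
Qed.

End Points.

(** * Pell's equation *)

Lemma nonsquare_neq (d p q : int) : (forall k : int, k ^+ 2 != d) -> q != 0 -> p ^+ 2 != d * q ^+ 2.
Proof.
move=> hd q0; apply/eqP => e.
have : (`|q| %| `|p|)%N.
  rewrite -(@dvdn_pexp2r _ _ 2)//; apply/dvdnP; exists `|d|%N.
  by rewrite -!abszX e abszM.
move=> h; have /dvdzP[k hk] : (q %| p)%Z by [].
case/eqP: (hd k); apply: (mulIf (expf_neq0 2 q0)).
by rewrite -e hk exprMn.
Qed.

(** Dirichlet's argument: the fractional parts of the multiples [0, ..., N] of the root fall into
    [N] boxes of length [1 / N]. *)
Lemma pell_approx (R : realType) (d : int) (N : nat) : 1 < d -> (0 < N)%N ->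
  exists p q : int, [/\ 0 < p, 0 < q, q <= N%:Z &
    `|p%:~R - q%:~R * Num.sqrt d%:~R : R| < N%:R^-1].
Proof.
move=> d1 N0; pose r : R := Num.sqrt d%:~R.
have NR : 0 < N%:R :> R by rewrite ltr0n.
have r1 : 1 < r by rewrite -sqrtr1 ltr_sqrt ?ltr0z ?(lt_trans ltr01 d1)// -[1]/(1%:~R) ltr_int.
pose fl (k : nat) : int := Num.floor (k%:R * r).
pose g (k : nat) : R := k%:R * r - (fl k)%:~R.
have g0 k : 0 <= g k by rewrite subr_ge0 floor_le.
have g1 k : g k < 1 by rewrite ltrBlDl; have := floorD1_gt (k%:R * r); rewrite intrD.
have hb (k : 'I_N.+1) : (`|Num.floor (N%:R * g k)| < N)%N.
  have h0 : 0 <= Num.floor (N%:R * g k) by rewrite floor_ge0 mulr_ge0 ?g0// ltW.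
  rewrite -ltz_nat abszE ger0_norm// -(ltr_int R); apply: le_lt_trans (floor_le _) _.
  by rewrite -[ltRHS]mulr1 ltr_pM2l.
pose b (k : 'I_N.+1) : 'I_N := Ordinal (hb k).
have /injectivePn[i [j ij eb]] : ~~ injectiveb b.
  apply/negP => /injectiveP/leq_card; by rewrite !card_ord ltnn.
wlog lij : i j ij eb / (i < j)%N.
  move=> h; case: (ltngtP i j) => [lij|lij|/val_inj e]; first exact: h ij eb lij.
    by apply: (h j i) => //; rewrite eq_sym.
  by rewrite e eqxx in ij.
have ef : Num.floor (N%:R * g i) = Num.floor (N%:R * g j).
  have h0 k : 0 <= Num.floor (N%:R * g k) by rewrite floor_ge0 mulr_ge0 ?g0// ltW.
  by move: eb => /(congr1 val) /= /(congr1 Posz); rewrite !abszE !ger0_norm.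
have hg : `|N%:R * g j - N%:R * g i| < 1.
  have := floor_le (N%:R * g j); have := floorD1_gt (N%:R * g j).
  have := floor_le (N%:R * g i); have := floorD1_gt (N%:R * g i).
  rewrite ef intrD; set F := (Num.floor _)%:~R => h1 h2 h3 h4.
  rewrite ltr_norml; apply/andP; split; lra.
pose q : int := (j - i)%N; pose p := fl j - fl i.
have q0 : 0 < q by rewrite /q ltz_nat subn_gt0.
have qE : q%:~R = j%:R - i%:R :> R by rewrite /q -pmulrn natrB// ltnW.
have key : `|p%:~R - q%:~R * r : R| < N%:R^-1.
  rewrite -(ltr_pM2l NR) divff ?gt_eqF// -[X in X * `|_|]gtr0_norm// -normrM.
  rewrite distrC in hg; apply: le_lt_trans hg; rewrite le_eqVlt; apply/orP; left; apply/eqP.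
  by congr (`|_|); rewrite /g qE /p rmorphB /=; ring.
exists p, q; split => //.
  rewrite -(ltr_int R); have N1 : N%:R^-1 <= 1 :> R by rewrite invf_le1// ler1n.
  have q1 : 1 <= q%:~R :> R by rewrite -[1]/(1%:~R) ler_int -gtz0_ge1.
  have : 1 < q%:~R * r by apply: (lt_le_trans r1 _); rewrite ler_peMl// ltW// (lt_trans ltr01 r1).
  move: key; rewrite ltr_norml => /andP[]; lra.
by rewrite /q lez_nat; apply: leq_trans (leq_subr _ _) _; rewrite -ltnS.
Qed.

(** Infinitude is expressed by avoiding any finite list: a denominator bound [N] beyond the inverse
    of the least error in the list gives a new pair. Its norm is a product of a factor below [1 / N]
    and one of order [N], whence the uniform bound [2 * r + 1]. *)
Lemma pell_infinite (R : realType) (d : int) : (forall k : int, k ^+ 2 != d) -> 1 < d ->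
  exists M : nat, forall s : seq (int * int), exists2 z : int * int, z \notin s &
    [/\ 0 < z.1, 0 < z.2 & `|z.1 ^+ 2 - d * z.2 ^+ 2| <= M%:Z].
Proof.
move=> hd d1; pose r : R := Num.sqrt d%:~R.
have d0 : 0 < d by exact: lt_trans d1.
have rr : r ^+ 2 = d%:~R by rewrite sqr_sqrtr// ler0z ltW.
have r0 : 0 <= r by exact: sqrtr_ge0.
pose M := (Num.truncn (2 * r + 1)).+1; exists M => s.
have [e e0 he] : exists2 e : R, 0 < e & forall z, z \in s -> 0 < z.2 ->
    e <= `|z.1%:~R - z.2%:~R * r|.
  elim: s => [|z s [e e0 IH]]; first by exists 1.
  have [z2|z2] := boolP (0 < z.2); last first.
    by exists e => // w; rewrite inE => /orP[/eqP -> wz|]; [rewrite wz in z2|exact: IH].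
  have nz : 0 < `|z.1%:~R - z.2%:~R * r|.
    rewrite normr_gt0 subr_eq0; apply/eqP => h.
    have /eqP := nonsquare_neq z.1 hd (lt0r_neq0 z2); apply.
    apply/eqP; rewrite -(eqr_int R) rmorphXn /= rmorphM /= rmorphXn /= h exprMn rr mulrC.
    by rewrite eqxx.
  exists (Num.min e `|z.1%:~R - z.2%:~R * r|); first by rewrite lt_min e0.
  move=> w; rewrite inE => /orP[/eqP ->|ws w2]; first by rewrite ge_min lexx orbT.
  by rewrite ge_min IH.
pose N := (Num.truncn e^-1).+1.
have NR : e^-1 < N%:R by rewrite truncnS_gt.
have N1 : N%:R^-1 <= 1 :> R by rewrite invf_le1 ?ler1n ?ltr0n.
have N0 : 0 < N%:R :> R by rewrite ltr0n.
have [p [q [p0 q0 qN hpq]]] := @pell_approx R d N d1 isT.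
rewrite -/r in hpq; exists (p, q) => /=.
  apply/negP => /he /= /(_ q0); rewrite leNgt => /negP; apply; apply: lt_trans hpq _.
  by rewrite invf_plt ?posrE.
split => //; rewrite -(ler_int R) intr_norm.
apply: le_trans (_ : 2 * r + 1 <= _); last by rewrite -pmulrn ltW// truncnS_gt.
have -> : (p ^+ 2 - d * q ^+ 2)%:~R = (p%:~R - q%:~R * r) * (p%:~R - q%:~R * r + 2 * (q%:~R * r)) :> R.
  by rewrite rmorphB /= rmorphXn /= rmorphM /= rmorphXn /= -rr; ring.
have q0R : 0 <= q%:~R :> R by rewrite ler0z ltW.
rewrite normrM; apply: le_trans (_ : N%:R^-1 * (N%:R^-1 + 2 * (N%:R * r)) <= _).
  apply: ler_pM => //; first exact: ltW.
  apply: le_trans (ler_normD _ _) _; apply: lerD; first exact: ltW.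
  rewrite ger0_norm ?mulr_ge0// ler_wpM2l// ler_wpM2r//.
  by have : q%:~R <= N%:Z%:~R :> R by rewrite ler_int.
rewrite mulrDr [leRHS]addrC; apply: lerD.
  by rewrite mulr_ile1// ?invr_ge0 ltW.
by rewrite mulrCA mulKf ?gt_eqF.
Qed.

(** Among the pairs of bounded norm, two different ones share the norm and the residues of both
    entries modulo it. Their quotient in the quadratic ring is integral and has norm 1. *)
Lemma pell (R : realType) (d : int) : (forall k : int, k ^+ 2 != d) -> 0 < d ->
  exists u y : int, [/\ 0 < u, 0 < y & u ^+ 2 - d * y ^+ 2 = 1].
Proof.
move=> hd d0.
have d1 : 1 < d by move: (hd 1) d0; rewrite expr1n; lia.
have [M hM] := pell_infinite R hd d1.
pose good (z : int * int) := [&& 0 < z.1, 0 < z.2 & `|z.1 ^+ 2 - d * z.2 ^+ 2| <= M%:Z].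
have many k : exists s : seq (int * int), [/\ size s = k, uniq s & all good s].
  elim: k => [|k [s [ss us gs]]]; first by exists [::].
  have [z zs [z1 z2 z3]] := hM s; exists (z :: s) => /=; rewrite ss zs us; split => //.
  by rewrite /good z1 z2 z3.
pose nm (z : int * int) := z.1 ^+ 2 - d * z.2 ^+ 2.
pose F (z : int * int) := (nm z, (z.1 %% nm z)%Z, (z.2 %% nm z)%Z).
pose ints := [seq (i%:Z - M%:Z : int) | i <- iota 0 (2 * M).+1].
have ints_mem (z : int) : `|z| <= M%:Z -> z \in ints.
  move=> hz; apply/mapP; exists (absz (z + M%:Z)); last by lia.
  by rewrite mem_iota; lia.
pose t := [seq (p, c) | p <- [seq (a, b) | a <- ints, b <- ints], c <- ints].
have [s [ss us gs]] := many (size t).+1.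
have nm0 z : good z -> nm z != 0.
  move=> /and3P[_ z2 _]; rewrite subr_eq0; apply: nonsquare_neq => //.
  by rewrite gt_eqF.
have sub : {subset [seq F z | z <- s] <= t}.
  move=> _ /mapP[z zs ->]; have gz := allP gs _ zs; have n0 := nm0 _ gz.
  have hk : `|nm z| <= M%:Z by case/and3P: gz.
  have hm a : `|(a %% nm z)%Z| <= M%:Z.
    rewrite ger0_norm ?modz_ge0//; apply: le_trans hk; apply/ltW/ltz_mod => //.
  apply: allpairs_f; last by apply: ints_mem.
  by apply: allpairs_f; apply: ints_mem.
have [z1 z1s [z2 z2s [z12 eF]]] : exists2 z1, z1 \in s & exists2 z2, z2 \in s & z1 != z2 /\ F z1 = F z2.
  apply: contrapT => h; have : uniq [seq F z | z <- s].
    rewrite map_inj_in_uniq// => a b as_ bs e; apply/eqP/negPn/negP => ab.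
    by apply: h; exists a => //; exists b.
  by move=> /uniq_leq_size/(_ sub); rewrite size_map ss ltnn.
have g1 := allP gs _ z1s; have g2 := allP gs _ z2s.
case: z1 z2 z12 eF g1 g2 {z1s z2s} => [p1 q1] [p2 q2] /= z12 [ek ep eq].
move=> g1 g2; have n0 := nm0 _ g1; rewrite -ek in ep eq.
move: g1 g2 => /and3P[/= p10 q10 _] /and3P[/= p20 q20 _].
set k := nm (p1, q1) in ek ep eq n0.
have k1 : p1 ^+ 2 - d * q1 ^+ 2 = k by [].
have k2 : p2 ^+ 2 - d * q2 ^+ 2 = k by rewrite ek.
have [a ha] : exists a, p1 - p2 = a * k.
  by apply/dvdzP; rewrite -eqz_mod_dvd; apply/eqP.
have [b hb] : exists b, q1 - q2 = b * k.
  by apply/dvdzP; rewrite -eqz_mod_dvd; apply/eqP.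
have ep1 : p1 = p2 + a * k by rewrite -ha addrC subrK.
have eq1 : q1 = q2 + b * k by rewrite -hb addrC subrK.
(* The quotient is [A - B * sqrt d], obtained by multiplying the first pair by the conjugate of the
   second and dividing by [k]. *)
pose A := 1 + a * p2 - d * b * q2; pose B := a * q2 - b * p2.
have eA : p1 * p2 - d * q1 * q2 = A * k.
  transitivity ((p2 ^+ 2 - d * q2 ^+ 2) + (a * p2 - d * b * q2) * k); last by rewrite k2 /A; ring.
  by rewrite ep1 eq1; ring.
have eB : p1 * q2 - p2 * q1 = B * k by rewrite ep1 eq1 /B; ring.
have AB : A ^+ 2 - d * B ^+ 2 = 1.
  apply: (mulIf (expf_neq0 2 n0)); rewrite mul1r.
  have -> : (A ^+ 2 - d * B ^+ 2) * k ^+ 2 = (A * k) ^+ 2 - d * (B * k) ^+ 2 by ring.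
  rewrite -eA -eB; transitivity ((p1 ^+ 2 - d * q1 ^+ 2) * (p2 ^+ 2 - d * q2 ^+ 2)).
    by ring.
  by rewrite k1 k2 expr2.
have B0 : B != 0.
  apply/eqP => B0; rewrite B0 mul0r in eB; have epq : p1 * q2 = p2 * q1 by apply/eqP; rewrite -subr_eq0 eB.
  have : k * q2 ^+ 2 = k * q1 ^+ 2.
    rewrite -{1}k1 -k2; have : (p1 * q2) ^+ 2 = (p2 * q1) ^+ 2 by rewrite epq.
    rewrite !exprMn => e; rewrite !mulrBl e; ring.
  move/(mulfI n0)/eqP; rewrite eqrXn2 ?ltW// => /eqP eqq.
  move: epq; rewrite eqq => /(mulIf (lt0r_neq0 q10)) epp.
  by move: z12; rewrite epp eqq eqxx.
exists `|A|, `|B|; rewrite !normr_gt0 B0; split => //; last by rewrite -!normrX !ger0_norm ?sqr_ge0.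
apply: contra_eqT AB => /negPn/eqP ->; rewrite expr0n /= sub0r -subr_eq0.
have : 0 <= d * B ^+ 2 by rewrite mulr_ge0 ?sqr_ge0// ltW.
by clear; lia.
Qed.

Lemma pell_large (R : realType) (d : int) (M : int) : (forall k : int, k ^+ 2 != d) -> 0 < d ->
  exists u y : int, [/\ 0 < u, M <= y & u ^+ 2 - d * y ^+ 2 = 1].
Proof.
move=> hd d0; have [u [y [u0 y0 e]]] := pell R hd d0.
suff main (k : nat) : exists u y : int, [/\ 0 < u, 0 < y, k%:Z <= y & u ^+ 2 - d * y ^+ 2 = 1].
  by have [u' [y' [? _ h ?]]] := main `|M|%N; exists u', y'; split => //; apply: le_trans h; rewrite abszE ler_norm.
elim: k => [|k [u' [y' [u0' y0' h e']]]]; first by exists u, y; split => //; exact: ltW.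
exists (u' ^+ 2 + d * y' ^+ 2), (2 * u' * y'); split.
- by rewrite addr_gt0 ?mulr_gt0 ?exprn_gt0.
- by rewrite !mulr_gt0.
- have u1 : 1 <= u' by lia.
  have : 1 * y' <= u' * y' by rewrite ler_wpM2r// ltW.
  lia.
- transitivity ((u' ^+ 2 - d * y' ^+ 2) ^+ 2); first by ring.
  by rewrite e' expr1n.
Qed.

(** * Seeds *)

(** A product of two linear forms is the bilinear form of a matrix of rank at most 1; this makes
    discriminants quadratic forms with integral matrices. *)
Lemma bf_rank1 (K : comNzRingType) (m : nat) (S T : 'M[K]_m) (u w x y : 'rV[K]_m) :
  bf ((S *m u^T) *m (w *m T)) x y = bf S x u * bf T w y.
Proof.
have -> : bf ((S *m u^T) *m (w *m T)) x y = ((x *m S *m u^T) *m (w *m T *m y^T)) 0 0.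
  by rewrite /bf !mulmxA.
by rewrite mxE big_ord1.
Qed.

Lemma bf_mxBZ (K : comNzRingType) (m : nat) (c : K) (S T : 'M[K]_m) (x y : 'rV[K]_m) :
  bf (S - c *: T) x y = bf S x y - c * bf T x y.
Proof.
by rewrite /bf mulmxBr mulmxBl -scalemxAr -scalemxAl mxE [X in _ + X]mxE [X in _ - X]mxE.
Qed.

Lemma bf_matrix_eq0 (m : nat) (M : 'M[int]_m) : M^T = M ->
  (forall z : 'rV[int]_m, bf M z z = 0) -> M = 0.
Proof.
move=> MT h; apply/matrixP => i j; rewrite [RHS]mxE.
have e (k l : 'I_m) : bf M (delta_mx 0 k) (delta_mx 0 l) = M k l.
  by rewrite /bf trmx_delta -matrix.rowE -matrix.colE !mxE.
have := h (delta_mx 0 i + delta_mx 0 j); rewrite !bfE (bfC (delta_mx 0 j) (delta_mx 0 i) MT).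
rewrite [bf M (delta_mx 0 i) (delta_mx 0 i)]h [bf M (delta_mx 0 j) (delta_mx 0 j)]h e; lia.
Qed.

Lemma bf_nonzero (m : nat) (M : 'M[int]_m) : M^T = M -> M != 0 -> exists z, bf M z z != 0.
Proof.
move=> MT M0; apply: contrapT => h; case/eqP: M0; apply: bf_matrix_eq0 => // z.
by apply/eqP; apply: contrapT => /negP hz; apply: h; exists z.
Qed.

Section Seeds.
Context (R : realType) (n : nat) (v : 'rV[R]_n.+1) (S : 'M[int]_n.+1).
Hypotheses (li : Q_independent v) (ST : S^T = S) (Qv : bf (map_mx intr S) v v = 0).
Context (e : 'rV[int]_n.+1).
Local Notation B := (bf S).
Local Notation a := (B e e).
Hypothesis a0 : a != 0.
Local Notation iv x := (map_mx intr x : 'rV[R]_n.+1).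
Local Notation rv x := (map_mx intr x : 'rV[rat]_n.+1).
Implicit Types w z t : 'rV[int]_n.+1.

(* The Gram determinant of the plane spanned by [e] and [w], up to sign. *)
Definition discr_mx : 'M[int]_n.+1 := (S *m e^T) *m (e *m S) - a *: S.

Lemma discr_mxE w z : bf discr_mx w z = B e w * B e z - a * B w z.
Proof.
by rewrite /discr_mx bf_mxBZ bf_rank1 (bfC w e ST).
Qed.

Lemma discr_mxT : discr_mx^T = discr_mx.
Proof. by rewrite /discr_mx linearB linearZ /= !trmx_mul trmxK ST mulmxA. Qed.

Lemma discr_mx_e z : bf discr_mx e z = 0.
Proof. by rewrite discr_mxE; ring. Qed.

(** At the isotropic [v] the form equals the square of [bf S e v], non-zero because the coordinates
    of [v] are independent and [a] is not 0. It therefore stays positive at the integral point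
    nearest below a large multiple of [v]. *)
Lemma discr_pos_exists : exists w, 0 < bf discr_mx w w.
Proof.
pose D : 'M[R]_n.+1 := map_mx intr discr_mx.
have Dv : bf D v v = bf (map_mx intr S) (iv e) v ^+ 2.
  have -> : D = (map_mx intr S *m (iv e)^T) *m (iv e *m map_mx intr S) - (a%:~R : R) *: map_mx intr S.
    by rewrite /D /discr_mx map_mxB map_mxZ !map_mxM /= -map_trmx.
  by rewrite bf_mxBZ bf_rank1 Qv mulr0 subr0 expr2 (bfC v (iv e)) // map_trmx ST.
have Bv : bf (map_mx intr S) (iv e) v != 0.
  apply/eqP => h; move/Q_independentP: li => /(_ (S *m e^T)) hl.
  have : S *m e^T = 0.
    apply: hl; rewrite map_mxM /= -map_trmx mulmxA; apply/matrixP => i j; rewrite !ord1 [RHS]mxE.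
    by move: h; rewrite (bfC (iv e)) // map_trmx ST.
  by move=> h2; case/eqP: a0; rewrite /bf -mulmxA h2 mulmx0 mxE.
have Dv0 : 0 < bf D v v by rewrite Dv exprn_even_gt0//.
have [C C0 hC] := bf_bound D.
have DT : D^T = D by rewrite /D map_trmx discr_mxT.
pose N : nat := (Num.truncn ((2 * C * `|v| + C) / bf D v v)).+1.
have NR : (2 * C * `|v| + C) / bf D v v < N%:R by rewrite truncnS_gt.
have N1 : 1 <= N%:R :> R by rewrite ler1n.
pose w : 'rV[int]_n.+1 := \row_i Num.floor (N%:R * v 0 i).
pose r : 'rV[R]_n.+1 := iv w - N%:R *: v.
have hr : `|r| <= 1.
  apply: norm_le_coord => i; rewrite !mxE ler_norml.
  have := floor_le (N%:R * v 0 i); have := floorD1_gt (N%:R * v 0 i); rewrite intrD.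
  move=> h1 h2; apply/andP; split; lra.
exists w; rewrite -(ltr_int R) -bf_map -/D.
have -> : iv w = N%:R *: v + r by rewrite addrC subrK.
clearbody r.
rewrite !bfE (bfC r v DT).
have /ler_normlW h1 : `|- bf D v r| <= C * `|v|.
  rewrite normrN; apply: le_trans (hC _ _) _; rewrite -[leRHS]mulr1 ler_wpM2l// mulr_ge0 ?(ltW C0)//.
have /ler_normlW h2 : `|- bf D r r| <= C.
  rewrite normrN; apply: le_trans (hC _ _) _; rewrite -mulrA -[leRHS]mulr1 ler_wpM2l ?(ltW C0)// mulr_ile1//.
have h3 : (2 * C * `|v| + C) < N%:R * bf D v v by rewrite -ltr_pdivrMr.
have h4 : N%:R * (2 * C * `|v| + C) < N%:R * (N%:R * bf D v v).
  by rewrite ltr_pM2l// (lt_le_trans ltr01 N1).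
have h5 : N%:R * - bf D v r <= N%:R * (C * `|v|) by apply: ler_wpM2l; [exact: ler0n|exact: h1].
have h6 : 1 * C <= N%:R * C by rewrite ler_wpM2r// ltW.
have CV : 0 <= N%:R * (C * `|v|) by rewrite !mulr_ge0 ?(ltW C0)//.
lra.
Qed.

(** Squares of distinct non-negative integers differ by at least the sum of these integers. *)
Lemma square_gap (X Y E : int) : 0 <= X -> `|E| < Y -> X ^+ 2 - Y ^+ 2 = E -> E = 0.
Proof.
move=> X0 EY h; have [e'|XY] := eqVneq X Y; first by rewrite -h e' subrr.
have : `|E| = `|X - Y| * (X + Y).
  rewrite -h (_ : X ^+ 2 - Y ^+ 2 = (X - Y) * (X + Y)); last by ring.
  by rewrite normrM [`|X + Y|]ger0_norm// addr_ge0// ltW// (le_lt_trans _ EY).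
have : 1 <= `|X - Y| by rewrite -gtz0_ge1 normr_gt0 subr_eq0.
nia.
Qed.

(* If all positive values of [discr_mx] are squares, its values at [k *: w0 + z], [k] large, show that
   it is a constant times the square of [bf discr_mx w0]; since it equals [bf S e v ^+ 2] at [v], the
   independence of [v] makes [bf discr_mx w0] proportional to [bf S e], but only the former vanishes at [e]. *)
Lemma discr_nonsquare_exists : exists w, 0 < bf discr_mx w w /\
  forall k : int, k ^+ 2 != bf discr_mx w w.
Proof.
have [w0 w0_gt] := discr_pos_exists; set D := discr_mx in w0_gt *.
apply: contrapT => /forallNP hsq.
have sq w : 0 < bf D w w -> exists2 k : int, 0 <= k & k ^+ 2 = bf D w w.
  move=> hw; apply: contrapT => h; apply: (hsq w); split => // k; apply/eqP => ek; apply: h.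
  by exists `|k|; rewrite ?normr_ge0// -normrX ger0_norm ?sqr_ge0.
have [c c_ge ec] := sq _ w0_gt.
have c0 : 0 < c by rewrite lt_neqAle c_ge andbT; apply/eqP => c0; move: w0_gt; rewrite -ec -c0 expr0n.
have key z : bf D w0 w0 * bf D z z - bf D w0 z ^+ 2 = 0.
  set E := _ - _; pose b := bf D w0 z; pose C := bf D z z.
  have [k kb] : exists k : int, `|b| + `|C| + `|E| + 1 + `|b| <= k.
    by exists (`|b| + `|C| + `|E| + 1 + `|b|).
  have k0 : 0 <= k by lia.
  have Pk : bf D (k *: w0 + z) (k *: w0 + z) = c ^+ 2 * k ^+ 2 + 2 * b * k + C.
    by rewrite !bfE (bfC z w0 discr_mxT) -ec -/b -/C; ring.
  have c1 : 1 <= c ^+ 2 by rewrite ec; lia.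
  have ck : k <= c ^+ 2 * k by rewrite ler_peMl.
  have ckk : k * k <= c ^+ 2 * k ^+ 2 by rewrite expr2 mulrA ler_wpM2r.
  have [|s s0 es] := sq (k *: w0 + z).
    rewrite Pk; have h1 : (2 * `|b| + `|C| + 1) * k <= k * k by rewrite ler_wpM2r//; lia.
    have h2 : - (2 * `|b| * k) <= 2 * b * k by rewrite -mulNr ler_wpM2r//; lia.
    have h3 : `|C| * 1 <= `|C| * k by rewrite ler_wpM2l//; lia.
    have h4 : 1 <= k by lia.
    have h5 : (2 * `|b| + `|C| + 1) * k = 2 * `|b| * k + `|C| * k + k by ring.
    have h6 : - `|C| <= C by lia.
    rewrite h5 in h1; move: h1 h2 h3 h4 h6 ckk; clear; set t1 := c ^+ 2 * k ^+ 2; set t2 := k * k; set t3 := 2 * b * k.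
    set t4 := 2 * `|b| * k; set t5 := `|C| * k; lia.
  (* The squares of [c * s] and [c ^+ 2 * k + b] differ by [E], which does not depend on [k]. *)
  apply: (@square_gap (c * s) (c ^+ 2 * k + b)); first by rewrite mulr_ge0 ?(ltW C0)//.
    by apply: lt_le_trans (lerD ck (lexx b)); lia.
  by rewrite exprMn es Pk /E -ec -/b -/C; ring.
pose M := bf D w0 w0 *: D - (D *m w0^T) *m (w0 *m D).
have MT : M^T = M by rewrite /M linearB linearZ /= !trmx_mul trmxK discr_mxT mulmxA.
have ME (K : comNzRingType) (f : {rmorphism int -> K}) (x : 'rV[K]_n.+1) :
    bf (map_mx f M) x x = f (bf D w0 w0) * bf (map_mx f D) x x - bf (map_mx f D) (map_mx f w0) x ^+ 2.
  rewrite -mulN1r (_ : -1 * _ = 0 - 1 * bf (map_mx f D) (map_mx f w0) x ^+ 2); last by ring.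
  have -> : map_mx f M = 0 - 1 *: ((map_mx f D *m (map_mx f w0)^T) *m (map_mx f w0 *m map_mx f D) - f (bf D w0 w0) *: map_mx f D).
    by rewrite /M map_mxB map_mxZ /= !map_mxM /= -map_trmx scale1r sub0r opprB.
  rewrite !bf_mxBZ bf_rank1 (bfC x (map_mx f w0)) ?map_trmx ?discr_mxT//.
  have -> : bf 0 x x = 0 :> K by rewrite /bf mulmx0 mul0mx mxE.
  by ring.
have M0 : M = 0.
  apply: bf_matrix_eq0 => // z; have := ME _ (idfun : {rmorphism int -> int}) z.
  have mid p q (A : 'M[int]_(p, q)) : map_mx idfun A = A by apply/matrixP => i j; rewrite mxE.
  by rewrite !mid => ->; exact: key.
have := ME _ (intr : {rmorphism int -> R}) v; rewrite M0 map_mx0.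
have -> : bf 0 v v = 0 by rewrite /bf mulmx0 mul0mx mxE.
have -> : bf (map_mx intr D) v v = bf (map_mx intr S) (iv e) v ^+ 2.
  have -> : map_mx intr D = (map_mx intr S *m (iv e)^T) *m (iv e *m map_mx intr S) - (a%:~R : R) *: map_mx intr S.
    by rewrite /D /discr_mx map_mxB map_mxZ !map_mxM /= -map_trmx.
  by rewrite bf_mxBZ bf_rank1 Qv mulr0 subr0 expr2 (bfC v (iv e)) // map_trmx ST.
rewrite -ec rmorphXn /= -exprMn => /esym/eqP; rewrite subr_eq0 eqf_sqr.
have no (s : int) : s != 0 -> c%:~R * bf (map_mx intr S) (iv e) v != s%:~R * bf (map_mx intr D) (iv w0) v.
  move=> s0; apply/eqP => h.
  have hl : c *: (S *m e^T) - s *: (D *m w0^T) = 0.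
    move/Q_independentP: li; apply; apply/matrixP => i j; rewrite !ord1.
    rewrite map_mxB !map_mxZ !map_mxM /= -!map_trmx mulmxBr -!scalemxAr !mulmxA mxE [X in _ + X]mxE [X in X - _]mxE [X in _ - X]mxE [RHS]mxE.
    rewrite -/(bf (map_mx intr S) v (iv e)) -/(bf (map_mx intr D) v (iv w0)).
    by rewrite (bfC v (iv e)) ?map_trmx ?ST// (bfC v (iv w0)) ?map_trmx ?discr_mxT// h subrr.
  have := congr1 (fun A => (e *m A) 0 0) hl; rewrite mulmx0 mulmxBr -!scalemxAr !mulmxA mxE [X in _ + X]mxE [X in X - _]mxE [X in _ - X]mxE [RHS]mxE.
  rewrite -/(bf S e e) -/(bf D e w0) discr_mx_e mulr0 subr0 => /eqP; rewrite mulf_eq0 (negPf a0) orbF.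
  by rewrite gt_eqF.
case/orP => [/eqP h|/eqP h].
  by have /eqP := no 1 isT; rewrite mul1r h.
by have /eqP := no (-1) isT; rewrite mulN1r h.
Qed.

Lemma nonsquare_mul (d s : int) : s != 0 -> (forall k : int, k ^+ 2 != d) ->
  forall k : int, k ^+ 2 != s ^+ 2 * d.
Proof. by move=> s0 hd k; rewrite mulrC; exact: nonsquare_neq. Qed.

(** Reflecting a good [w1] with respect to the discriminant form multiplies its value by a square,
    so it remains positive and not a square. The mirror [k *: w1 + z0] has a component outside [U],
    which the reflection keeps; a large [k] makes the relevant values non-zero. *)
Lemma discr_nonsquare_outside (U : {vspace 'rV[rat]_n.+1}) : (\dim U <= n)%N ->
  exists w, [/\ 0 < bf discr_mx w w, forall k : int, k ^+ 2 != bf discr_mx w w & rv w \notin U].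
Proof.
move=> dU; have [w1 [A0 Asq]] := discr_nonsquare_exists; set D := discr_mx in A0 Asq *.
have [w1U|w1U] := boolP (rv w1 \in U); last by exists w1.
have [i zU] : exists i, rv (delta_mx 0 i : 'rV[int]_n.+1) \notin U.
  apply: contrapT => /forallNP h; have : (fullv <= U)%VS.
    apply/subvP => x _; rewrite (row_sum_delta x); apply: memv_suml => i _; apply: memvZ.
    have := h i; rewrite map_delta_mx => /negP; rewrite negbK; exact.
  move=> /dimvS; rewrite dimvf /dim /= mul1n => /leq_trans /(_ dU); by rewrite ltnn.
set z0 := delta_mx 0 i in zU; pose A := bf D w1 w1; pose b := bf D w1 z0; pose C := bf D z0 z0.
have [k kb] : exists k : int, 2 * `|b| + `|C| + 1 <= k by exists (2 * `|b| + `|C| + 1).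
have k1 : 1 <= k by lia.
pose z := k *: w1 + z0.
have bz : bf D z w1 != 0.
  rewrite /z bfDl bfZl (bfC z0 w1 discr_mxT) -/A -/b; have : k <= k * A by rewrite ler_peMr ?(le_trans ler01 k1)// -gtz0_ge1.
  by move=> h; apply/eqP; move: h kb; clear; set t := _ * A; lia.
have Dz : bf D z z != 0.
  rewrite /z !bfE (bfC z0 w1 discr_mxT) -/A -/b -/C.
  have k0 : 0 <= k by exact: le_trans ler01 k1.
  have A1 : 1 <= A by rewrite -gtz0_ge1.
  have h1 : k * k <= k * (k * A) by rewrite ler_wpM2l// ler_peMr.
  have h2 : (2 * `|b| + `|C| + 1) * k <= k * k by rewrite ler_wpM2r//.
  have h3 : - (`|b| * k) <= k * b by rewrite -mulNr mulrC ler_wpM2l//; lia.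
  have h4 : `|C| * 1 <= `|C| * k by rewrite ler_wpM2l.
  have h5 : (2 * `|b| + `|C| + 1) * k = 2 * (`|b| * k) + `|C| * k + k by ring.
  rewrite h5 in h2.
  have h6 : - `|C| <= C by lia.
  apply/eqP; move: k1 h6 h1 h2 h3 h4; set t1 := k * (k * A); set t2 := k * k; set t3 := k * b; set t4 := `|b| * k; set t5 := `|C| * k.
  clear; lia.
pose w := reflv D z w1.
have eD : bf D w w = bf D z z ^+ 2 * A.
  have e' x : bf D (reflv D x w1) (reflv D x w1) = bf D x x ^+ 2 * A.
    by rewrite /reflv !bfE (bfC w1 x discr_mxT) -/A; ring.
  exact: e'.
exists w; split.
- by rewrite eD mulr_gt0// exprn_even_gt0.
- by rewrite eD; exact: nonsquare_mul.
- apply: contra zU => wU.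
  have -> : rv z0 = (2 * bf D z w1)%:~R^-1 *: (rv w - (2 * bf D z w1 * k - bf D z z)%:~R *: rv w1).
    have nz : (2 * bf D z w1)%:~R != 0 :> rat by rewrite intr_eq0 mulf_neq0.
    apply: (scalerI nz); rewrite scalerA divff// scale1r /w /reflv -!map_mxZ /= -map_mxB /=.
    by congr (map_mx _ _); apply/rowP => l; rewrite /z !mxE; ring.
  by rewrite memvZ// memvB// memvZ.
Qed.

(** On these points all products are multiples of [a], so the coefficients of the recurrence are
    integers and the recurrence stays inside. *)
Definition lattice t : Prop := exists (u : int) m, B e m = 0 /\ t = u *: e + a *: m.

(** The condition [u != 0] says that the seed is not orthogonal to [e]. In [seed_extend] it ensures
    that the product of the two conjugates does not degenerate. *)
Definition seed t : Prop := B t t = a /\ exists (u : int) m, [/\ u != 0, B e m = 0 & t = u *: e + a *: m].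

Lemma seed_e : seed e.
Proof. by split => //; exists 1, 0; split => //; rewrite ?bf0r// scaler0 addr0 scale1r. Qed.

Lemma seed_lattice t : seed t -> lattice t.
Proof. by move=> [_ [u [m [_ em h]]]]; exists u, m. Qed.

Lemma lattice_dvd t t' : lattice t -> lattice t' -> exists g, B t t' = a * g.
Proof.
move=> [u [m [em ->]]] [u' [m' [em' ->]]].
exists (u * u' + a * B m m').
by rewrite !bfE em' (bfC m e ST) em; ring.
Qed.

(* The new seed is [u *: e + (y * a) *: f], [f] orthogonal to [e]: Pell's equation makes its norm equal to
   [a], and its product with [t] is large since the product of the two conjugates grows like [y ^+ 2]. *)
Lemma seed_extend (s : seq 'rV[int]_n.+1) (M : int) : (forall t, t \in s -> seed t) ->
  e \in s -> (size s <= n)%N -> exists r, [/\ seed r, rv r \notin <<[seq rv t | t <- s]>>%VS &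
    forall t, t \in s -> M * `|a| <= `|B r t|].
Proof.
move=> hs es sn.
have dU : (\dim <<[seq rv t | t <- s]>> <= n)%N by apply: leq_trans (dim_span _) _; rewrite size_map.
have [w [w1 w2 wU]] := discr_nonsquare_outside dU; set D := bf discr_mx w w in w1 w2.
(* With this [d] the vector [u *: e + (y * a) *: f] has norm [a * (u ^+ 2 - d * y ^+ 2)]. *)
pose d := a ^+ 2 * D; have d0 : 0 < d by rewrite mulr_gt0// exprn_even_gt0.
have dsq : forall k : int, k ^+ 2 != d by exact: nonsquare_mul.
have [f [ef Bf Qf]] : exists f, [/\ f = a *: w - B e w *: e, B e f = 0 & B f f = - (a * D)].
  exists (a *: w - B e w *: e); split => //; first by rewrite !bfE; ring.
  by rewrite /D discr_mxE !bfE (bfC w e ST); ring.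
have bound (s' : seq 'rV[int]_n.+1) : (forall t, t \in s' -> seed t) -> exists Y : int, forall u y, Y <= y -> 0 < u -> u ^+ 2 - d * y ^+ 2 = 1 ->
    forall t, t \in s' -> M * `|a| <= `|B (u *: e + (y * a) *: f) t|.
  elim: s' => [|t s' IH] hs'; first by exists 0.
  have [|Y hY] := IH; first by move=> x xs; apply: hs'; rewrite inE xs orbT.
  have [_ [ut [m [ut0 em et]]]] := hs' t (mem_head _ _).
  pose be := a * B f m; pose C := (1 + d) * `|ut| + `|be| + 1.
  pose M' := `|M|.
  exists (Num.max Y (M' * C + ut ^+ 2 + 1)) => u y; rewrite ge_max => /andP[yY yb] u0 pe x.
  rewrite inE => /orP[/eqP -> {x}|]; last exact: hY.
  have eB : B (u *: e + (y * a) *: f) t = a * (u * ut + y * be).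
    by rewrite et !bfE (bfC f e ST) Bf em /be; ring.
  rewrite eB normrM mulrC ler_wpM2l//.
  apply: le_trans (ler_norm M) _; rewrite -/M'.
  have M'0 : 0 <= M' by exact: normr_ge0.
  have C1 : 1 <= C by rewrite /C lerDr addr_ge0// mulr_ge0// addr_ge0// ltW.
  have MC0 : 0 <= M' * C by rewrite mulr_ge0// (le_trans ler01 C1).
  have u2 : 0 <= ut ^+ 2 by exact: sqr_ge0.
  have y0 : 0 < y by lia.
  pose X := `|u * ut + y * be|; pose X' := `|u * ut - y * be|.
  have D0 : d * ut ^+ 2 - be ^+ 2 != 0.
    by rewrite subr_eq0 eq_sym; exact: nonsquare_neq.
  have XX : X * X' = `|ut ^+ 2 + y ^+ 2 * (d * ut ^+ 2 - be ^+ 2)|.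
    rewrite /X /X' -normrM; congr (`|_|).
    have -> : (u * ut + y * be) * (u * ut - y * be) = (u ^+ 2 - d * y ^+ 2) * ut ^+ 2 + y ^+ 2 * (d * ut ^+ 2 - be ^+ 2) by ring.
    by rewrite pe mul1r.
  have XXl : y ^+ 2 - ut ^+ 2 <= X * X'.
    have h1 : y ^+ 2 <= `|y ^+ 2 * (d * ut ^+ 2 - be ^+ 2)|.
      rewrite normrM [`|y ^+ 2|]ger0_norm ?sqr_ge0// ler_peMr ?sqr_ge0//.
      by rewrite -gtz0_ge1 normr_gt0.
    rewrite XX addrC; move: h1; have := ler_normB (y ^+ 2 * (d * ut ^+ 2 - be ^+ 2) + ut ^+ 2) (ut ^+ 2).
    rewrite addrK [`|ut ^+ 2|]ger0_norm//; clear; lia.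
  have uy : u <= (1 + d) * y.
    rewrite -(@ler_pXn2r _ 2)// ?nnegrE ?(ltW u0)//; last by rewrite mulr_ge0 ?(ltW y0)// addr_ge0// ltW.
    have -> : u ^+ 2 = 1 + d * y ^+ 2 by rewrite -pe; ring.
    rewrite exprMn; have y1 : 1 <= y ^+ 2 by rewrite -gtz0_ge1 exprn_gt0.
    apply: le_trans (_ : (1 + d) * y ^+ 2 <= _); first by rewrite mulrDl mul1r lerD2r.
    by rewrite ler_wpM2r ?sqr_ge0// expr2 ler_peMr ?addr_ge0 ?(ltW d0)// lerDl ltW.
  have X'C : X' <= C * y.
    apply: le_trans (ler_normB _ _) _; rewrite !normrM (gtr0_norm u0) (gtr0_norm y0).
    have : u * `|ut| <= (1 + d) * y * `|ut| by rewrite ler_wpM2r.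
    rewrite /C; have -> : ((1 + d) * `|ut| + `|be| + 1) * y = (1 + d) * y * `|ut| + y * `|be| + y by ring.
    move: y0; set t1 := u * _; set t2 := (1 + d) * _ * _; set t3 := y * _; clear; lia.
  rewrite leNgt; apply/negP => XM.
  have h1 : X * X' <= M' * (C * y) by apply: ler_pM => //; exact: ltW.
  have h2 : (M' * C + ut ^+ 2 + 1) * y <= y ^+ 2 by rewrite expr2 ler_wpM2r// ltW.
  have h3 : ut ^+ 2 <= ut ^+ 2 * y by rewrite ler_peMr// -gtz0_ge1.
  rewrite !mulrDl mul1r -mulrA in h2.
  move: XXl h1 h2 h3 y0; set t1 := X * X'; set t2 := M' * (C * y); set t3 := ut ^+ 2 * y; set t4 := y ^+ 2; set t5 := ut ^+ 2; clear; lia.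
have [Y hY] := bound s hs; have [u [y [u0 yY pe]]] := pell_large R (Num.max Y 1) dsq d0.
move: yY; rewrite ge_max => /andP[yY y1].
exists (u *: e + (y * a) *: f); split; last by exact: hY.
- split.
    rewrite !bfE (bfC f e ST) Bf Qf; transitivity (a * (u ^+ 2 - d * y ^+ 2)); first by rewrite /d; ring.
    by rewrite pe mulr1.
  exists u, (y *: f); split; first by rewrite gt_eqF.
    by rewrite bfZr Bf mulr0.
  by rewrite scalerA [y * a]mulrC.
- apply: contra wU => rU; set U := <<_>>%VS in rU *.
  have eU : rv e \in U by apply: memv_span; apply/mapP; exists e.
  have nz : (y * a * a)%:~R != 0 :> rat by rewrite intr_eq0 !mulf_neq0// gt_eqF// (lt_le_trans ltr01 y1).
  have -> : rv w = (y * a * a)%:~R^-1 *: (rv (u *: e + (y * a) *: f) - (u - y * a * B e w)%:~R *: rv e).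
    apply: (scalerI nz); rewrite scalerA divff// scale1r -!map_mxZ /= -map_mxB /=.
    by congr (map_mx _ _); apply/rowP => l; rewrite ef !mxE; ring.
  by rewrite memvZ// memvB// memvZ.
Qed.

(** The constants 3 and 2 are those of [three_term_growth]; they start the induction in [g_window].
    The number [M] exceeds twice all earlier products. *)
Lemma seeds_exist : exists r : nat -> 'rV[int]_n.+1, [/\ forall i, (i <= n)%N -> seed (r i), r 0%N = e,
  forall i, (i <= n)%N -> rv (r i) \notin <<[seq rv (r j) | j <- iota 0 i]>>%VS,
  forall i j, (j < i)%N -> (i <= n)%N -> 3 * `|a| <= `|2 * B (r i) (r j)| &
  forall i j k, (k < j)%N -> (j < i)%N -> (i <= n)%N -> 2 * `|B (r j) (r k)| <= `|B (r i) (r k)|].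
Proof.
suff main k : (k <= n)%N -> exists r : nat -> 'rV[int]_n.+1, [/\ forall i, (i <= k)%N -> seed (r i), r 0%N = e,
  forall i, (i <= k)%N -> rv (r i) \notin <<[seq rv (r j) | j <- iota 0 i]>>%VS,
  forall i j, (j < i)%N -> (i <= k)%N -> 3 * `|a| <= `|2 * B (r i) (r j)| &
  forall i j l, (l < j)%N -> (j < i)%N -> (i <= k)%N -> 2 * `|B (r j) (r l)| <= `|B (r i) (r l)|].
  exact: main.
elim: k => [_|k IH kn].
  exists (fun=> e); split => //.
  - by move=> i _; exact: seed_e.
  - move=> i; rewrite leqn0 => /eqP -> /=; rewrite span_nil memv0.
    apply: contraNneq a0 => /rowP h; suff -> : e = 0 by rewrite bf0l.
    by apply/rowP => l; move: (h l); rewrite !mxE => /eqP; rewrite intr_eq0 => /eqP.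
  - by move=> i j ji; rewrite leqn0 => /eqP i0; rewrite i0 in ji.
  - by move=> i j l _ ji; rewrite leqn0 => /eqP i0; rewrite i0 in ji.
have [r [h1 h2 h3 h4 h5]] := IH (ltnW kn).
pose s := [seq r j | j <- iota 0 k.+1].
pose M : int := 3 + \sum_(i < k.+1) \sum_(j < k.+1) 2 * `|B (r i) (r j)|.
have ms i : (i <= k)%N -> r i \in s by move=> ik; apply/mapP; exists i; rewrite ?mem_iota.
have hM i j : (i <= k)%N -> (j <= k)%N -> 2 * `|B (r i) (r j)| <= M.
  move=> ik jk; apply: le_trans (_ : \sum_(i < k.+1) \sum_(j < k.+1) 2 * `|B (r i) (r j)| <= _); last by rewrite lerDr.
  rewrite (bigD1 (Ordinal (ik : (i < k.+1)%N)))//=.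
  apply: le_trans (_ : \sum_(j < k.+1) 2 * `|B (r i) (r j)| <= _); last first.
    by rewrite lerDl; apply: sumr_ge0 => x _; apply: sumr_ge0 => y _; rewrite mulr_ge0.
  rewrite (bigD1 (Ordinal (jk : (j < k.+1)%N)))//= lerDl.
  by apply: sumr_ge0 => y _; rewrite mulr_ge0.
have M3 : 3 <= M by rewrite lerDl sumr_ge0// => x _; apply: sumr_ge0 => y _; rewrite mulr_ge0.
have [|||x [x1 x2 x3]] := @seed_extend s M.
- by move=> t /mapP[j]; rewrite mem_iota /= => jk ->; exact: h1.
- by rewrite -h2; exact: ms.
- by rewrite size_map size_iota.
pose r' i := if i == k.+1 then x else r i.
have rE i : (i <= k)%N -> r' i = r i by move=> ik; rewrite /r' ltn_eqF// ltnS.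
have rK : r' k.+1 = x by rewrite /r' eqxx.
have a1 : 1 <= `|a| by rewrite -gtz0_ge1 normr_gt0.
exists r'; split.
- by move=> i; rewrite leq_eqVlt ltnS => /orP[/eqP -> |ik]; rewrite ?rK// rE//; exact: h1.
- by rewrite rE.
- move=> i; rewrite leq_eqVlt ltnS => /orP[/eqP -> |ik].
    rewrite rK (_ : [seq rv (r' j) | j <- iota 0 k.+1] = [seq rv t | t <- s])//.
    by rewrite /s -map_comp; apply/eq_in_map => j; rewrite mem_iota /= => jk; rewrite rE.
  rewrite rE// (_ : [seq rv (r' j) | j <- iota 0 i] = [seq rv (r j) | j <- iota 0 i]); first exact: h3.
  by apply/eq_in_map => j; rewrite mem_iota /= => jk; rewrite rE// ltnW// (leq_trans jk).
- move=> i j ji; rewrite leq_eqVlt ltnS => /orP[/eqP ei|ik].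
    rewrite ei in ji *; rewrite rK rE//; have := x3 _ (ms j ji).
    rewrite normrM; have : 3 * `|a| <= M * `|a| by rewrite ler_wpM2r.
    move: (`|B x (r j)|) => t; lia.
  by rewrite !rE//; [exact: h4|exact: leq_trans (ltnW ji) ik].
- move=> i j l lj ji; rewrite leq_eqVlt ltnS => /orP[/eqP ei|ik].
    rewrite ei in ji *; rewrite rK !rE//; last by exact: leq_trans (ltnW lj) ji.
    apply: le_trans (hM j l ji (leq_trans (ltnW lj) ji)) _.
    by apply: le_trans (x3 _ (ms l (leq_trans (ltnW lj) ji))); rewrite ler_peMr// (le_trans _ M3).
  have jk := leq_trans (ltnW ji) ik; have lk := leq_trans (ltnW lj) jk.
  by rewrite !rE//; exact: h5 lj ji ik.
Qed.

End Seeds.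

(** * Extending the seeds *)

Lemma three_term_growth (t x y : int) : 3 <= `|x| -> 3 <= `|t| -> 2 * `|y| <= `|t| ->
  2 * `|x| <= `|t * x - y|.
Proof.
move=> x3 t3 yt; have h1 : 3 * (2 * `|x| - 1) <= `|t| * (2 * `|x| - 1) by rewrite ler_wpM2r//; lia.
have h2 : `|t * x| = `|t| * `|x| by rewrite normrM.
have h3 : `|t| * (2 * `|x| - 1) = 2 * (`|t| * `|x|) - `|t| by ring.
have h4 := ler_normB (t * x - y) (- y).
rewrite opprK subrK h2 normrN in h4; rewrite h3 in h1.
move: x3 yt h1 h4; clear; move: (`|t| * `|x|) => p; lia.
Qed.

Lemma three_term_double (t x y : int) : `|y| <= `|x| -> 3 <= `|t| -> 2 * `|x| <= `|t * x - y|.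
Proof.
move=> yx t3; have h1 : 3 * `|x| <= `|t| * `|x| by rewrite ler_wpM2r.
have h4 := ler_normB (t * x - y) (- y).
rewrite opprK subrK normrM normrN in h4.
move: yx h1 h4; clear; move: (`|t| * `|x|) => p; lia.
Qed.

(** The hypothesis says that the intervals of radius [eps i] around [u i] are nested; a common point
    is a limit with an explicit rate. *)
Lemma nested_limit (R : realType) (u eps : nat -> R) :
  (forall i, `|u i.+1 - u i| <= eps i - eps i.+1) -> (forall i, 0 <= eps i) ->
  exists l, forall i, `|u i - l| <= eps i.
Proof.
move=> hu he.
have hlo i : u i - eps i <= u i.+1 - eps i.+1.
  by have := hu i; rewrite ler_norml => /andP[]; lra.
have hup i : u i.+1 + eps i.+1 <= u i + eps i.
  by have := hu i; rewrite ler_norml => /andP[]; lra.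
have lo_mono i k : u i - eps i <= u (k + i)%N - eps (k + i)%N.
  by elim: k => // k IH; apply: le_trans IH _; rewrite addSn.
have up_mono i k : u (k + i)%N + eps (k + i)%N <= u i + eps i.
  by elim: k => // k IH; apply: le_trans IH; rewrite addSn.
have cross i j : u i - eps i <= u j + eps j.
  apply: le_trans (lo_mono i j) _; apply: le_trans (up_mono j i); rewrite addnC lerD2l.
  by rewrite -subr_ge0 opprK addr_ge0.
pose E := [set u i - eps i | i in setT].
have supE : has_sup E.
  by split; [exists (u 0%N - eps 0%N); exists 0%N|exists (u 0%N + eps 0%N) => _ [i _ <-]].
exists (sup E) => i; rewrite ler_norml; apply/andP; split.
  have : sup E <= u i + eps i by apply: ge_sup => [|_ [j _ <-]]; [exact: supE.1|exact: cross].
  by lra.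
have : u i - eps i <= sup E by apply: ub_le_sup; [exact: supE.2|exists i].
by lra.
Qed.

Section Continue.
Context (R : realType) (n : nat) (S : 'M[int]_n.+1) (e : 'rV[int]_n.+1).
Hypothesis ST : S^T = S.
Local Notation B := (bf S).
Local Notation a := (B e e).
Hypothesis a0 : a != 0.
Local Notation iv x := (map_mx intr x : 'rV[R]_n.+1).
Local Notation rv x := (map_mx intr x : 'rV[rat]_n.+1).
Context (s : nat -> 'rV[int]_n.+1).
Hypotheses (s_seed : forall i, (i <= n)%N -> seed S e (s i))
  (s_free : forall i, (i <= n)%N -> rv (s i) \notin <<[seq rv (s j) | j <- iota 0 i]>>%VS)
  (s_big : forall i j, (j < i)%N -> (i <= n)%N -> 3 * `|a| <= `|2 * B (s i) (s j)|)
  (s_grow : forall i j k, (k < j)%N -> (j < i)%N -> (i <= n)%N ->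
     2 * `|B (s j) (s k)| <= `|B (s i) (s k)|).

Definition gram (x y : 'rV[int]_n.+1) : int := ((2 * B x y) %/ a)%Z.

(* [window i] lists [r i], ..., [r (i + n)]. *)
Fixpoint window i : nat -> 'rV[int]_n.+1 :=
  if i is i'.+1 then fun j => if (j < n)%N then window i' j.+1
    else gram (window i' n) (window i' 0%N) *: window i' n - window i' 0%N
  else s.

Definition continued i := window i 0%N.
Local Notation r := continued.

Lemma windowE i j : (j <= n)%N -> window i j = r (i + j).
Proof.
rewrite /continued; elim: j i => [|j IH] i jn; first by rewrite addn0.
by rewrite addnS -addSn -IH ?(ltnW jn)//= jn.
Qed.

Lemma continued_seed j : (j <= n)%N -> r j = s j.
Proof. by move=> jn; rewrite -(windowE 0 jn). Qed.

Lemma continuedS i : r (i + n.+1) = gram (r (i + n)) (r i) *: r (i + n) - r i.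
Proof. by rewrite addnS -addSn -windowE//= ltnn -!windowE// addn0. Qed.

Local Notation lattice := (lattice S e).

Lemma gramE t t' : lattice t -> lattice t' -> 2 * B t t' = a * gram t t'.
Proof.
by move=> h h'; have [g hg] := lattice_dvd ST h h'; rewrite /gram hg mulrCA (mulrC a) mulzK// mulrC.
Qed.

Lemma continued_ind (P : nat -> Prop) : (forall i, (i <= n)%N -> P i) ->
  (forall i, P i -> P (i + n)%N -> P (i + n.+1)%N) -> forall i, P i.
Proof.
move=> h0 hS; elim/ltn_ind => i IH; case: (leqP i n) => [|ni]; first exact: h0.
rewrite -(subnK ni); apply: hS; apply: IH.
  by rewrite ltn_subrL (leq_ltn_trans _ ni).
by rewrite -[X in (_ < X)%N](subnK ni) addnS.
Qed.

Lemma continued_lattice i : lattice (r i).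
Proof.
apply: (@continued_ind (fun i => lattice (r i))) => {i} [i ni|i [u [m [em h]]] [u' [m' [em' h']]]].
  by rewrite continued_seed//; apply: seed_lattice; exact: s_seed.
rewrite continuedS; move: (gram _ _) => g; rewrite h h'.
exists (g * u' - u), (g *: m' - m); split; first by rewrite !bfE em em'; ring.
by apply/rowP => k; rewrite !mxE; ring.
Qed.

Local Notation g i j := (gram (r i) (r j)).

Lemma gC i j : g i j = g j i.
Proof. by rewrite /gram bfC. Qed.

Lemma gE i j : 2 * B (r i) (r j) = a * g i j.
Proof. by apply: gramE; exact: continued_lattice. Qed.

Lemma g_rec i j : g (i + n.+1) j = g (i + n) i * g (i + n) j - g i j.
Proof.
apply: (mulfI a0); rewrite -gE continuedS; move: (gram (r (i + n)) (r i)) => t; rewrite !bfE.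
have -> : a * (t * g (i + n) j - g i j) = t * (a * g (i + n) j) - a * g i j by ring.
by rewrite -!gE; ring.
Qed.

Lemma continued_norm i : B (r i) (r i) = a.
Proof.
apply: (@continued_ind (fun i => B (r i) (r i) = a)) => {i} [i ni|i h h'].
  by rewrite continued_seed//; have [] := s_seed ni.
have := gE (i + n) i; rewrite continuedS; move: (gram (r (i + n)) (r i)) => t et.
rewrite !bfE h h' (bfC (r i) (r (i + n)) ST); transitivity (t * (a * t - 2 * B (r (i + n)%N) (r i)) + a).
  by ring.
by rewrite et subrr mulr0 add0r.
Qed.

Lemma g_diag i : g i i = 2.
Proof. by apply: (mulfI a0); rewrite -gE continued_norm mulrC. Qed.

Lemma g_next i : g (i + n.+1) (i + n) = g (i + n) i.
Proof. by rewrite g_rec g_diag (gC i); ring. Qed.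

(** When the window moves by one, the newest pair inherits the entry [g (i + n) i] by [g_next], and
    all other new entries obey a three-term recurrence dominated by this same large coefficient. *)
Lemma g_window i : (forall j k, (i <= k < j)%N -> (j <= i + n)%N -> 3 <= `|g j k|) /\
  (forall l j k, (i <= k < j)%N -> (j < l <= i + n)%N -> 2 * `|g j k| <= `|g l k|).
Proof.
have a1 : 0 < `|a| by rewrite normr_gt0.
elim: i => [|i [h1 h2]].
  split=> [j k|l j k]; rewrite add0n.
    move=> kj jn; rewrite -(ler_pM2l a1) -normrM -gE mulrC !continued_seed ?s_big//.
    by apply: ltnW; exact: leq_trans kj jn.
  move=> kj /andP[jl ln]; rewrite -(ler_pM2l a1) mulrCA -!normrM -!gE !normrM.
  have jn := leq_trans (ltnW jl) ln; have kn := leq_trans (ltnW kj) jn.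
  rewrite mulrCA ler_wpM2l//; rewrite !continued_seed//; exact: s_grow.
have last k : (i < k < i + n)%N -> 2 * `|g (i + n) k| <= `|g (i + n.+1) k|.
  move=> /andP[ik kin]; rewrite g_rec (gC i k).
  have nin : (i <= i < i + n)%N by rewrite leqnn (ltn_trans ik kin).
  apply: three_term_growth; first by apply: h1; rewrite ?(ltnW ik).
    by apply: h1.
  by apply: h2; rewrite ?leqnn ?kin.
have h1' k : (i < k < i + n.+1)%N -> 3 <= `|g (i + n.+1) k|.
  rewrite addnS ltnS [(k <= _)%N]leq_eqVlt => /andP[ik /orP[/eqP ek|kin]].
    by rewrite ek -addnS g_next; apply: h1; rewrite ?leqnn//= -ek.
  rewrite -addnS; apply: le_trans (_ : 3 <= 2 * `|g (i + n) k|) (last k _); last by rewrite ik.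
  have : 3 <= `|g (i + n) k| by apply: h1; rewrite ?(ltnW ik).
  by lia.
split=> [j k|l j k].
  move=> /andP[ik kj]; rewrite addSnnS leq_eqVlt => /orP[/eqP ej|jin].
    by rewrite ej; apply: h1'; rewrite ik -ej.
  by apply: h1; [rewrite ltnW|move: jin; rewrite addnS ltnS].
move=> /andP[ik kj] /andP[jl]; rewrite addSnnS leq_eqVlt => /orP[/eqP el|lin].
  rewrite el; move: (jl); rewrite el addnS ltnS leq_eqVlt => /orP[/eqP ej|jin].
    by rewrite ej -addnS; apply: last; rewrite ik -ej.
  apply: le_trans (_ : `|g (i + n) k| <= _).
    by apply: h2; rewrite ?jin ?leqnn// (ltnW ik).
  rewrite -addnS; apply: le_trans (last k _); first by rewrite ler_peMl.
  by rewrite ik (ltn_trans kj).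
by apply: h2; rewrite ?jl ?(ltnW ik)//; move: lin; rewrite addnS ltnS.
Qed.

Hypothesis n0 : (0 < n)%N.

(* [b i / 2] is the coordinate of [r i] on [e]. *)
Local Notation b i := (g i 0).

Lemma g_big i : 3 <= `|g (i + n) i|.
Proof. by have [h _] := g_window i; apply: h; rewrite ?leqnn//= -[X in (X < _)%N]addn0 ltn_add2l. Qed.

Lemma coord_mono i j : (j <= i)%N -> `|b j| <= `|b i|.
Proof.
suff h k : `|b k| <= `|b k.+1|.
  by move=> /subnK <-; elim: (i - j)%N => // m IH; apply: le_trans IH _; rewrite addSn.
elim/ltn_ind: k => k IH; case: (ltnP k n) => kn.
  case: k kn {IH} => [|k] kn.
    by have [h _] := g_window 0; rewrite g_diag; apply: le_trans (h 1%N 0%N _ _).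
  have [_ h] := g_window 0; apply: le_trans (h k.+2 k.+1 0%N _ _); rewrite ?add0n ?ltnSn//.
  by rewrite ler_peMl.
have mono m i' : (m + i' <= k)%N -> `|b m| <= `|b (m + i')|.
  elim: i' => [|i' IH2]; first by rewrite addn0.
  rewrite addnS => hm; apply: le_trans (IH2 (ltnW hm)) _; exact: IH.
set i' := (k - n)%N; have ek : k = (i' + n)%N by rewrite /i' subnK.
rewrite ek -addnS g_rec; have := g_big i'; have := mono i' n; rewrite ek => /(_ (leqnn _)) h1 h2.
by apply: le_trans (three_term_double h1 h2); rewrite ler_peMl.
Qed.

Lemma coord_double i : (n <= i)%N -> 2 * `|b i| <= `|b i.+1|.
Proof.
move=> /subnK <-; set i' := (i - n)%N; rewrite -addnS g_rec; have := g_big i'.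
have := coord_mono (leq_addr n i'); move: (g _ _) (g _ _) (g _ _) => t x y.
exact: three_term_double.
Qed.

Lemma coord_ge2 i : 2 <= `|b i|.
Proof. by have := coord_mono (leq0n i); rewrite g_diag. Qed.

(** Divided by [b i * b j], this is the difference of [r j] and [r i] after both are normalised by
    their [b]. *)
Definition cross i j : 'rV[int]_n.+1 := b i *: r j - b j *: r i.

Lemma crossC i j : cross j i = - cross i j.
Proof. by rewrite /cross opprB. Qed.

Lemma cross_rec i k : cross (i + n.+1) k = g (i + n) i *: cross (i + n) k - cross i k.
Proof.
rewrite /cross g_rec continuedS; move: (gram (r (i + n)) (r i)) => t.
by apply/rowP => l; rewrite !mxE; ring.
Qed.

Lemma cross_next i : cross (i + n.+1) (i + n) = cross (i + n) i.
Proof.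
rewrite cross_rec (_ : cross (i + n) (i + n) = 0); last by rewrite /cross subrr.
by rewrite scaler0 sub0r -crossC.
Qed.

Let H i j : R := `|iv (cross i j)|.

Lemma cross_norm_sym i j : H i j = H j i.
Proof. by rewrite /H crossC map_mxN normrN. Qed.

(* The recurrence for [cross] is that of [g], so the bound [A * (|g| - 1)] propagates. *)
Lemma cross_window : exists2 A : R, 0 < A &
  forall i j k, (i <= k < j)%N -> (j <= i + n)%N -> H j k <= A * (`|g j k|%:~R - 1).
Proof.
pose A := 1 + \sum_(j < n.+1) \sum_(k < n.+1) H j k.
have H0 j k : 0 <= H j k by exact: normr_ge0.
have A0 : 0 < A by rewrite ltr_wpDr// sumr_ge0// => j _; rewrite sumr_ge0.
exists A => // i; elim: i => [|i IH] j k.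
  rewrite add0n => /andP[_ kj] jn; have [h _] := g_window 0.
  have : 3 <= `|g j k| by exact: h.
  rewrite -(ler_int R) => h3.
  apply: le_trans (_ : A * 1 <= _); last by rewrite ler_wpM2l ?(ltW A0)//; move: h3; lra.
  rewrite mulr1 (_ : H j k = H (Ordinal (jn : (j < n.+1)%N)) (Ordinal (leq_trans (ltnW kj) jn : (k < n.+1)%N)))//.
  rewrite /A (bigD1 (Ordinal (jn : (j < n.+1)%N)))//= (bigD1 (Ordinal (leq_trans (ltnW kj) jn : (k < n.+1)%N)))//=.
  set x1 := H j k; set x2 := \sum_(_ < _ | _) _; set x3 := \sum_(_ < _ | _) _.
  have : 0 <= x2 by apply: sumr_ge0.
  have : 0 <= x3 by apply: sumr_ge0 => l _; exact: sumr_ge0.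
  by lra.
move=> /andP[ik kj]; rewrite addSnnS leq_eqVlt => /orP[/eqP ej|jin]; last first.
  by apply: IH; [rewrite ltnW|move: jin; rewrite addnS ltnS].
rewrite ej; move: (kj); rewrite ej addnS ltnS leq_eqVlt => /orP[/eqP ek|kin].
  rewrite ek -addnS /H cross_next g_next; apply: IH; last by [].
  by rewrite leqnn -[X in (X < _)%N]addn0 ltn_add2l.
rewrite -addnS.
have nin : (i <= i < i + n)%N by rewrite leqnn (ltn_trans ik kin).
have h1 : H (i + n) k <= A * (`|g (i + n) k|%:~R - 1) by apply: IH; rewrite ?(ltnW ik).
have h2 : H i k <= A * (`|g k i|%:~R - 1).
  by rewrite cross_norm_sym; apply: IH; rewrite ?leqnn//= ltnW.
have h3 : (2 * `|g k i|)%:~R <= `|g (i + n) i|%:~R :> R.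
  by rewrite ler_int; have [_ h] := g_window i; apply: h; rewrite ?leqnn ?kin.
have h4 : H (i + n.+1) k <= `|g (i + n) i|%:~R * H (i + n) k + H i k.
  rewrite /H cross_rec map_mxB map_mxZ; apply: le_trans (ler_normB _ _) _.
  by rewrite normrZ -intr_norm.
have h5 : (`|g (i + n) i| * `|g (i + n) k| - `|g k i|)%:~R <= `|g (i + n.+1) k|%:~R :> R.
  rewrite ler_int g_rec (gC i k) -normrM.
  have := ler_normB (g (i + n) i * g (i + n) k - g k i) (- g k i).
  by rewrite opprK subrK normrN; lia.
move: h1 h2 h3 h4 h5; rewrite !rmorphB !rmorphM /=.
have t0 : 0 <= `|g (i + n) i|%:~R :> R by rewrite ler0z.
move: t0; set t : R := `|g (i + n) i|%:~R; set x : R := `|g (i + n) k|%:~R.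
set y : R := `|g k i|%:~R; set z : R := `|g (i + n.+1) k|%:~R => t0 h1 h2 h3 h4 h5.
apply: le_trans h4 _; apply: le_trans (lerD (ler_wpM2l t0 h1) h2) _.
have -> : t * (A * (x - 1)) + A * (y - 1) = A * (t * x - t + y - 1) by ring.
rewrite ler_wpM2l ?(ltW A0)//; move: h3 h5; rewrite mulr_natl; lra.
Qed.

Let bR i : R := (b i)%:~R.
Let beta i : R := `|bR i|.

Lemma betaE i : beta i = `|b i|%:~R. Proof. by rewrite /beta /bR intr_norm. Qed.

Lemma beta_gt0 i : 0 < beta i.
Proof. by rewrite betaE ltr0z; have := coord_ge2 i; lia. Qed.

Lemma beta_ge1 i : 1 <= beta i.
Proof. by rewrite betaE ler1z; have := coord_ge2 i; lia. Qed.

Lemma beta_mono i j : (j <= i)%N -> beta j <= beta i.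
Proof. by move=> ji; rewrite !betaE ler_int coord_mono. Qed.

Lemma beta_double i : (n <= i)%N -> 2 * beta i <= beta i.+1.
Proof. by move=> ni; rewrite !betaE -[2 * _](intrM R 2) ler_int coord_double. Qed.

Lemma beta_infty M : exists I, forall i, (I <= i)%N -> M <= beta i.
Proof.
have h k : k%:R <= beta (n + k).
  elim: k => [|k IH]; first by rewrite (le_trans ler01)// beta_ge1.
  rewrite addnS; apply: le_trans (beta_double (leq_addr _ _)).
  by rewrite -natr1; have := beta_ge1 (n + k); move: IH; lra.
exists (n + (Num.truncn M).+1)%N => i hi; apply: le_trans (beta_mono hi).
by apply: le_trans (h _); apply: ltW; rewrite truncnS_gt.
Qed.

(** Consecutive quotients of [r i] by [bR i] differ by a [cross] over the product of both [beta].
    The [- 1] in [cross_window] matches the inequality between [(|g| - 1) * beta i] and [beta i.+1],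
    which leaves a difference of at most [A / beta i ^+ 2]. *)
Lemma limit_exists : exists (xi : 'rV[R]_n.+1) (A : R), 0 < A /\
  forall i, (n <= i)%N -> `|iv (r i) - bR i *: xi| <= A / beta i.
Proof.
have [A A0 hA] := cross_window.
have bne i : bR i != 0 by rewrite -normr_gt0; exact: beta_gt0.
have step i : (n <= i)%N -> H i.+1 i * beta i <= A * beta i.+1.
  move=> /subnK <-; set i' := (i - n)%N; rewrite -addnS.
  have h : H (i' + n.+1) (i' + n) <= A * (`|g (i' + n) i'|%:~R - 1).
    rewrite /H cross_next; apply: (hA i') => //.
    by rewrite leqnn -[X in (X < _)%N]addn0 ltn_add2l.
  have h2 : (`|g (i' + n) i'| - 1) * `|b (i' + n)| <= `|b (i' + n.+1)|.
    rewrite g_rec; have := coord_mono (leq_addr n i').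
    have := ler_normB (g (i' + n) i' * b (i' + n) - b i') (- b i').
    rewrite opprK subrK normrN normrM mulrBl mul1r.
    by move: (_ * _) (`|b i'|); lia.
  apply: le_trans (ler_wpM2r (ltW (beta_gt0 _)) h) _; rewrite -mulrA ler_wpM2l ?(ltW A0)//.
  by rewrite !betaE -[_ - 1](intrB R _ 1) -intrM ler_int.
have coord k : exists l, forall i, `|iv (r (i + n)) 0 k / bR (i + n) - l| <= 2 * A / beta (i + n) ^+ 2.
  apply: nested_limit => i; last by rewrite divr_ge0 ?sqr_ge0// mulr_ge0// ltW.
  have in' : (n <= i + n)%N by exact: leq_addl.
  rewrite addSn; move: (i + n)%N in' => j nj.
  have -> : iv (r j.+1) 0 k / bR j.+1 - iv (r j) 0 k / bR j = - (iv (cross j.+1 j) 0 k / (bR j * bR j.+1)).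
    by rewrite /cross !mxE intrB !intrM -/(bR j) -/(bR j.+1); field; rewrite !bne.
  rewrite normrN normrM normfV normrM -/(beta j) -/(beta j.+1).
  have b1 := beta_gt0 j; have b2 := beta_gt0 j.+1; have b3 := beta_double nj.
  apply: le_trans (_ : A / beta j ^+ 2 <= _).
    rewrite ler_pdivrMr ?mulr_gt0//.
    have -> : A / beta j ^+ 2 * (beta j * beta j.+1) = A * beta j.+1 / beta j by field; lra.
    rewrite ler_pdivlMr//; apply: le_trans (step _ nj); rewrite ler_wpM2r ?(ltW b1)//.
    exact: norm_coord.
  rewrite -subr_ge0.
  have -> : 2 * A / beta j ^+ 2 - 2 * A / beta j.+1 ^+ 2 - A / beta j ^+ 2 =
    A * (beta j.+1 ^+ 2 - 2 * beta j ^+ 2) / (beta j ^+ 2 * beta j.+1 ^+ 2) by field; lra.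
  apply: divr_ge0; last by rewrite mulr_ge0 ?sqr_ge0.
  apply: mulr_ge0; [exact: ltW|rewrite subr_ge0].
  by apply: le_trans (_ : (2 * beta j) ^+ 2 <= _); [nra|rewrite ler_pXn2r// ?nnegrE; lra].
have [l hl] := choice coord.
exists (\row_k l k), (2 * A); split; first by rewrite mulr_gt0.
move=> i /subnK <-; set i' := (i - n)%N; apply: norm_le_coord => k; rewrite !mxE.
have := hl k i'; rewrite mxE => h; have b0 := bne (i' + n)%N.
have -> : (r (i' + n)%N 0 k)%:~R - bR (i' + n)%N * l k = bR (i' + n)%N * ((r (i' + n)%N 0 k)%:~R / bR (i' + n)%N - l k).
  by field.
rewrite normrM -/(beta _); apply: le_trans (ler_wpM2l (ltW (beta_gt0 _)) h) _.
by rewrite le_eqVlt; apply/orP; left; apply/eqP; have := beta_gt0 (i' + n) => ?; field; lra.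
Qed.

Lemma continued_neq0 i : r i != 0.
Proof. by apply: contraNneq a0 => h; rewrite -(continued_norm i) h bf0l. Qed.

Lemma continued_span (l : 'cV[int]_n.+1) : (forall i, (i <= n)%N -> r i *m l = 0) -> l = 0.
Proof.
move=> h; pose L := map_mx intr l : 'cV[rat]_n.+1.
pose X i := [seq rv (s j) | j <- iota 0 i].
have XS i : X i.+1 = rcons (X i) (rv (s i)) by rewrite /X -(addn1 i) iotaD map_cat cats1.
have Xfree i : (i <= n.+1)%N -> free (X i).
  elim: i => [|i IH] hi; first by rewrite /X /= nil_free.
  rewrite XS (_ : free _ = free (rv (s i) :: X i)); last by apply: perm_free; rewrite perm_rcons.
  rewrite free_cons s_free//= IH//; exact: ltnW.
have full : (<<X n.+1>> = fullv)%VS.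
  apply/eqP; rewrite eqEdim subvf /= dimvf /dim /= mul1n.
  by have := Xfree _ (leqnn _); rewrite /free => /eqP ->; rewrite size_map size_iota.
have sub : (<<X n.+1>> <= lker (linfun (mulmxr L : 'rV[rat]_n.+1 -> 'rV[rat]_1)))%VS.
  apply/span_subvP => x /mapP[j]; rewrite mem_iota /= ltnS => jn ->.
  by rewrite memv_ker lfunE /= /L -map_mxM -(continued_seed jn) h// map_mx0.
have L0 (x : 'rV[rat]_n.+1) : x *m L = 0.
  have : x \in lker (linfun (mulmxr L : 'rV[rat]_n.+1 -> 'rV[rat]_1)).
    by apply: (subvP sub); rewrite full memvf.
  by rewrite memv_ker lfunE /= => /eqP.
apply/matrixP => i j; rewrite ord1 mxE; have := L0 (delta_mx 0 i).
rewrite -matrix.rowE => /rowP/(_ 0); rewrite !mxE => /eqP.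
by rewrite intr_eq0 => /eqP.
Qed.

(** Isotropy: the form has the constant value [a] on the [r i], while a non-zero value at [xi] would
    make it grow. Independence: an integral form vanishing at [xi] takes integer values tending to 0
    on the [r i]. Growth: isotropy of [xi] leaves [g (i + n) i] of order at most
    [bt (i + n) / bt i], which is inserted in the recurrence for [bt]. *)
Lemma limit_facts : exists (xi : 'rV[R]_n.+1) (A C : R) (bt : nat -> R),
  [/\ [/\ 0 < A, 0 < C, bf (map_mx intr S) xi xi = 0 & Q_independent xi],
    [/\ forall i, 1 <= bt i, forall i j, (j <= i)%N -> bt j <= bt i &
      forall M, exists I, forall i, (I <= i)%N -> M <= bt i],
    forall i, (n <= i)%N -> (exists t, `|iv (r i) - t *: xi| <= A / bt i) /\ `|iv (r i)| <= C * bt i &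
    forall i, (n <= i)%N -> bt (i + n.+1)%N * bt i <= C * bt (i + n)%N ^+ 2].
Proof.
have [xi [A [A0 hA]]] := limit_exists.
have [C C0 hC] := bf_bound (map_mx intr S : 'M[R]_n.+1).
have STR : (map_mx intr S : 'M[R]_n.+1)^T = map_mx intr S by rewrite map_trmx ST.
pose del i := iv (r i) - bR i *: xi.
have rE i : iv (r i) = bR i *: xi + del i by rewrite /del addrC subrK.
have BE i j : (B (r i) (r j))%:~R = bR i * bR j * bf (map_mx intr S) xi xi + (bR i * bf (map_mx intr S) xi (del j)
    + bR j * bf (map_mx intr S) xi (del i) + bf (map_mx intr S) (del i) (del j)).
  move: (rE i) (rE j); rewrite -bf_map; move: (del i) (del j) => d d' -> ->.
  by rewrite !bfE (bfC d xi STR); ring.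
pose K := 2 * (C * `|xi| * A) + C * A ^+ 2.
have K0 : 0 <= K by rewrite /K addr_ge0 ?mulr_ge0 ?sqr_ge0 ?(ltW C0) ?(ltW A0).
have bound i j : (n <= j)%N -> (j <= i)%N -> `|bR i * bf (map_mx intr S) xi (del j)
    + bR j * bf (map_mx intr S) xi (del i) + bf (map_mx intr S) (del i) (del j)| <= K * (beta i / beta j).
  move=> nj ji; have ni := leq_trans nj ji.
  have b1 := beta_ge1 i; have b2 := beta_ge1 j; have b3 := beta_mono ji.
  have di := hA i ni; have dj := hA j nj; rewrite -/(del _) in di dj.
  have h1 : `|bR i * bf (map_mx intr S) xi (del j)| <= C * `|xi| * A * (beta i / beta j).
    rewrite normrM -/(beta i) (_ : _ * A * _ = beta i * (C * `|xi| * (A / beta j))); last by field; lra.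
    rewrite ler_wpM2l ?(ltW (beta_gt0 _))//; apply: le_trans (hC _ _) _.
    by rewrite ler_wpM2l// mulr_ge0// ltW.
  have q1 : beta j / beta i <= 1 by rewrite ler_pdivrMr; lra.
  have q2 : 1 <= beta i / beta j by rewrite ler_pdivlMr; lra.
  have h2 : `|bR j * bf (map_mx intr S) xi (del i)| <= C * `|xi| * A * (beta i / beta j).
    apply: le_trans (_ : C * `|xi| * A * (beta j / beta i) <= _); last first.
      by apply: ler_wpM2l; [rewrite !mulr_ge0 ?(ltW C0) ?(ltW A0)|lra].
    rewrite normrM -/(beta j) (_ : _ * A * _ = beta j * (C * `|xi| * (A / beta i))); last by field; lra.
    rewrite ler_wpM2l ?(ltW (beta_gt0 _))//; apply: le_trans (hC _ _) _.
    by rewrite ler_wpM2l// mulr_ge0// ltW.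
  have h3 : `|bf (map_mx intr S) (del i) (del j)| <= C * A ^+ 2 * (beta i / beta j).
    apply: le_trans (hC _ _) _; rewrite -!mulrA ler_wpM2l ?(ltW C0)//.
    apply: le_trans (_ : A * A <= _).
      apply: ler_pM => //.
        by apply: le_trans di _; rewrite ler_pdivrMr ?beta_gt0// ler_peMr// ltW.
      by apply: le_trans dj _; rewrite ler_pdivrMr ?beta_gt0// ler_peMr// ltW.
    by rewrite mulrA -expr2 ler_peMr ?sqr_ge0.
  apply: le_trans (ler_normD _ _) _; apply: le_trans (lerD (ler_normD _ _) (lexx _)) _.
  rewrite [K * _]mulrDl mulr_natl [_ *+ 2 * _]mulrDl.
  by rewrite lerD// lerD.
have Q0 : bf (map_mx intr S) xi xi = 0.
  apply/eqP; rewrite -normr_eq0 eq_le normr_ge0 andbT leNgt; apply/negP => q0.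
  have [I hI] := beta_infty ((K + `|a|%:~R) / `|bf (map_mx intr S) xi xi| + 1).
  have := hI (maxn I n) (leq_maxl _ _); set i := maxn I n => hi.
  have ni : (n <= i)%N by exact: leq_maxr.
  have := bound i i ni (leqnn _); rewrite divff ?gt_eqF ?beta_gt0// mulr1 => hb.
  have := BE i i; rewrite continued_norm => he.
  have : `|bR i * bR i * bf (map_mx intr S) xi xi| <= K + `|a|%:~R.
    rewrite -[_ * bf _ _ _](addrK (bR i * bf (map_mx intr S) xi (del i)
    + bR i * bf (map_mx intr S) xi (del i) + bf (map_mx intr S) (del i) (del i))) -he addrC.
    by apply: le_trans (ler_normD _ _) _; rewrite normrN intr_norm lerD2r.
  rewrite !normrM -/(beta i) => hb2.
  have b1 := beta_ge1 i.
  have : beta i * `|bf (map_mx intr S) xi xi| <= K + `|a|%:~R.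
    by apply: le_trans hb2; rewrite -mulrA ler_peMl// mulr_ge0//; lra.
  by rewrite -ler_pdivlMr//; lra.
have li : Q_independent xi.
  apply/Q_independentP => l hl.
  have Ll i : (n <= i)%N -> `|(r i *m l) 0 0|%:~R <= \sum_k `|l k 0|%:~R * A / beta i :> R.
    move=> ni; rewrite intr_norm.
    have -> : ((r i *m l) 0 0)%:~R = (del i *m map_mx intr l) 0 0 :> R.
      by rewrite /del mulmxBl -scalemxAl hl scaler0 subr0 -map_mxM [RHS]mxE.
    rewrite mxE; apply: le_trans (ler_norm_sum _ _ _) _; apply: ler_sum => k _.
    rewrite normrM [map_mx intr l _ _]mxE -intr_norm mulrC -mulrA ler_wpM2l ?ler0z//.
    by apply: le_trans (norm_coord _ _) _; exact: hA.
  have ev : exists I, forall i, (I <= i)%N -> r i *m l = 0.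
    have [I hI] := beta_infty (\sum_k `|l k 0|%:~R * A + 1).
    exists (maxn I n) => i; rewrite geq_max => /andP[Ii ni].
    apply/matrixP => x y; rewrite !ord1 [RHS]mxE; apply/eqP; rewrite -normr_le0.
    have : `|(r i *m l) 0 0|%:~R < 1 :> R.
      apply: le_lt_trans (Ll i ni) _; rewrite -mulr_suml ltr_pdivrMr ?beta_gt0// mul1r.
      by have := hI i Ii; lra.
    by rewrite ltrz1; lia.
  have [I hI] := ev; apply: continued_span => i _.
  (* The recurrence is solved for its lowest term, so vanishing descends to the seeds, which
     span. *)
  have desc m : r (I - m)%N *m l = 0 -> (forall j, (I - m <= j)%N -> r j *m l = 0) -> (forall j, (I - m.+1 <= j)%N -> r j *m l = 0).
    move=> _ IH j; rewrite leq_eqVlt => /orP[/eqP <-|hj]; last by apply: IH; lia.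
    case: (leqP I m) => Im; first by apply: IH; lia.
    set i' := (I - m.+1)%N; have e1 := continuedS i'.
    have -> : r i' = gram (r (i' + n)) (r i') *: r (i' + n)%N - r (i' + n.+1)%N by rewrite e1 opprB addrCA subrr addr0.
    by rewrite mulmxBl -scalemxAl !IH ?scaler0 ?subrr// /i'; lia.
  have all m : forall j, (I - m <= j)%N -> r j *m l = 0.
    by elim: m => [|m IH]; [rewrite subn0|apply: desc => //; apply: IH].
  by apply: (all I); rewrite subnn.
pose C' := `|xi| + A + 2 * K + 1.
have x0 : 0 <= `|xi| by [].
exists xi, A, C', beta; split => //.
- split => //; rewrite /C'; lra.
- split; [exact: beta_ge1|exact: beta_mono|exact: beta_infty].
- move=> i ni; split; first by exists (bR i); exact: hA.
  rewrite rE; apply: le_trans (ler_normD _ _) _; rewrite normrZ -/(beta i).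
  have := hA i ni; rewrite -/(del i) => h; have b1 := beta_ge1 i.
  have : A / beta i <= A * beta i.
    by rewrite ler_wpM2l ?(ltW A0)// (le_trans _ b1)// invf_le1// beta_gt0.
  have : 0 <= (2 * K + 1) * beta i by rewrite mulr_ge0// ?(ltW (beta_gt0 _))//; lra.
  by rewrite /C'; lra.
- move=> i ni; have b1 := beta_ge1 i; have b2 := beta_mono (leq_addr n i).
  have := bound (i + n)%N i ni (leq_addr _ _); have := BE (i + n)%N i; rewrite Q0 mulr0 add0r => <- hb.
  have ht : `|g (i + n) i|%:~R <= 2 * (K * (beta (i + n) / beta i)).
    have h1 : `|g (i + n) i| <= `|2 * B (r (i + n)) (r i)|.
      by rewrite gE normrM ler_peMl// -gtz0_ge1 normr_gt0.
    move: h1; rewrite -(ler_int R) => h1; apply: le_trans h1 _.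
    by rewrite intr_norm intrM normrM ger0_norm// ler_wpM2l.
  have hrec : beta (i + n.+1) <= `|g (i + n) i|%:~R * beta (i + n) + beta i.
    rewrite /beta /bR g_rec rmorphB rmorphM; apply: le_trans (ler_normB _ _) _.
    by rewrite normrM -intr_norm.
  move: ht hrec; set t : R := `|g _ _|%:~R; set x := beta (i + n); set y := beta (i + n.+1); set z := beta i => ht hrec.
  have z1 : 1 <= z by exact: beta_ge1.
  have zx : z <= x by exact: beta_mono (leq_addr _ _).
  have tz : t * z <= 2 * K * x.
    apply: le_trans (ler_wpM2r _ ht) _; first by lra.
    by rewrite le_eqVlt; apply/orP; left; apply/eqP; field; lra.
  have h1 : y * z <= (t * x + z) * z by rewrite ler_wpM2r//; lra.
  have h2 : t * z * x <= 2 * K * x * x by rewrite ler_wpM2r//; lra.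
  have h3 : z * z <= x * x by apply: ler_pM; lra.
  have h4 : 0 <= (`|xi| + A) * (x * x) by rewrite !mulr_ge0//; lra.
  rewrite /C' expr2; move: h1 h2 h3 h4; lra.
Qed.

End Continue.

(** * Growth of the extended sequence *)

Section Ratio.
Context (R : realType) (n : nat) (rho : R).
Hypotheses (n0 : (0 < n)%N) (rho1 : 1 < rho) (rho2 : rho < 2) (hrho : root (rho_poly R n) rho).

(** The second factor is increasing and vanishes at [rho], so the left-hand side stays away from 0
    beyond any point larger than [rho]. *)
Lemma rho_gap (x : R) : 0 < x -> x - 2 + x ^- n = (x - 1) * (1 - \sum_(i < n) x ^- i.+1).
Proof.
move=> x0; have xn : x ^+ n != 0 by rewrite expf_neq0// gt_eqF.
have key : x ^+ n * \sum_(i < n) x ^- i.+1 = \sum_(i < n) x ^+ i.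
  rewrite mulr_sumr (reindex_inj rev_ord_inj) /=; apply: eq_bigr => i _.
  rewrite subnSK//.
  have h : (i + (n - i) = n)%N by rewrite subnKC ?(ltnW (ltn_ord i)).
  by rewrite -[X in x ^+ X * _]h exprD mulfK// expf_neq0// gt_eqF.
apply: (mulfI xn); rewrite mulrCA mulrBr mulr1 key mulrDr divff//.
have := subrX1 x n; set s := \sum_(i < n) _ => h.
by rewrite [in RHS]mulrBr -h; ring.
Qed.

Lemma rho_gap_mono (L0 : R) : rho < L0 -> exists2 eta, 0 < eta &
  forall L, L0 <= L -> eta <= L - 2 + L ^- n.
Proof.
move=> hL0; pose h x := 1 - \sum_(i < n) x ^- i.+1 : R.
have hinv x y : 0 < x -> x <= y -> h x <= h y.
  move=> x0 xy; have y0 : 0 < y by exact: lt_le_trans xy.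
  rewrite lerD2l lerN2; apply: ler_sum => i _.
  by rewrite lef_pV2 ?posrE ?exprn_gt0// ler_pXn2r// nnegrE ltW.
have r0 : 0 < rho by exact: lt_trans rho1.
have h_rho : h rho = 0.
  have := rho_gap r0; have := rho_mul hrho => e1.
  have e2 : rho ^- n = 2 - rho.
    have rn : rho ^+ n != 0 by rewrite expf_neq0// gt_eqF.
    by apply: (mulIf rn); rewrite e1 mulVf.
  rewrite e2 (_ : rho - 2 + (2 - rho) = 0); last by ring.
  by move/esym/eqP; rewrite mulf_eq0 subr_eq0 gt_eqF//= => /eqP.
have hpos : 0 < h L0.
  have L00 : 0 < L0 by exact: lt_trans hL0.
  rewrite -h_rho ltrD2l ltrN2 (bigD1 (Ordinal n0))//= [X in _ < X](bigD1 (Ordinal n0))//=.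
  rewrite ltr_leD ?expr1 ?ltf_pV2 ?posrE//; apply: ler_sum => i _.
  rewrite lef_pV2 ?posrE ?exprn_gt0// ler_pXn2r// ?nnegrE ?(ltW hL0) ?(ltW r0) ?(ltW L00)//.
have L01 : 1 < L0 := lt_trans rho1 hL0.
exists ((L0 - 1) * h L0); first by rewrite mulr_gt0//; lra.
move=> L hL; rewrite rho_gap; last by lra.
by apply: ler_pM; rewrite ?(ltW hpos)//; [lra|lra|apply: hinv => //; lra].
Qed.

(* If an exponent [x >= L] is admissible, then so is [2 - x ^- n + eta / 2], which is at most
   [x - eta / 2] because [x - 2 + x ^- n >= eta] beyond [L]. *)
Lemma ratio_le (s : nat -> R) (c L : R) : (forall i, 0 <= s i) ->
  (forall i j, (j <= i)%N -> s j <= s i) ->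
  (forall M, exists I, forall i, (I <= i)%N -> M <= s i) ->
  (exists I, forall i, (I <= i)%N -> s (i + n.+1)%N + s i <= 2 * s (i + n)%N + c) ->
  rho < L -> exists I, forall i, (I <= i)%N -> s i.+1 <= L * s i.
Proof.
move=> s_ge mono inf [I0 hI0] hL.
have [eta eta0 heta] := rho_gap_mono hL.
pose P x := exists I, forall i, (I <= i)%N -> s i.+1 <= x * s i.
have Pup x y : x <= y -> P x -> P y.
  by move=> xy [I hI]; exists I => i Ii; apply: le_trans (hI i Ii) _; rewrite ler_wpM2r.
have shift i : (I0 + n <= i)%N -> exists2 j, i = (j + n)%N & (I0 <= j)%N.
  by move=> h; exists (i - n)%N; lia.
have P3 : P 3.
  have [I hI] := inf c; exists (maxn I (I0 + n)) => i; rewrite geq_max => /andP[Ii /shift[j ej Ij]].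
  by have := hI0 j Ij; have := s_ge j; have := hI i Ii; rewrite addnS -ej; lra.
have Pstep x : L <= x -> P x -> P (x - eta / 2).
  move=> Lx [I hI]; have x0 : 0 < x by apply: lt_le_trans Lx; apply: lt_trans hL; exact: lt_trans rho1.
  have xi m i : (I <= i)%N -> s (i + m)%N <= x ^+ m * s i.
    move=> Ii; elim: m => [|m IH]; first by rewrite addn0 mul1r.
    rewrite addnS exprS -mulrA; apply: le_trans (hI _ (leq_trans Ii (leq_addr _ _))) _.
    by rewrite ler_wpM2l// ltW.
  have [J hJ] := inf (c / (eta / 2)).
  exists (maxn J (I + I0 + n)) => i; rewrite geq_max => /andP[Ji hi].
  have [|j ej Ij] := shift i; first by lia.
  have h1 := hI0 j Ij; rewrite addnS -ej in h1.
  have h2 : s i * x ^- n <= s j.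
    by rewrite ler_pdivrMr ?exprn_gt0// mulrC ej; apply: xi; lia.
  have h3 : c <= s i * (eta / 2) by rewrite -ler_pdivrMr; [exact: hJ|lra].
  have h4 : eta * s i <= (x - 2 + x ^- n) * s i by rewrite ler_wpM2r// heta.
  by move: h1 h2 h3 h4; lra.
(* Starting from the crude ratio 3, each step lowers the ratio by [eta / 2] until [L] is reached. *)
have Piter k : P L \/ P (3 - k%:R * (eta / 2)).
  elim: k => [|k [IH|IH]]; [by right; rewrite mul0r subr0|by left|].
  case: (lerP L (3 - k%:R * (eta / 2))) => h; last by left; apply: Pup IH; exact: ltW.
  by right; have := Pstep _ h IH; congr P; rewrite -natr1; lra.
have e2 : 0 < eta / 2 by lra.
have [//|h] := Piter (Num.truncn (3 / (eta / 2))).+1.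
apply: Pup h; have : 3 / (eta / 2) < (Num.truncn (3 / (eta / 2))).+1%:R by rewrite truncnS_gt.
have L1 : 1 < L by exact: lt_trans hL.
rewrite ltr_pdivrMr// => hk; rewrite lerBlDr; apply: le_trans (ltW hk) _.
by rewrite lerDr ltW// (lt_trans ltr01).
Qed.

End Ratio.

Lemma unif_of_seq (R : realType) (n : nat) (v : 'rV[R]_n.+1) (l : R) (z : nat -> 'rV[int]_n.+1) (T : nat -> R) :
  0 <= l -> (forall i, z i != 0) -> (forall M, exists I, forall i, (I <= i)%N -> M <= T i) ->
  (exists I, forall i, (I <= i)%N -> `|map_mx intr (z i) : 'rV[R]_n.+1| <= expR (T i) /\
     exists t, `|map_mx intr (z i) - t *: v| <= expR (- (l * T i.+1))) -> unif v l.
Proof.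
move=> l0 z0 inf [I hI]; exists (T I) => X hX.
have [J hJ] := inf (X + 1).
have ex : exists k, X < T (I + k).+1.
  by exists J; apply: lt_le_trans (hJ (I + J).+1 _); [lra|lia].
have [k hk hmin] := ex_minnP ex.
have hk2 : T (I + k)%N <= X.
  case: k hk hmin => [|k] hk hmin; first by rewrite addn0.
  rewrite leNgt; apply/negP => h; have := hmin k; rewrite -addnS h => /(_ isT); lia.
have [h1 [t h2]] := hI (I + k)%N (leq_addr _ _).
exists (z (I + k)%N), t; split => //; first by apply: le_trans h1 _; rewrite ler_expR.
apply: le_trans h2 _; rewrite ler_expR lerN2; apply: ler_wpM2l => //; exact: ltW.
Qed.

(** * Existence of extremal points *)

Lemma lnX2 (R : realType) (x : R) : 0 < x -> ln (x ^+ 2) = 2 * ln x.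
Proof. by move=> x0; rewrite lnXn// mulr_natl. Qed.

Definition reflv_mx (K : comNzRingType) (m : nat) (S : 'M[K]_m) (w : 'rV[K]_m) : 'M[K]_m :=
  2 *: ((S *m w^T) *m w) - (bf S w w)%:M.

Lemma reflv_mxE (K : comNzRingType) (m : nat) (S : 'M[K]_m) (w x : 'rV[K]_m) : S^T = S ->
  x *m reflv_mx S w = reflv S w x.
Proof.
move=> ST; rewrite /reflv_mx mulmxBr -scalemxAr mul_mx_scalar !mulmxA /reflv; congr (_ - _).
rewrite (bfC w x ST) -scalerA; congr (_ *: _); rewrite /bf.
by rewrite {1}[x *m S *m w^T]mx11_scalar mul_scalar_mx.
Qed.

Lemma bf_combine (K : comNzRingType) (m : nat) (S : 'M[K]_m) (x : K) (e z : 'rV[K]_m) : S^T = S ->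
  bf S (x *: e + z) (x *: e + z) = x ^+ 2 * bf S e e + 2 * x * bf S e z + bf S z z.
Proof. by move=> ST; rewrite !bfE (bfC z e ST); ring. Qed.

Lemma int_scaler_eq0 (m p : nat) (c : int) (x : 'M[int]_(m, p)) : c != 0 -> c *: x = 0 -> x = 0.
Proof.
move=> c0 h; apply/matrixP => i j; move/matrixP: h => /(_ i j); rewrite !mxE => /eqP.
by rewrite mulf_eq0 (negPf c0) => /eqP.
Qed.

Lemma quadratic_neq0 (a b c k : int) : a != 0 -> 2 * `|b| + `|c| + 1 <= k ->
  k ^+ 2 * a + 2 * k * b + c != 0.
Proof.
move=> a0 hk; have a1 : 1 <= `|a| by rewrite -gtz0_ge1 normr_gt0.
have k1 : 1 <= k by lia.
have h1 : k * k <= k * k * `|a| by rewrite ler_peMr// mulr_ge0; lia.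
have h2 : (2 * `|b| + `|c| + 1) * k <= k * k by rewrite ler_wpM2r//; lia.
have h5 : (2 * `|b| + `|c| + 1) * k = 2 * (k * `|b|) + `|c| * k + k by ring.
have h4 : `|c| * 1 <= `|c| * k by rewrite ler_wpM2l.
have h6 : `|k ^+ 2 * a| = k * k * `|a| by rewrite normrM expr2 normrM ger0_norm//; lia.
have h7 : `|2 * k * b| = 2 * (k * `|b|) by rewrite !normrM (ger0_norm (_ : 0 <= k)) ?mulrA//; lia.
rewrite h5 in h2; apply/eqP => h; move: k1 h1 h2 h4 h6 h7 h; clear.
move: (k ^+ 2 * a) (2 * k * b) (k * k * `|a|) (k * k) (k * `|b|) (`|c| * k) => *; lia.
Qed.

Section Existence.
Context (R : realType) (n : nat) (S : 'M[int]_n.+1) (rho : R).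
Hypotheses (n1 : (1 < n)%N) (ST : S^T = S) (S0 : S != 0).
Hypotheses (rho1 : 1 < rho) (rho2 : rho < 2) (hrho : root (rho_poly R n) rho).
Local Notation iv x := (map_mx intr x : 'rV[R]_n.+1).

Definition extremal (v : 'rV[R]_n.+1) : Prop :=
  [/\ Q_independent v, bf (map_mx intr S) v v = 0 & forall l, l < rho^-1 -> unif v l].

Lemma extremal_exists (v : 'rV[R]_n.+1) : Q_independent v -> bf (map_mx intr S) v v = 0 ->
  exists xi, extremal xi.
Proof.
move=> li Qv; have n0 : (0 < n)%N by exact: ltnW.
have [e a0] := bf_nonzero ST S0.
have [s [s1 s2 s3 s4 s5]] := seeds_exist li ST Qv a0.
have [xi [A [C [bt [[A0 C0 Qxi lixi] [b1 bmono binf] happ hgrow]]]]] :=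
  limit_facts R ST a0 s1 s3 s4 s5 n0.
set r := continued S e s in happ.
have r_neq0 i : r i != 0 by exact: (continued_neq0 ST a0 s1).
have b0 i : 0 < bt i by exact: lt_le_trans (b1 i).
exists xi; split => // l hl.
apply: (@unif_le _ _ _ (Num.max l 0)); first by rewrite le_max lexx.
have {hl} : Num.max l 0 < rho^-1 by rewrite gt_max hl invr_gt0 (lt_trans ltr01).
have : 0 <= Num.max l 0 by rewrite le_max lexx orbT.
move: (Num.max l 0) => {}l l0 hl.
pose s' i := ln (bt i).
have s'_ge i : 0 <= s' i by exact: ln_ge0.
have s'_mono i j : (j <= i)%N -> s' j <= s' i.
  by move=> ji; rewrite ler_ln ?posrE//; exact: bmono.
have s'_inf M : exists I, forall i, (I <= i)%N -> M <= s' i.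
  have [I hI] := binf (expR M); exists I => i Ii; rewrite -ler_expR lnK ?posrE//; exact: hI.
have s'_rec : exists I, forall i, (I <= i)%N -> s' (i + n.+1)%N + s' i <= 2 * s' (i + n)%N + ln C.
  exists n => i ni; rewrite -lnX2// -lnM ?posrE// -lnM ?posrE ?exprn_gt0//.
  by rewrite ler_ln ?posrE ?mulr_gt0 ?exprn_gt0// mulrC [leRHS]mulrC mulrC; exact: hgrow.
have r0 : 0 < rho by exact: lt_trans rho1.
have lrho : l * rho < 1 by rewrite -ltr_pdivlMr// div1r.
(* A ratio above [rho], as [ratio_le] requires, but still with [l * L < 1] because [l < 1]; the
   remaining room absorbs the constants. *)
pose L := rho + (1 - l * rho) / 2.
have hL : rho < L by rewrite ltrDl divr_gt0// subr_gt0.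
have lL : l * L < 1.
  have l1 : l < 1 by apply: lt_trans hl _; rewrite invf_lt1.
  have : l * (1 - l * rho) <= 1 * (1 - l * rho) by rewrite ler_wpM2r// ?(ltW l1)// subr_ge0 ltW.
  have -> : l * L = l * rho + l * (1 - l * rho) / 2 by rewrite /L; ring.
  by lra.
have [I hI] := ratio_le n0 rho1 rho2 hrho s'_ge s'_mono s'_inf s'_rec hL.
apply: (@unif_of_seq _ _ _ _ r (fun i => ln C + s' i)) => //.
  move=> M; have [J hJ] := s'_inf (M - ln C); exists J => i Ji; have := hJ i Ji; lra.
have [J hJ] := s'_inf ((ln A + l * ln C) / (1 - l * L)).
exists (maxn n (maxn I J)) => i; rewrite !geq_max => /and3P[ni Ii Ji].
have [[t ht] hr] := happ i ni; split; first by rewrite expRD !lnK ?posrE.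
exists t; apply: le_trans ht _.
rewrite (_ : A / bt i = expR (ln A - s' i)); last by rewrite expRD expRN !lnK ?posrE.
rewrite ler_expR; have := hJ i Ji; rewrite ler_pdivrMr ?subr_gt0// => h1.
have h2 : l * s' i.+1 <= l * (L * s' i) by rewrite ler_wpM2l//; exact: hI.
by move: h1 h2; lra.
Qed.

(** The reflection is an integral map whose square is a non-zero scalar, so it preserves
    independence, and it changes norms and distances by bounded factors only. *)
Lemma extremal_reflv (w : 'rV[int]_n.+1) (v : 'rV[R]_n.+1) : bf S w w != 0 -> extremal v ->
  extremal (reflv (map_mx intr S) (iv w) v).
Proof.
move=> w0 [li Qv hu].
have STR : (map_mx intr S : 'M[R]_n.+1)^T = map_mx intr S by rewrite map_trmx ST.
have wR : bf (map_mx intr S) (iv w) (iv w) != 0 by rewrite bf_map intr_eq0.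
have reflD c x y : reflv (map_mx intr S) (iv w) (x - c *: y) =
    reflv (map_mx intr S) (iv w) x - c *: reflv (map_mx intr S) (iv w) y.
  by rewrite /reflv !bfE; apply/rowP => i; rewrite !mxE; ring.
split.
- apply/Q_independentP => l hl.
  have hM : map_mx intr (reflv_mx S w) = reflv_mx (map_mx intr S) (iv w) :> 'M[R]_n.+1.
    rewrite /reflv_mx map_mxB map_mxZ !map_mxM /= map_scalar_mx -bf_map -map_trmx.
    by rewrite (_ : 2%:~R = 2).
  have l0 : reflv_mx S w *m l = 0.
    move/Q_independentP: li; apply; rewrite map_mxM /= mulmxA hM reflv_mxE//.
  have : (bf S w w ^+ 2) *: l = 0.
    suff e : reflv_mx S w *m reflv_mx S w = (bf S w w ^+ 2)%:M.
      by rewrite -mul_scalar_mx -e -mulmxA l0 mulmx0.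
    apply/row_matrixP => i; rewrite matrix.rowE mulmxA !reflv_mxE// reflvK [RHS]matrix.rowE.
    by rewrite mul_mx_scalar.
  by apply: int_scaler_eq0; rewrite expf_neq0.
- have -> : bf (map_mx intr S) (reflv (map_mx intr S) (iv w) v) (reflv (map_mx intr S) (iv w) v) =
    bf (map_mx intr S) (iv w) (iv w) ^+ 2 * bf (map_mx intr S) v v.
    by rewrite /reflv !bfE (bfC v (iv w) STR); ring.
  by rewrite Qv mulr0.
- move=> l hl; pose l' := (l + rho^-1) / 2.
  have [T0 hT0] : unif v l' by apply: hu; rewrite /l'; lra.
  have [C C0 hC] := bf_bound (map_mx intr S : 'M[R]_n.+1).
  pose K := 2 * C * `|iv w| ^+ 2 + `|bf (map_mx intr S) (iv w) (iv w)| + 1.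
  have K0 : 0 < K by rewrite ltr_wpDl// addr_ge0// mulr_ge0 ?sqr_ge0// mulr_ge0// ltW.
  have hK y : `|reflv (map_mx intr S) (iv w) y| <= K * `|y|.
    rewrite /reflv; apply: le_trans (ler_normB _ _) _; rewrite !normrZ.
    rewrite [`|2|](ger0_norm (ler0n R 2)).
    have := hC (iv w) y; have := normr_ge0 y; have := normr_ge0 (iv w) => y0 w0' h.
    have : `|bf (map_mx intr S) (iv w) y| * `|iv w| <= C * `|iv w| * `|y| * `|iv w| by rewrite ler_wpM2r.
    by rewrite /K expr2; lra.
  pose D := ln K; pose e := l' - l; have e0 : 0 < e by rewrite /e /l'; lra.
  exists (Num.max (T0 + D) ((D + l' * D) / e)) => T; rewrite ge_max => /andP[T1 T2].
  have [|x [t [x0 h1 h2]]] := hT0 (T - D); first by lra.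
  have xr : iv (reflv S w x) = reflv (map_mx intr S) (iv w) (iv x) by rewrite reflv_map.
  exists (reflv S w x), t; split.
  + apply: contra_neq x0 => h; have := reflvK S w x.
    rewrite h /reflv bf0r mulr0 scale0r scaler0 subr0 => /esym.
    by apply: int_scaler_eq0; rewrite expf_neq0.
  + rewrite xr; apply: le_trans (hK _) _; apply: le_trans (ler_wpM2l (ltW K0) h1) _.
    by rewrite expRD expRN lnK ?posrE// mulrC divfK// gt_eqF.
  + rewrite xr -reflD; apply: le_trans (hK _) _; apply: le_trans (ler_wpM2l (ltW K0) h2) _.
    rewrite -{1}(lnK K0) -expRD ler_expR -/D.
    by move: T2; rewrite ler_pdivrMr// /e; lra.
Qed.

(** Proportional images would make [w] and [w'] proportional or put [v] in their plane. In the
    latter case the vector product of [w] and [w'] in the coordinates [i], [j], [k] is an integral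
    form vanishing at [v], with the non-zero minor as its coefficient at [k]. *)
Lemma reflv_independent (w w' : 'rV[int]_n.+1) (v : 'rV[R]_n.+1) c (i j k : 'I_n.+1) : k != i -> k != j ->
  Q_independent v -> bf S w w != 0 -> w 0 i * w' 0 j - w 0 j * w' 0 i != 0 ->
  reflv (map_mx intr S) (iv w) v <> c *: reflv (map_mx intr S) (iv w') v.
Proof.
move=> ki kj li w0 m0; rewrite /reflv scalerBr !scalerA.
set al := 2 * bf _ (iv w) v; set q := bf _ (iv w) (iv w).
set al' := c * _; set q' := c * _ => h.
have hc x : al * (w 0 x)%:~R - q * v 0 x = al' * (w' 0 x)%:~R - q' * v 0 x.
  by move/rowP: h => /(_ x); rewrite !mxE.
have al0 : al != 0.
  rewrite mulf_neq0 ?pnatr_eq0//; apply/eqP => h0.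
  have Sw : S *m w^T = 0.
    move/Q_independentP: li; apply; apply/matrixP => x y; rewrite !ord1 [RHS]mxE map_mxM /= -map_trmx mulmxA.
    by move: h0; rewrite (bfC (iv w)) /bf// map_trmx ST.
  by case/eqP: w0; rewrite /bf -mulmxA Sw mulmx0 mxE.
have [qq|qq] := eqVneq q' q.
  have e x : al * (w 0 x)%:~R = al' * (w' 0 x)%:~R by have := hc x; rewrite qq; lra.
  have : al * (w 0 i * w' 0 j - w 0 j * w' 0 i)%:~R = 0.
    rewrite intrB !intrM mulrBr !mulrA !e; ring.
  by move/eqP; rewrite mulf_eq0 (negPf al0) intr_eq0 (negPf m0).
pose X := w 0 j * w' 0 k - w 0 k * w' 0 j; pose Y := w 0 k * w' 0 i - w 0 i * w' 0 k.
pose m := w 0 i * w' 0 j - w 0 j * w' 0 i.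
pose l : 'cV[int]_n.+1 := X *: delta_mx i 0 + Y *: delta_mx j 0 + m *: delta_mx k 0.
have vl : v *m map_mx intr l = 0.
  apply/matrixP => x y; rewrite !ord1 [RHS]mxE /l !map_mxD !map_mxZ !map_delta_mx.
  rewrite !mulmxDr -!scalemxAr -!matrix.colE !mxE.
  apply: (mulfI (_ : q' - q != 0)); first by rewrite subr_eq0.
  have e x' : (q' - q) * v 0 x' = al' * (w' 0 x')%:~R - al * (w 0 x')%:~R by have := hc x'; lra.
  have -> a1 a2 a3 b1 b2 b3 : (q' - q) * (a1 * b1 + a2 * b2 + a3 * b3) =
    a1 * ((q' - q) * b1) + a2 * ((q' - q) * b2) + a3 * ((q' - q) * b3) by ring.
  by rewrite !e /X /Y /m !rmorphB !rmorphM /=; ring.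
have lk : l = 0 by move/Q_independentP: li; apply.
case/eqP: m0; move/matrixP: lk => /(_ k 0).
by rewrite !mxE (negPf ki) (negPf kj) !eqxx /= !mulr0 !add0r mulr1.
Qed.

Lemma extremal_infinite (v : 'rV[R]_n.+1) : extremal v -> exists f : nat -> 'rV[R]_n.+1,
  (forall k, extremal (f k)) /\ (forall k k' c, k != k' -> f k <> c *: f k').
Proof.
move=> hv; have [li _ _] := hv; have [e a0] := bf_nonzero ST S0.
have [i ei] : exists i, e 0 i != 0.
  apply: contrapT => /forallNP h; case/eqP: a0; suff -> : e = 0 by rewrite bf0l.
  by apply/rowP => i; rewrite mxE; apply/eqP/negPn/negP => hi; exact: (h i).
have [j [k [ji ki kj]]] : exists j k, [/\ j != i, k != i & k != j].
  have n0 : (0 < n)%N by exact: ltnW.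
  exists (lift i (Ordinal n0)), (lift i (Ordinal n1)).
  by rewrite ![lift _ _ == i]eq_sym !neq_lift (inj_eq (@lift_inj _ _)).
pose z : 'rV[int]_n.+1 := delta_mx 0 j.
(* From [K] on, the leading term keeps the form non-zero at [w k], by [quadratic_neq0]. *)
have [K hK] : exists K, 2 * `|bf S e z| + `|bf S z z| + 1 <= K by eexists; exact: lexx.
pose w k : 'rV[int]_n.+1 := (K + k%:Z) *: e + z.
have w0 m : bf S (w m) (w m) != 0.
  have -> : bf S (w m) (w m) = (K + m%:Z) ^+ 2 * bf S e e + 2 * (K + m%:Z) * bf S e z + bf S z z.
    exact: bf_combine.
  by apply: quadratic_neq0 => //; apply: le_trans hK _; rewrite lerDl.
exists (fun m => reflv (map_mx intr S) (iv (w m)) v); split.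
  by move=> m; exact: extremal_reflv.
move=> m m' c mm; apply: (reflv_independent ki kj) => //.
rewrite /w !mxE !eqxx (eq_sym i j) (negPf ji) /= !addr0.
have -> : (K + m%:Z) * e 0 i * ((K + m'%:Z) * e 0 j + 1) - ((K + m%:Z) * e 0 j + 1) * ((K + m'%:Z) * e 0 i)
  = (m%:Z - m'%:Z) * e 0 i by ring.
by rewrite mulf_neq0// subr_eq0 eqz_nat.
Qed.

End Existence.

(** * Witt index at least two *)

Definition hyperbolic_quadruple (n : nat) (S : 'M[int]_n) (e1 f1 e2 f2 : 'rV[int]_n) : Prop :=
  [/\ bf S e1 e1 = 0, bf S f1 f1 = 0, bf S e2 e2 = 0 & bf S f2 f2 = 0] /\
  [/\ bf S e1 f1 != 0, bf S e2 f2 != 0, bf S e1 e2 = 0 & bf S e1 f2 = 0] /\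
  bf S f1 e2 = 0 /\ bf S f1 f2 = 0.

Definition admissible (n : nat) (S : 'M[int]_n) (x y : 'rV[int]_n) : Prop :=
  bf S y y = 0 /\ bf S x y = 0.

Section Steps.
Context (n : nat) (S : 'M[int]_n.+1) (ST : S^T = S).
Local Notation B := (bf S).
Implicit Types x y z u : 'rV[int]_n.+1.
Implicit Types l : 'cV[int]_n.+1.

(** Multiples of [e1] correct [e2] and [f2] to be orthogonal to [x]; they remain isotropic since
    [e1] is isotropic and orthogonal to both. *)
Lemma admissible_pair_aux x e1 e2 f2 : B e1 e1 = 0 -> B e2 e2 = 0 -> B f2 f2 = 0 ->
  B e1 e2 = 0 -> B e1 f2 = 0 -> B e2 f2 != 0 -> B x e1 != 0 ->
  exists y u, [/\ admissible S x y, admissible S x u & B y u != 0].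
Proof.
move=> h1 h2 h3 h4 h5 h6 p1.
exists (B x e2 *: e1 - B x e1 *: e2), (B x e1 *: f2 - B x f2 *: e1).
rewrite /admissible !bfE (bfC e2 e1 ST) (bfC f2 e1 ST) h1 h2 h3 h4 h5.
split; [by split; ring|by split; ring|].
set t := (X in X != 0); have -> : t = - (B x e1 * (B x e1 * B e2 f2)) by rewrite /t; ring.
by rewrite oppr_eq0 !mulf_neq0.
Qed.

Lemma admissible_pair x e1 f1 e2 f2 : hyperbolic_quadruple S e1 f1 e2 f2 ->
  exists y u, [/\ admissible S x y, admissible S x u & B y u != 0].
Proof.
move=> [[e11 f11 e22 f22] [[ef1 ef2 ee ef] [fe ff]]].
have [xe1|] := eqVneq (B x e1) 0; last exact: (@admissible_pair_aux x e1 e2 f2).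
have [xf1|] := eqVneq (B x f1) 0; last exact: (@admissible_pair_aux x f1 e2 f2).
by exists e1, f1.
Qed.

(* [x] is orthogonal to the hyperbolic plane spanned by [y] and [u], so isotropic vectors span its
   orthogonal. *)
Lemma admissible_span x y u z l : admissible S x y -> admissible S x u -> B y u != 0 ->
  B x z = 0 -> (forall y', admissible S x y' -> y' *m l = 0) -> z *m l = 0.
Proof.
move=> [yy xy] [uu xu] yu xz h.
have [t bt] : exists t, B z y + t * B y u != 0.
  have [zy|zy] := eqVneq (B z y) 0; first by exists 1; rewrite zy add0r mul1r.
  by exists 0; rewrite mul0r addr0.
set b := B z y + t * B y u in bt; pose c := B z z + 2 * t * B z u.
have hy := h y (conj yy xy); have hu := h u (conj uu xu).
have : ((2 * b) *: z - c *: y + (2 * b * t) *: u) *m l = 0.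
  apply: h; split.
    have eb : b = B z y + t * B y u by []. have ec : c = B z z + 2 * t * B z u by [].
    clearbody b c.
    rewrite !bfE (bfC y z ST) (bfC u z ST) (bfC u y ST) yy uu.
    have -> : B z z = c - 2 * t * B z u by rewrite ec; ring.
    have -> : B z y = b - t * B y u by rewrite eb; ring.
    by ring.
  by clearbody b c; rewrite !bfE xy xu xz; ring.
rewrite !mulmxDl mulNmx -!scalemxAl hy hu !scaler0 oppr0 !addr0 => /int_scaler_eq0; apply.
by rewrite mulf_neq0.
Qed.

(** All admissible vectors at [x] may be killed by [l], so two steps can be necessary. If those at
    [N *: x + y] were killed too, then by [admissible_span] so would be its orthogonal hyperplane,
    and also the vector [u] outside this hyperplane; then [l] would be 0. *)
Lemma step_exists x l e1 f1 e2 f2 : hyperbolic_quadruple S e1 f1 e2 f2 -> l != 0 ->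
  exists y, [/\ admissible S x y,
    (exists2 y', admissible S x y' & y' *m l != 0) -> y *m l != 0 &
    y *m l = 0 -> forall N, exists2 y', admissible S (N *: x + y) y' & y' *m l != 0].
Proof.
move=> hq l0; have [[y xy yl]|hno] := pselect (exists2 y', admissible S x y' & y' *m l != 0).
  by exists y; split => // yl0; rewrite yl0 eqxx in yl.
have vanish x' : ~ (exists2 y', admissible S x' y' & y' *m l != 0) ->
    forall y', admissible S x' y' -> y' *m l = 0.
  by move=> h y' hy'; apply/eqP/negPn/negP => hl; apply: h; exists y'.
have [y [u [hy hu yu]]] := admissible_pair x hq.
exists y; split => // _ N; apply: contrapT => hno'.
have [y' [u' [hy' hu' yu']]] := admissible_pair (N *: x + y) hq.
have ul : u *m l = 0 by apply: vanish hno _ hu.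
have xu : B (N *: x + y) u = B y u by rewrite bfDl bfZl hu.2 mulr0 add0r.
case/eqP: l0; apply/matrixP => i j; rewrite !ord1 [RHS]mxE.
pose z : 'rV[int]_n.+1 := delta_mx 0 i.
have hz : (B y u *: z - B (N *: x + y) z *: u) *m l = 0.
  apply: (admissible_span hy' hu' yu') (vanish _ hno').
  by rewrite bfDr bfNr !bfZr xu mulrC subrr.
move: hz; rewrite mulmxBl -!scalemxAl ul scaler0 subr0 => /int_scaler_eq0 -/(_ yu).
by rewrite -matrix.rowE => /rowP/(_ 0); rewrite !mxE.
Qed.

End Steps.

(** * Walks with large multipliers and their limits *)

Section Walk.
Context (R : realType) (n : nat) (x0 : 'rV[int]_n.+1) (y : nat -> 'rV[int]_n.+1 -> 'rV[int]_n.+1)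
  (W : nat -> 'rV[int]_n.+1 -> R).
Local Notation iv x := (map_mx intr x : 'rV[R]_n.+1).

Definition multiplier i x : nat := (Num.truncn (W i x)).+1.

Fixpoint walk i : 'rV[int]_n.+1 :=
  if i is i'.+1 then (multiplier i' (walk i'))%:Z *: walk i' + y i' (walk i') else x0.

Definition step_size i x : R := Num.max 1 `|iv (y i x)|.

Hypothesis W_ge : forall i x, 2 * step_size i x <= W i x.

Lemma multiplier_gt i x : W i x < (multiplier i x)%:R.
Proof. by rewrite /multiplier truncnS_gt. Qed.

Lemma step_size_ge1 i x : 1 <= step_size i x.
Proof. by rewrite le_max lexx. Qed.

(** Divided by the product [P] of the earlier multipliers, the walk becomes a series with terms
    [y i / P i.+1]. The factor 2 in [W_ge] makes each bound cover the next term together with the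
    next bound. *)
Lemma walk_limit : exists xi : 'rV[R]_n.+1, forall i, exists2 P : R, 1 <= P &
  `|iv (walk i) - P *: xi| <= 2 * step_size i (walk i) / (multiplier i (walk i))%:R.
Proof.
pose P i : R := \prod_(j < i) (multiplier j (walk j))%:R.
have PS i : P i.+1 = P i * (multiplier i (walk i))%:R by rewrite /P big_ord_recr.
have F1 i : 1 <= (multiplier i (walk i))%:R :> R by rewrite ler1n.
have P1 i : 1 <= P i.
  by elim: i => [|i IH]; [rewrite /P big_ord0|rewrite PS -[leLHS]mulr1 ler_pM].
have P0 i : 0 < P i by exact: lt_le_trans (P1 i).
have F0 i : 0 < (multiplier i (walk i))%:R :> R by rewrite ltr0n.
have s1 i := step_size_ge1 i (walk i).
have coord k : exists l, forall i, `|iv (walk i) 0 k / P i - l| <= 2 * step_size i (walk i) / P i.+1.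
  apply: nested_limit => i; last by rewrite divr_ge0 ?(ltW (P0 _))// mulr_ge0// (le_trans ler01).
  have f0 : (multiplier i (walk i))%:R != 0 :> R by rewrite gt_eqF.
  have p0 : P i != 0 by rewrite gt_eqF.
  have -> : iv (walk i.+1) 0 k / P i.+1 - iv (walk i) 0 k / P i = iv (y i (walk i)) 0 k / P i.+1.
    rewrite PS /= !mxE rmorphD rmorphM /=; move: (multiplier i (walk i)) f0 => N f0.
    by rewrite -[_%:~R]/(N%:R : R); field; rewrite f0 p0.
  rewrite normrM normfV (gtr0_norm (P0 _)).
  have h1 : `|iv (y i (walk i)) 0 k| / P i.+1 <= step_size i (walk i) / P i.+1.
    rewrite ler_pM2r ?invr_gt0//; apply: le_trans (norm_coord _ _) _.
    by rewrite le_max lexx orbT.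
  have h2 : 2 * step_size i.+1 (walk i.+1) / P i.+2 <= 1 / P i.+1.
    rewrite [P i.+2]PS invfM mulrA [_ / P i.+1 / _]mulrAC ler_pM2r ?invr_gt0//.
    rewrite ler_pdivrMr// mul1r; apply: le_trans (W_ge _ _) _; exact: ltW (multiplier_gt _ _).
  have h3 : 1 / P i.+1 <= step_size i (walk i) / P i.+1 by rewrite ler_pM2r ?invr_gt0.
  by move: h1 h2 h3; rewrite -mulrA; lra.
have [l hl] := choice coord.
exists (\row_k l k) => i; exists (P i) => //.
apply: norm_le_coord => k; rewrite !mxE; have := hl k i; rewrite mxE => h.
have p0 : P i != 0 by rewrite gt_eqF.
have -> : (walk i 0 k)%:~R - P i * l k = P i * ((walk i 0 k)%:~R / P i - l k) by field.
rewrite normrM (gtr0_norm (P0 _)); apply: le_trans (ler_wpM2l (ltW (P0 _)) h) _.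
rewrite PS invfM mulrA mulrC mulrA mulrA [_^-1 * _ in leLHS]mulrC.
by rewrite -[leLHS]mulrA -[leLHS]mulrA; rewrite le_eqVlt; apply/orP; left; apply/eqP; field; rewrite p0 gt_eqF.
Qed.

Lemma walk_neq0 i : x0 != 0 -> walk i != 0.
Proof.
move=> h0; elim: i => // i IH /=; apply/eqP => h.
have e : iv (y i (walk i)) = - ((multiplier i (walk i))%:R *: iv (walk i)).
  apply/eqP; rewrite -addr_eq0 addrC -[_%:R *: _](map_mxZ intr (multiplier i (walk i))%:Z) -map_mxD h.
  by rewrite map_mx0.
have := norm_iv_ge1 R IH; have := multiplier_gt i (walk i); have := W_ge i (walk i).
have : `|iv (y i (walk i))| <= step_size i (walk i) by rewrite le_max lexx orbT.
rewrite e normrN normrZ ger0_norm//.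
have := step_size_ge1 i (walk i).
set N : R := _%:R; set s := step_size _ _; set w := W _ _ => s1 h1 h2 h3 h4.
have : N * 1 <= N * `|iv (walk i)| by rewrite ler_wpM2l// ler0n.
by lra.
Qed.

Lemma walk_norm i : `|iv (walk i.+1)| <=
  (multiplier i (walk i))%:R * (`|iv (walk i)| + step_size i (walk i)).
Proof.
rewrite /= map_mxD map_mxZ; apply: le_trans (ler_normD _ _) _; rewrite normrZ mulrDr.
apply: lerD; first by rewrite -intr_norm.
apply: le_trans (_ : step_size i (walk i) <= _); first by rewrite le_max lexx orbT.
by rewrite ler_peMl ?ler1n// (le_trans ler01)// step_size_ge1.
Qed.

End Walk.

Lemma witt_quadruple (n : nat) (q : mpoly.mpoly n.+1 rat) (S : 'M[int]_n.+1) (k : rat) (m : nat) :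
  S^T = S -> k != 0 -> (forall x, qval q x = k * bf (map_mx intr S) x x) ->
  is_witt_index q m -> (1 < m)%N -> exists e1 f1 e2 f2, hyperbolic_quadruple S e1 f1 e2 f2.
Proof.
move=> ST k0 hq [K [H [W [[_ hH _] [[_ _ hHH _] _]]]]] m1.
have STQ : (map_mx intr S : 'M[rat]_n.+1)^T = map_mx intr S by rewrite map_trmx ST.
have k2 : 2 * k != 0 by rewrite mulf_neq0.
pose i1 := Ordinal (ltnW m1); pose i2 := Ordinal m1.
have [x1 [y1 [b1 qx1 qy1 xy1]]] := hH i1; have [x2 [y2 [b2 qx2 qy2 xy2]]] := hH i2.
have z2 x : qval q x = 0 -> bf (map_mx intr S) x x = 0.
  by rewrite hq => /eqP; rewrite mulf_eq0 (negPf k0) => /eqP.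
have mx1 : x1 \in H i1 by apply: (basis_mem b1); rewrite mem_head.
have my1 : y1 \in H i1 by apply: (basis_mem b1); rewrite !inE eqxx orbT.
have mx2 : x2 \in H i2 by apply: (basis_mem b2); rewrite mem_head.
have my2 : y2 \in H i2 by apply: (basis_mem b2); rewrite !inE eqxx orbT.
have ort x y : x \in H i1 -> y \in H i2 -> bf (map_mx intr S) x y = 0.
  move=> hx hy; have : qbil q x y = 0 by exact: (hHH i1 i2).
  by rewrite (qbilE _ _ STQ hq) => /eqP; rewrite mulf_eq0 (negPf k2) => /eqP.
have nz x y : qbil q x y != 0 -> bf (map_mx intr S) x y != 0.
  by rewrite (qbilE _ _ STQ hq) mulf_eq0 negb_or => /andP[].
have [e1 [d1 [d10 E1]]] := int_scale x1; have [f1 [c1 [c10 F1]]] := int_scale y1.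
have [e2 [d2 [d20 E2]]] := int_scale x2; have [f2 [c2 [c20 F2]]] := int_scale y2.
have tr (u w : 'rV[int]_n.+1) (x y : 'rV[rat]_n.+1) (c d : int) : map_mx intr u = c%:~R *: x -> map_mx intr w = d%:~R *: y ->
    (bf S u w)%:~R = c%:~R * d%:~R * bf (map_mx intr S) x y :> rat.
  by move=> hu hw; rewrite -bf_map hu hw bfZl bfZr mulrA.
have tr0 (u w : 'rV[int]_n.+1) (x y : 'rV[rat]_n.+1) (c d : int) : map_mx intr u = c%:~R *: x -> map_mx intr w = d%:~R *: y ->
    bf (map_mx intr S) x y = 0 -> bf S u w = 0.
  by move=> hu hw h; apply/eqP; rewrite -(intr_eq0 rat) (tr _ _ _ _ _ _ hu hw) h mulr0.
have trn (u w : 'rV[int]_n.+1) (x y : 'rV[rat]_n.+1) (c d : int) : map_mx intr u = c%:~R *: x -> map_mx intr w = d%:~R *: y ->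
    c != 0 -> d != 0 -> bf (map_mx intr S) x y != 0 -> bf S u w != 0.
  by move=> hu hw hc hd h; rewrite -(intr_eq0 rat) (tr _ _ _ _ _ _ hu hw) !mulf_neq0// intr_eq0.
exists e1, f1, e2, f2; split; first by split; [exact: (tr0 _ _ _ _ _ _ E1 E1 (z2 _ qx1))|exact: (tr0 _ _ _ _ _ _ F1 F1 (z2 _ qy1))|
  exact: (tr0 _ _ _ _ _ _ E2 E2 (z2 _ qx2))|exact: (tr0 _ _ _ _ _ _ F2 F2 (z2 _ qy2))].
split; first split.
- exact: (trn _ _ _ _ _ _ E1 F1 d10 c10 (nz _ _ xy1)).
- exact: (trn _ _ _ _ _ _ E2 F2 d20 c20 (nz _ _ xy2)).
- exact: (tr0 _ _ _ _ _ _ E1 E2 (ort _ _ mx1 mx2)).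
- exact: (tr0 _ _ _ _ _ _ E1 F2 (ort _ _ mx1 my2)).
by split; [exact: (tr0 _ _ _ _ _ _ F1 E2 (ort _ _ my1 mx2))|exact: (tr0 _ _ _ _ _ _ F1 F2 (ort _ _ my1 my2))].
Qed.

Section Avoid.
Context (R : realType) (n : nat) (S : 'M[int]_n.+1) (e1 f1 e2 f2 : 'rV[int]_n.+1).
Hypotheses (n0 : (0 < n)%N) (ST : S^T = S) (hq : hyperbolic_quadruple S e1 f1 e2 f2).
Context (p : nat -> 'rV[R]_n.+1).
Hypotheses (p0 : forall j, p j 0 0 = 1) (pli : forall j, Q_independent (p j)).
Local Notation iv x := (map_mx intr x : 'rV[R]_n.+1).
Local Notation B := (bf S).

(* The [k]-th linear form is treated at steps [2k] and [2k+1]. As [p j] has independent coordinates, it is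
   not on the line of the integral point [walk j], so a small enough next step avoids it. *)
Lemma isotropic_avoiding : exists xi : 'rV[R]_n.+1,
  [/\ Q_independent xi, bf (map_mx intr S) xi xi = 0, forall l, l < 1 -> unif xi l &
    forall j c, xi <> c *: p j].
Proof.
(* Every integral column occurs as some [form k]; codes without a column give the zero form, for
   which the step is 0. *)
pose form k : 'cV[int]_n.+1 := odflt 0 (unpickle k).
have stepP (xl : 'rV[int]_n.+1 * 'cV[int]_n.+1) : exists y, [/\ admissible S xl.1 y,
    (exists2 y', admissible S xl.1 y' & y' *m xl.2 != 0) -> y *m xl.2 != 0 &
    xl.2 != 0 -> y *m xl.2 = 0 -> forall N, exists2 y', admissible S (N *: xl.1 + y) y' & y' *m xl.2 != 0].
  have [l0|l0] := eqVneq xl.2 0.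
    exists 0; split; first by split; rewrite ?bf0l ?bf0r.
      by case=> y' _; rewrite l0 mulmx0 eqxx.
    by move/eqP.
  by have [y [h1 h2 h3]] := step_exists ST xl.1 hq l0; exists y; split.
have [Y hY] := choice stepP.
pose y j x := Y (x, form j./2).
pose M := step_size R y.
have M1 j x : 1 <= M j x by exact: step_size_ge1.
have M0 j x : 0 < M j x by exact: lt_le_trans (M1 j x).
pose nrm (l : 'cV[int]_n.+1) : R := \sum_a `|l a 0|%:~R.
have nrm0 l : 0 <= nrm l by apply: sumr_ge0 => a _; rewrite ler0z.
pose de j x := dist (p j) x / (1 + `|p j|).
(* Each summand of [W] serves one purpose: [w2] makes the first forms smaller than 1 at the error
   vector, [w3] avoids [p j], [w4] prevents cancellation between [N *: x] and [y] under the current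
   form, [w5] drives the exponent to 1, [w6] makes the errors tend to 0 for the isotropy of the
   limit, and [w7] sends the norm bounds to infinity. *)
pose w2 j x := 2 * M j x * \sum_(k < j.+1) nrm (form k).
pose w3 j x := 2 * M j x / de j x.
pose w4 j x : R := `|(y j x *m form j./2) 0 0|%:~R.
pose w5 j x := expR (j.+2%:R * (ln (2 * M j x) + ln (`|iv x| + M j x))).
pose w6 j x := 2 * M j x * j%:R.
pose w7 j (x : 'rV[int]_n.+1) : R := expR j%:R.
pose W j x := 2 * M j x + w2 j x + w3 j x + w4 j x + w5 j x + w6 j x + w7 j x.
have M20 j x : 0 <= 2 * M j x by rewrite mulr_ge0// ltW.
have w2_ge j x : 0 <= w2 j x by rewrite mulr_ge0// sumr_ge0.
have w3_ge j x : 0 <= w3 j x by rewrite divr_ge0// divr_ge0 ?dist_ge0// addr_ge0.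
have w4_ge j x : 0 <= w4 j x by rewrite ler0z.
have w5_ge j x : 0 <= w5 j x by exact: expR_ge0.
have w6_ge j x : 0 <= w6 j x by rewrite mulr_ge0.
have w7_ge j x : 0 <= w7 j x by exact: expR_ge0.
have WE j x : [/\ [/\ 2 * M j x <= W j x, w2 j x <= W j x, w3 j x <= W j x & w4 j x <= W j x],
    w5 j x <= W j x, w6 j x <= W j x & w7 j x <= W j x].
  move: (M20 j x) (w2_ge j x) (w3_ge j x) (w4_ge j x) (w5_ge j x) (w6_ge j x) (w7_ge j x); rewrite /W.
  move: (2 * M j x) (w2 j x) (w3 j x) (w4 j x) (w5 j x) (w6 j x) (w7 j x) => a1 a2 a3 a4 a5 a6 a7 *.
  by split; [split| | |]; lra.
have W_ge j x : 2 * step_size R y j x <= W j x by have [[]] := WE j x.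
have [xi hxi] := walk_limit e1 W_ge.
set x := walk e1 y W in hxi.
pose N j : R := (multiplier W j (x j))%:R.
have NW j : W j (x j) < N j by exact: multiplier_gt.
have N0 j : 0 < N j by rewrite ltr0n.
pose D j := 2 * M j (x j) / N j.
have D0 j : 0 <= D j by rewrite divr_ge0// ltW.
have e10 : e1 != 0.
  have [_ [[ef _ _ _] _]] := hq; by apply: contraNneq ef => ->; rewrite bf0l.
have x0 j : x j != 0 by exact: walk_neq0.
have xS j : x j.+1 = (multiplier W j (x j))%:Z *: x j + y j (x j) by [].
have adm j : admissible S (x j) (y j (x j)) by have [] := hY (x j, form j./2).
have Qx j : B (x j) (x j) = 0.
  elim: j => [|j IH]; first by have [[]] := hq.
  have [h1 h2] := adm j; rewrite xS; move: (multiplier _ _ _)%:Z h1 h2; move: (y j (x j)) => z c h1 h2.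
  by rewrite bf_combine// IH h1 h2 !mulr0 !addr0.
have D6 j : D j * j%:R <= 1.
  rewrite /D mulrAC ler_pdivrMr// mul1r; have [_ _ h _] := WE j (x j).
  exact: le_trans h (ltW (NW j)).
have D2 j : D j * \sum_(k < j.+1) nrm (form k) < 1.
  rewrite /D mulrAC ltr_pdivrMr// mul1r; have [[_ h _ _] _ _ _] := WE j (x j).
  exact: le_lt_trans h (NW j).
have D3 j : D j < de j (x j).
  have de0 : 0 < de j (x j) by rewrite divr_gt0 ?ltr_pwDl// dist_gt0.
  rewrite /D ltr_pdivrMr// [ltRHS]mulrC -ltr_pdivrMr//; have [[_ _ h _] _ _ _] := WE j (x j).
  exact: le_lt_trans h (NW j).
have N4 j : `|(y j (x j) *m form j./2) 0 0|%:~R < N j.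
  by have [[_ _ _ h] _ _ _] := WE j (x j); exact: le_lt_trans h (NW j).
have N5 j : j.+2%:R * (ln (2 * M j (x j)) + ln (`|iv (x j)| + M j (x j))) <= ln (N j).
  have [_ h _ _] := WE j (x j); rewrite -[leLHS]expRK ler_ln ?posrE ?expR_gt0//.
  exact: le_trans h (ltW (NW j)).
have N7 j : j%:R <= ln (N j).
  have [_ _ _ h] := WE j (x j); rewrite -[leLHS]expRK ler_ln ?posrE ?expR_gt0//.
  exact: le_trans h (ltW (NW j)).
exists xi; split.
- apply/Q_independentP => l hl; apply/eqP/negPn/negP => l0.
  pose k := pickle l; have fk : form k = l by rewrite /form pickleK.
  have [j [jk kj yl]] : exists j, [/\ j./2 = k, (k <= j)%N & y j (x j) *m l != 0].
    have [yl|yl] := eqVneq (y k.*2 (x k.*2) *m l) 0; last first.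
      by exists k.*2; split; [rewrite doubleK|rewrite -addnn leq_addr|].
    exists k.*2.+1; split; [by rewrite -uphalfE uphalf_double|by rewrite ltnW// ltnS -addnn leq_addr|].
    have y1E : y k.*2.+1 (x k.*2.+1) = Y (x k.*2.+1, l) by rewrite /y -uphalfE uphalf_double fk.
    have y0E : y k.*2 (x k.*2) = Y (x k.*2, l) by rewrite /y doubleK fk.
    have [_ _ h] := hY (x k.*2, l); have [_ h2 _] := hY (x k.*2.+1, l).
    rewrite y1E; apply: h2; rewrite y0E in yl.
    have h' : exists2 y', admissible S (x k.*2.+1) y' & y' *m l != 0.
      by rewrite xS y0E; exact: (h l0 yl).
    exact: h'.
  have xl : (x j.+1 *m l) 0 0 != 0.
    rewrite xS mulmxDl -scalemxAl mxE [X in X + _]mxE.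
    have := N4 j; rewrite jk fk -[N j]/((multiplier W j (x j))%:Z%:~R) ltr_int => hN.
    have yl0 : (y j (x j) *m l) 0 0 != 0.
      by apply: contra_neq yl => h; apply/matrixP => a b; rewrite !ord1 h mxE.
    have [->|xl0] := eqVneq ((x j *m l) 0 0) 0; first by rewrite mulr0 add0r.
    rewrite addr_eq0; apply/eqP => h; move: hN; rewrite -normrN -h normrM.
    have : 1 <= `|(x j *m l) 0 0| by rewrite -gtz0_ge1 normr_gt0.
    by rewrite ger0_norm//; move: (`|_|) (multiplier W j (x j)) => a b; nia.
  have [P P1 hP] := hxi j.+1; rewrite -/(D _) in hP.
  have : `|(x j.+1 *m l) 0 0|%:~R < 1 :> R.
    rewrite intr_norm.
    have -> : ((x j.+1 *m l) 0 0)%:~R = ((iv (x j.+1) - P *: xi) *m map_mx intr l) 0 0 :> R.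
      by rewrite mulmxBl -scalemxAl hl scaler0 subr0 -map_mxM [RHS]mxE.
    rewrite mxE; apply: le_lt_trans (ler_norm_sum _ _ _) _.
    apply: le_lt_trans (D2 j.+1); apply: le_trans (_ : D j.+1 * nrm l <= _).
      rewrite mulr_sumr; apply: ler_sum => a _.
      rewrite normrM [map_mx intr l _ _]mxE -intr_norm ler_wpM2r ?ler0z//.
      exact: le_trans (norm_coord _ _) hP.
    rewrite ler_wpM2l// -fk (bigD1 (Ordinal (leqW kj : (k < j.+2)%N)))//= lerDl.
    by apply: sumr_ge0.
  by rewrite ltrz1 => h; move: xl; rewrite -normr_gt0 gtz0_ge1 leNgt h.
- have [C C0 hC] := bf_bound (map_mx intr S : 'M[R]_n.+1).
  have STR : (map_mx intr S : 'M[R]_n.+1)^T = map_mx intr S by rewrite map_trmx ST.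
  apply/eqP; rewrite -normr_eq0 eq_le normr_ge0 andbT leNgt; apply/negP.
  set b := bf _ xi xi => b0.
  have h j : (0 < j)%N -> `|b| * j%:R <= 2 * C * `|xi| + C.
    move=> j0; have [P P1 hP] := hxi j; rewrite -/(D _) in hP.
    set d := iv (x j) - P *: xi in hP.
    have ex : iv (x j) = P *: xi + d by rewrite addrC subrK.
    have : bf (map_mx intr S) (iv (x j)) (iv (x j)) = 0 by rewrite bf_map Qx.
    rewrite ex; clearbody d; rewrite bf_combine// -/b => h.
    have D1 : D j <= 1.
      by apply: le_trans (D6 j); rewrite ler_peMr// ler1n.
    have h1 : `|bf (map_mx intr S) xi d| <= C * `|xi| * D j.
      by apply: le_trans (hC _ _) _; rewrite ler_wpM2l// mulr_ge0// ltW.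
    have h2 : `|bf (map_mx intr S) d d| <= C * D j.
      apply: le_trans (hC _ _) _; rewrite -mulrA ler_wpM2l ?(ltW C0)//.
      apply: le_trans (_ : D j * D j <= _); first by apply: ler_pM.
      by rewrite ler_piMr.
    have P0 : 0 <= P by apply: le_trans P1.
    have h3 : `|P ^+ 2 * b| <= P ^+ 2 * ((2 * C * `|xi| + C) * D j).
      have -> : P ^+ 2 * b = - (2 * P * bf (map_mx intr S) xi d + bf (map_mx intr S) d d).
        by move: h; lra.
      rewrite normrN; apply: le_trans (ler_normD _ _) _.
      rewrite !normrM (ger0_norm (ler0n R 2)) (ger0_norm P0).
      have PP : P <= P ^+ 2 by rewrite expr2 ler_peMl.
      have k1 : P * `|bf (map_mx intr S) xi d| <= P ^+ 2 * (C * `|xi| * D j) by apply: ler_pM.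
      have k2 : 1 * `|bf (map_mx intr S) d d| <= P ^+ 2 * (C * D j).
        by apply: ler_pM => //; apply: le_trans PP.
      by move: k1 k2; lra.
    have P2 : 0 < P ^+ 2 by rewrite exprn_gt0// (lt_le_trans ltr01).
    move: h3; rewrite normrM (ger0_norm (ltW P2)) ler_pM2l// => h3.
    apply: le_trans (ler_wpM2r (ler0n _ j) h3) _; rewrite -[leLHS]mulrA ler_piMr//.
    by rewrite addr_ge0 ?(ltW C0)// mulr_ge0// mulr_ge0// ltW.
  have := h (Num.truncn ((2 * C * `|xi| + C) / `|b|)).+1 isT.
  rewrite leNgt => /negP; apply; rewrite [ltRHS]mulrC -ltr_pdivrMr//.
  by rewrite truncnS_gt.
- move=> l hl; apply: (@unif_le _ _ _ (Num.max l 0)); first by rewrite le_max lexx.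
  have {hl} : Num.max l 0 < 1 by rewrite gt_max hl ltr01.
  have : 0 <= Num.max l 0 by rewrite le_max lexx orbT.
  move: (Num.max l 0) => {}l l0 hl.
  pose T j := if j is j'.+1 then ln (N j' * (`|iv (x j')| + M j' (x j'))) else ln `|iv (x 0%N)|.
  have sum1 j : 1 <= `|iv (x j)| + M j (x j) by rewrite -[leLHS]add0r lerD.
  have TS j : T j.+1 = ln (N j) + ln (`|iv (x j)| + M j (x j)).
    by rewrite /= lnM ?posrE// (lt_le_trans ltr01).
  apply: (@unif_of_seq _ _ _ _ x T) => //.
    move=> K; exists (Num.truncn K).+2 => -[//|j]; rewrite ltnS => hj; rewrite TS.
    apply: le_trans (_ : j%:R <= _).
      by apply: le_trans (ltW (truncnS_gt K)) _; rewrite ler_nat.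
    by apply: le_trans (N7 j) _; rewrite lerDl ln_ge0.
  have l1 : 0 < 1 - l by rewrite subr_gt0.
  exists (Num.truncn (1 - l)^-1).+1 => j hj; split.
    case: j {hj} => [|j]; first by rewrite lnK// posrE (lt_le_trans ltr01)// norm_iv_ge1.
    rewrite /T lnK; first exact: walk_norm.
    by rewrite posrE mulr_gt0 // (lt_le_trans ltr01 (sum1 j)).
  have [P P1 hP] := hxi j; exists P; apply: le_trans hP _; rewrite -/(D j).
  (* From here on the growing power [j.+2] in [w5] outweighs the fixed deficit [1 - l]. *)
  have jl : 1 <= (1 - l) * j.+2%:R.
    rewrite mulrC -ler_pdivrMr// div1r; apply: le_trans (ltW (truncnS_gt _)) _.
    by rewrite ler_nat ltnW// ltnW.
  have -> : D j = expR (ln (2 * M j (x j)) - ln (N j)).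
    by rewrite expRD expRN !lnK ?posrE// mulr_gt0.
  rewrite ler_expR TS; have := N5 j.
  have : 0 <= ln (2 * M j (x j)) by rewrite ln_ge0//; have := M1 j (x j); lra.
  have : 0 <= ln (`|iv (x j)| + M j (x j)) by rewrite ln_ge0.
  move: (ln (2 * _)) (ln (`|_| + _)) (ln (N j)) => a b c b0 a0 h.
  have h1 : (a + b) * 1 <= (a + b) * ((1 - l) * j.+2%:R) by rewrite ler_wpM2l// addr_ge0.
  have h2 : (1 - l) * (j.+2%:R * (a + b)) <= (1 - l) * c by rewrite ler_wpM2l// ltW.
  have h3 : l * b <= 1 * b by rewrite ler_wpM2r// ltW.
  by move: h1 h2 h3; lra.
- move=> j c hc; have [P P1 hP] := hxi j; rewrite -/(D _) in hP.
  have := le_lt_trans hP (D3 j); rewrite hc scalerA ltr_pdivlMr ?ltr_pwDl// mulrC => h.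
  by have := dist_le (p0 j) (x j) (P * c); rewrite leNgt h.
Qed.

End Avoid.

(** * Points of the hypersurface *)

Section Points.
Context (R : realType) (n : nat) (q : mpoly.mpoly n.+1 rat) (S : 'M[int]_n.+1) (k : rat).
Hypotheses (n1 : (1 < n)%N) (ST : S^T = S) (S0 : S != 0) (k0 : k != 0)
  (hqS : forall x : 'rV[R]_n.+1, qval (qreal R q) x = ratr k * bf (map_mx intr S) x x).
Implicit Types (xi : projective_space R n) (v : 'rV[R]_n.+1).
Local Notation Zli := (li_points (hypersurface R q)).

Lemma Zli_nrep xi : Zli xi -> [/\ nrep xi 0 0 = 1, Q_independent (nrep xi),
  bf (map_mx intr S) (nrep xi) (nrep xi) = 0 & forall l, unif (rep xi) l <-> unif (nrep xi) l].
Proof. by move=> /(li_pointsP xi k0 hqS)[h1 h2]; exact: nrepP. Qed.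

Lemma nrep_inj xi xi' c : Zli xi -> nrep xi = c *: nrep xi' -> xi = xi'.
Proof.
move=> /(li_pointsP xi k0 hqS)[hl _]; have r0 := Q_independent_coord_neq0 0 hl.
rewrite /nrep => /(congr1 (fun v => rep xi 0 0 *: v)); rewrite !scalerA divff// scale1r => h.
apply: (point_eq _ h); apply: contraNneq (rep_neq0 xi) => h0.
by rewrite h h0 scale0r.
Qed.

Lemma Zli_exists v mu : Q_independent v -> bf (map_mx intr S) v v = 0 ->
  (forall l, l < mu -> unif v l) -> exists xi,
  [/\ exists2 c, c != 0 & rep xi = c *: v, Zli xi & (mu%:E <= lambda_hat xi)%E].
Proof.
move=> li Qv hu; have v0 : v != 0.
  by apply: contraNneq (Q_independent_coord_neq0 0 li) => ->; rewrite mxE.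
have [xi [c c0 e]] := point_exists v0; exists xi; split; first by exists c.
  apply/(li_pointsP xi k0 hqS); rewrite e; split; first exact: Q_independentZ.
  by rewrite bfZl bfZr Qv !mulr0.
apply: lambda_hat_ge => l hl; rewrite e; apply: unif_scale => //; exact: hu.
Qed.

Lemma lambda_hat_set_eq (mu : R) xi : Zli xi -> (mu%:E <= lambda_hat xi)%E ->
  (forall xi', Zli xi' -> (lambda_hat xi' <= mu%:E)%E) ->
  lambda_hat_set (hypersurface R q) = mu%:E.
Proof.
move=> hxi hge hle; apply/eqP; rewrite eq_le; apply/andP; split.
  by apply: ge_ereal_sup => _ [xi' hxi' <-]; exact: hle.
by apply: le_trans hge _; apply: ereal_sup_ubound; exists xi.
Qed.

Lemma lambda_hat_le1 xi : Zli xi -> (lambda_hat xi <= 1%:E)%E.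
Proof.
move=> /Zli_nrep[v0 li Qv hu]; apply: lambda_hat_le => l l1 /hu.
exact: unif_le1 v0 _ li (ltnW n1) l1.
Qed.

Section SmallIndex.
Context (rho : R).
Hypotheses (rho1 : 1 < rho) (rho2 : rho < 2) (hrho : root (rho_poly R n) rho).
Hypothesis hw : witt_le1 (map_mx intr S).

Lemma lambda_hat_le_rho xi : Zli xi -> (lambda_hat xi <= rho^-1%:E)%E.
Proof.
move=> /Zli_nrep[v0 li Qv hu]; apply: lambda_hat_le => l hl /hu.
exact: (unif_le_rho n1 ST S0 hw rho1 rho2 hrho v0 li Qv hl).
Qed.

Lemma extremal_points_countable : countable [set xi | Zli xi /\ lambda_hat xi = rho^-1%:E].
Proof.
set E := [set xi | _].
have hE xi : exists y : nat -> 'rV[int]_n.+1, E xi -> recurrent_seq S y /\ approximating (nrep xi) y.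
  have [[hz hl]|hn] := pselect (E xi); last by exists (fun=> 0).
  have [v0 li Qv hu] := Zli_nrep hz.
  have [|y hy] := recurrent_exists n1 ST S0 hw rho1 rho2 hrho v0 li Qv; last by exists y.
  by move=> l ll; apply/hu; exact: unif_of_lambda_hat hl ll.
have [y hy] := choice hE.
apply/countable_injP; exists (fun xi => pickle [ffun j : 'I_n.+1 => y xi j]).
move=> xi xi'; rewrite !inE => h h' /(pcan_inj (@pickleK _)) e.
have [v0 _ _ _] := Zli_nrep h.1; have [v'0 _ _ _] := Zli_nrep h'.1.
have [r1 a1] := hy _ h; have [r2 a2] := hy _ h'.
apply: (@nrep_inj xi xi' 1) => //; rewrite ?scale1r; first exact: h.1.
apply: (recurrent_unique v0 v'0 r1 a1 r2 a2) => j jn.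
by move/ffunP: e => /(_ (Ordinal (jn : (j < n.+1)%N))); rewrite !ffunE.
Qed.

Lemma extremal_points_infinite (v : 'rV[R]_n.+1) : extremal S rho v ->
  infinite_set [set xi | Zli xi /\ lambda_hat xi = rho^-1%:E].
Proof.
move=> hv; have [f [hf finj]] := extremal_infinite n1 ST S0 hv.
have hg i : exists xi, (Zli xi /\ lambda_hat xi = rho^-1%:E) /\ exists2 c, c != 0 & rep xi = c *: f i.
  have [h1 h2 h3] := hf i; have [xi [hc hz hl]] := Zli_exists h1 h2 h3; exists xi; split => //.
  by split => //; apply/eqP; rewrite eq_le hl lambda_hat_le_rho.
have [g hgE] := choice hg.
have ginj : {in [set: nat] &, injective g}.
  move=> i j _ _ eij; apply/eqP/negPn/negP => ij.
  have [_ [c c0 ec]] := hgE i; have [_ [c' c'0 ec']] := hgE j.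
  apply: (finj i j (c^-1 * c') ij); rewrite -scalerA -ec' -eij ec scalerA mulVf// scale1r.
  by [].
apply/infiniteP; apply: card_le_trans (_ : [set g i | i in [set: nat]] #<= _)%card.
  by have := inj_card_eq ginj; rewrite card_eq_le => /andP[].
by apply: subset_card_le => _ [i _ <-]; have [] := hgE i.
Qed.

End SmallIndex.

Lemma maximal_points_uncountable e1 f1 e2 f2 xi0 : hyperbolic_quadruple S e1 f1 e2 f2 ->
  Zli xi0 -> ~ countable [set xi | Zli xi /\ lambda_hat xi = 1%:E].
Proof.
move=> hq hz0 /countable_injP[h hinj].
have hp j : exists xi', Zli xi' /\ forall xi, Zli xi -> lambda_hat xi = 1%:E -> h xi = j -> xi' = xi.
  have [[xi [hz hl hj]]|hno] := pselect (exists xi, [/\ Zli xi, lambda_hat xi = 1%:E & h xi = j]).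
    by exists xi; split => // xi' hz' hl' hj'; apply: hinj; rewrite ?inE// hj hj'.
  by exists xi0; split => // xi hz hl hj; case: hno; exists xi.
have [p hpE] := choice hp.
have [j|j|xi [li Qxi hu hav]] := @isotropic_avoiding R n S e1 f1 e2 f2 (ltnW n1) ST hq (fun j => nrep (p j)).
- by have [] := Zli_nrep (hpE j).1.
- by have [] := Zli_nrep (hpE j).1.
have [pt [[c c0 ec] hz hl]] := Zli_exists li Qxi hu.
have hl1 : lambda_hat pt = 1%:E by apply/eqP; rewrite eq_le hl lambda_hat_le1.
have := (hpE (h pt)).2 pt hz hl1 erefl => ept.
apply: (hav (h pt) (c^-1 * rep pt 0 0)); rewrite ept /nrep scalerA -mulrA divff.
  by rewrite mulr1 ec scalerA mulVf// scale1r.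
by have /(li_pointsP pt k0 hqS)[+ _] := hz; exact: Q_independent_coord_neq0.
Qed.

End Points.

Theorem theorem1p1 (R : realType) (n : nat) (q : mpoly.mpoly n.+1 rat) (m : nat)
  (hn : (2 <= n)%N)
  (hq : quadratic_form q)
  (hZ : hypersurface R q !=set0)
  (hm : is_witt_index q m)
  (hli : li_points (hypersurface R q) !=set0) :
  exists rho : R,
    [/\ 1 < rho < 2,
        root (rho_poly R n) rho
      & forall x : R, 0 < x -> root (rho_poly R n) x -> x = rho] /\
    lambda_hat_set (hypersurface R q) = (if (m <= 1)%N then rho^-1 else 1)%:E /\
    (let E := [set xi | li_points (hypersurface R q) xi /\
                        lambda_hat xi = lambda_hat_set (hypersurface R q)] in
     ((m <= 1)%N -> (E #= [set: nat])%card) /\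
     ((1 < m)%N -> ~ countable E)).
Proof.
have [rho [rho12 hrho huniq]] := rho_exists R hn; have /andP[rho1 rho2] := rho12.
have [S [k [ST S0 k0 hqQ hqR]]] := quad_matrix hq.
have [xi0 hz0] := hli; have [n01 li0 Q0 _] := Zli_nrep k0 (hqR R) hz0.
exists rho; split => //; case: (leqP m 1) => m1.
  have hw := witt_index_le1 (_ : (map_mx intr S : 'M[rat]_n.+1)^T = map_mx intr S) k0 hqQ hm m1.
  have {}hw : witt_le1 (map_mx intr S) by apply: hw; rewrite map_trmx ST.
  have [v hv] := extremal_exists hn ST S0 rho1 rho2 hrho li0 Q0.
  have [v1 v2 v3] := hv; have [xi [_ hz hl]] := Zli_exists k0 (hqR R) v1 v2 v3.
  have e : lambda_hat_set (hypersurface R q) = rho^-1%:E.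
    apply: (lambda_hat_set_eq hz hl) => xi'.
    exact: (lambda_hat_le_rho hn ST S0 k0 (hqR R) rho1 rho2 hrho hw).
  split => //; split => //= _; rewrite e; apply: eq_card_nat.
    exact: (extremal_points_countable hn ST S0 k0 (hqR R) rho1 rho2 hrho hw).
  exact: (extremal_points_infinite hn ST S0 k0 (hqR R) rho1 rho2 hrho hw hv).
have [e1 [f1 [e2 [f2 hquad]]]] := witt_quadruple ST k0 hqQ hm m1.
(* For the value of the supremum any list to avoid will do; a constant one is taken. *)
have [v [v1 v2 v3 _]] := @isotropic_avoiding R n S e1 f1 e2 f2 (ltnW hn) ST hquad (fun=> nrep xi0)
  (fun=> n01) (fun=> li0).
have [xi [_ hz hl]] := Zli_exists k0 (hqR R) v1 v2 v3.
have e : lambda_hat_set (hypersurface R q) = 1%:E.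
  by apply: (lambda_hat_set_eq hz hl) => xi'; exact: (lambda_hat_le1 hn k0 (hqR R)).
split => //; split => //= _; rewrite e.
exact: (maximal_points_uncountable hn ST k0 (hqR R) hquad hz0).
Qed.
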